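(* Let $(A(n))_{n\ge1}$ be an i.i.d. sequence of random topical operators on $\mathbb R^d$ with the memory loss property, and let $\phi:\mathbb R^d\to\mathbb R$ be topical. Assume that $\sup_x|\phi(A(1)x)-\phi(x)|$ has an exponential moment (i.e. $\mathbb E[e^{\theta\sup_x|\phi(A(1)x)-\phi(x)|}]<\infty$ for some $\theta>0$), and that $\sigma^2>0$, where $\sigma^2$ is the constant such that $\frac{x(n,X^0)-n\gamma\mathbf 1}{\sqrt n}$ converges weakly to a random vector with equal coordinates of law $\mathcal N(0,\sigma^2)$. Then there exists a nonnegative strictly convex function $c$, defined on a neighbourhood of $0$ and vanishing only at $0$, such that for every bounded $\mathbb R^d$-valued random variable $X^0$ independent of $(A(n))$ and every sufficiently small $\epsilon>0$: $$\lim_n\frac1n\ln\mathbb P[\phi(x(n,X^0))-n\gamma>n\epsilon]=-c(\epsilon),\qquad \lim_n\frac1n\ln\mathbb P[\phi(x(n,X^0))-n\gamma<-n\epsilon]=-c(-\epsilon).$$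
   Context: A map $A:\mathbb R^d\to\mathbb R^d$ is topical if it is isotone ($x\le y$ coordinatewise implies $Ax\le Ay$) and additively homogeneous ($A(x+a\mathbf 1)=Ax+a\mathbf 1$, $\mathbf 1=(1,\dots,1)'$). A map $\phi:\mathbb R^d\to\mathbb R$ is topical if isotone and $\phi(x+a\mathbf 1)=\phi(x)+a$. $\mathbb{PR}^d_{\max}$ is the quotient of $\mathbb R^d$ by $x\sim y\iff x-y\in\mathbb R\mathbf 1$, $\bar x$ the class of $x$. $A$ has rank 1 if $\overline{Ax}$ does not depend on $x$. The sequence has the memory loss property if some $A(N)\cdots A(1)$ has rank 1 with positive probability. $x(0,X^0)=X^0$, $x(n,X^0)=A(n)x(n-1,X^0)$; $\gamma$ is the Lyapunov exponent ($x(n,X^0)/n\to\gamma\mathbf 1$ a.s.). *)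

(* Defs.v *)
From HB Require Import structures.
From mathcomp Require Import all_boot all_order all_algebra.
From mathcomp Require Import all_classical all_reals all_analysis.

Set Implicit Arguments.
Unset Strict Implicit.
Unset Printing Implicit Defensive.

Import Order.TTheory GRing.Theory Num.Theory.
Import numFieldNormedType.Exports.

Local Open Scope classical_set_scope.
Local Open Scope ring_scope.

Section topical.
Variables (R : realType) (d : nat).

Definition vle (x y : 'rV[R]_d) : Prop := forall i : 'I_d, x ord0 i <= y ord0 i.

Definition cvec (a : R) : 'rV[R]_d := const_mx a.

Definition topical_op (A : 'rV[R]_d -> 'rV[R]_d) : Prop :=
  (forall x y, vle x y -> vle (A x) (A y)) /\
  (forall x a, A (x + cvec a) = A x + cvec a).

Definition topical_fun (phi : 'rV[R]_d -> R) : Prop :=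
  (forall x y, vle x y -> phi x <= phi y) /\
  (forall x a, phi (x + cvec a) = phi x + a).

(** rank 1: the class of A x in PR^d_max (R^d modulo R.1) does not depend on x *)
Definition rank_one (A : 'rV[R]_d -> 'rV[R]_d) : Prop :=
  forall x y, exists a : R, A x = A y + cvec a.

Definition strictly_convex_on (I : set R) (c : R -> R) : Prop :=
  forall x y t, I x -> I y -> x != y -> 0 < t < 1 ->
    c (t * x + (1 - t) * y) < t * c x + (1 - t) * c y.

End topical.

Section random.
Context {dT : measure_display} {T : measurableType dT} {R : realType} {d : nat}.

(** Random operators are indexed from 0: [A n] is the paper's A(n+1). *)

Fixpoint traj (A : nat -> T -> 'rV[R]_d -> 'rV[R]_d) (X0 : T -> 'rV[R]_d)
    (n : nat) (w : T) : 'rV[R]_d :=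
  match n with
  | 0 => X0 w
  | n'.+1 => A n' w (traj A X0 n' w)
  end.

Definition sigma_op (A : T -> 'rV[R]_d -> 'rV[R]_d) : set (set T) :=
  <<s [set E | exists (x : 'rV[R]_d) (i : 'I_d) (B : set R),
                 measurable B /\ E = (fun w => A w x ord0 i) @^-1` B] >>.

Definition sigma_vec (X : T -> 'rV[R]_d) : set (set T) :=
  <<s [set E | exists (i : 'I_d) (B : set R),
                 measurable B /\ E = (fun w => X w ord0 i) @^-1` B] >>.

Definition random_op (A : T -> 'rV[R]_d -> 'rV[R]_d) : Prop :=
  forall (x : 'rV[R]_d) (i : 'I_d), measurable_fun setT (fun w => A w x ord0 i).

Definition random_vec (X : T -> 'rV[R]_d) : Prop :=
  forall i : 'I_d, measurable_fun setT (fun w => X w ord0 i).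

Definition iid_ops (P : probability T R) (A : nat -> T -> 'rV[R]_d -> 'rV[R]_d)
  : Prop :=
  (forall n, random_op (A n)) /\
  (forall (s : seq nat) (E : nat -> set T), uniq s ->
     (forall n, n \in s -> sigma_op (A n) (E n)) ->
     P (\big[setI/setT]_(n <- s) E n) = (\prod_(n <- s) P (E n))%E) /\
  (forall (n k : nat) (x : 'I_k -> 'rV[R]_d) (i : 'I_k -> 'I_d) (B : 'I_k -> set R),
     (forall j, measurable (B j)) ->
     P [set w | forall j, B j (A n w (x j) ord0 (i j))] =
     P [set w | forall j, B j (A 0 w (x j) ord0 (i j))]).

Definition indep_of_ops (P : probability T R) (X0 : T -> 'rV[R]_d)
  (A : nat -> T -> 'rV[R]_d -> 'rV[R]_d) : Prop :=
  forall E F, sigma_vec X0 E -> <<s \bigcup_n sigma_op (A n) >> F ->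
    P (E `&` F) = (P E * P F)%E.

Definition memory_loss (P : probability T R) (A : nat -> T -> 'rV[R]_d -> 'rV[R]_d)
  : Prop :=
  exists N : nat, (0 < N)%N /\ exists E : set T, measurable E /\ (0 < P E)%E /\
    forall w, E w -> rank_one (fun x => traj A (fun _ => x) N w).

End random.

(* Main.v *)
Require Import Defs.
From HB Require Import structures.
From mathcomp Require Import all_boot all_order all_algebra.
From mathcomp Require Import all_classical all_reals all_analysis.
From mathcomp Require Import measurable_realfun ring lra.

Import Order.TTheory GRing.Theory Num.Theory.
Import numFieldNormedType.Exports.

Set Implicit Arguments.
Unset Strict Implicit.
Unset Printing Implicit Defensive.

Local Open Scope classical_set_scope.
Local Open Scope ring_scope.

(* Only the central limit theorem, the exponential moment and the memory loss
   are needed.  Let X_n(x) be the orbit of x and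
   f_n(th, x) = E exp(th (phi(X_n(x)) - phi(x))).  By the Markov property,
   f_(n+N)(th, .) is obtained from f_n(th, .) by a positive kernel that forgets
   the starting point on the memory loss event, and for small th this event
   carries a fixed proportion of the tilted mass.  A Doeblin argument then shows
   that f_n(th, x) and f_n(th, y) are comparable uniformly in n, and that
   f_n(th + h, .) / f_n(th, .) has relative oscillation O(|h|) uniformly in n.
   So each block multiplies this ratio by at most 1 + O(|h|), and
   f_n(th + h) f_n(th - h) / f_n(th)^2 by at most 1 + O(h^2).
   Hence ln f_n(th, .) = n Lam(th) + O(1), where Lam is Lipschitz and
   Lam(th + h) + Lam(th - h) - 2 Lam(th) <= K h^2.
   If the centred rate Lam(th) - th gamma were <= 0 for some th != 0, Chernoff's
   bound would contradict the central limit theorem at the scale sqrt n; so it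
   is positive away from 0.  Its Legendre transform over a small interval is the
   rate function: the second difference bound makes it strictly convex and
   replaces differentiability in the Gartner-Ellis lower bound. *)

(** The normalisation by [phi x] matters: [phi(X_n(x)) - phi(x)] is unchanged when [x] moves along
    the diagonal, so a rank one block sends all starting points to states with the same future
    moments. Memory loss only has positive probability and increments are unbounded, so the event is
    first cut down to blocks whose total increment is at most some [b]; there a tilt with
    [|th| <= 1] distorts weights by at most [e^b], and [th] is kept so small that the distortion off
    the event cannot outweigh its mass. No eigenfunction of the tilted kernels is constructed: the
    finite-time moments serve instead, the density [exp(th a) f_k / f_(k+1)] turning each tilted
    step into a Markov kernel Q. The O(h^2) gain comes from pairing [th + h] with [th - h]: up to a
    constant free of the starting point, the ratio at [th + h] enters as some [Y = 1 + O(h)], the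
    one at [th - h] as at most a multiple of [1 / Y], and the first order terms of [Q[Y] Q[1 / Y]]
    cancel. The oscillation bound is what frees that constant from the starting point. *)

Section expR_inequalities.
Context {R : realType}.
Implicit Types x y z t : R.

Lemma expR_sub1_le x : expR x - 1 <= x * expR x.
Proof.
have := expR_ge1Dx (- x); rewrite expRN => h.
have e0 := expR_gt0 x.
have : (1 - x) * expR x <= 1.
  by rewrite -ler_pdivlMr// mul1r.
by rewrite mulrBl mul1r => ?; lra.
Qed.

Lemma norm_expR_sub1_le x z : `|x| <= z -> `|expR x - 1| <= z * expR z.
Proof.
move=> xz; have z0 : 0 <= z := le_trans (normr_ge0 _) xz.
have ez : 1 <= expR z by rewrite -expR0 ler_expR.
have [x0 x1] : - z <= x /\ x <= z by move: xz; rewrite ler_norml => /andP.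
rewrite ler_norml; apply/andP; split.
  have := expR_ge1Dx x; have : z <= z * expR z by rewrite ler_peMr.
  by move=> ? ?; lra.
apply: le_trans (expR_sub1_le x) _.
apply: (@le_trans _ _ (z * expR x)); first by rewrite ler_wpM2r// expR_ge0.
by rewrite ler_wpM2l// ler_expR.
Qed.

(** The left side is [expR (- x) * (expR x - 1) ^+ 2]: no first order term survives. This is the
    source of the quadratic bound in [doeblin_inverse]. *)
Lemma expRDN_sub2_le x z : `|x| <= z ->
  expR x + expR (- x) - 2 <= z ^+ 2 * expR z.
Proof.
wlog x0 : x / 0 <= x => [h xz|].
  have [x0|x0] := leP 0 x; first exact: h.
  rewrite addrC (addrC (expR x)) -{2}(opprK x) addrC; apply: h; rewrite ?normrN//.
  by rewrite oppr_ge0 ltW.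
rewrite ger0_norm// => xz.
have -> : expR x + expR (- x) - 2 = expR (- x) * (expR x - 1) ^+ 2.
  rewrite expRN; field; exact: lt0r_neq0 (expR_gt0 x).
have h1 : (expR x - 1) ^+ 2 <= (x * expR x) ^+ 2.
  rewrite ler_sqr ?nnegrE ?expR_sub1_le ?subr_ge0 -?expR0 ?ler_expR//.
  by rewrite mulr_ge0 ?expR_ge0.
apply: (@le_trans _ _ (x ^+ 2 * expR x)).
  apply: le_trans (ler_wpM2l (expR_ge0 _) h1) _.
  rewrite exprMn mulrCA ler_wpM2l ?sqr_ge0// expr2 mulrA -expRD addNr expR0.
  by rewrite mul1r.
rewrite ler_pM ?expR_ge0 ?sqr_ge0 ?ler_expR//.
by rewrite ler_sqr ?nnegrE//; exact: le_trans xz.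
Qed.

(** Trades a factor [x] for an arbitrarily small exponential weight. *)
Lemma le_expRM x t : 0 < t -> x <= t^-1 * expR (t * x).
Proof.
move=> t0; rewrite mulrC ler_pdivlMr// mulrC.
by have := expR_ge1Dx (t * x); lra.
Qed.

End expR_inequalities.

(** * Almost additive sequences and their growth rates *)

Section quasi_additive.
Context {R : realType}.
Implicit Types (b : nat -> R) (c u : R).

Lemma natmul_bounded_le0 u c : (forall k : nat, k%:R * u <= c) -> u <= 0.
Proof.
move=> h; rewrite leNgt; apply/negP => u0.
have := h (Num.truncn (c / u)).+1.
rewrite leNgt => /negP; apply.
by rewrite -ltr_pdivrMr// truncnS_gt.
Qed.

(** Fekete's argument in two-sided form: comparing [b (k * l)] with both [k * b l] and [l * b k]
    puts every lower quotient [(b k - 2 * c) / k] below every upper quotient [(b l + 2 * c) / l];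
    [L] is the supremum of the former. *)
Lemma quasi_additive b c : (forall k l, `|b (k + l)%N - b k - b l| <= c) ->
  exists L, forall k, `|b k - k%:R * L| <= 2 * c.
Proof.
move=> bc; have c0 : 0 <= c := le_trans (normr_ge0 _) (bc 0%N 0%N).
have mul k l : `|b (l * k)%N - l%:R * b k| <= l.+1%:R * c.
  elim: l => [|l IH].
    rewrite mul0n mul0r subr0 mul1r; have := bc 0%N 0%N.
    by rewrite addn0 subrr add0r normrN.
  have := lerD (bc k (l * k)%N) IH; rewrite -mulSn => /(le_trans (ler_normD _ _)).
  rewrite (_ : _ - _ + _ = b (l.+1 * k)%N - l.+1%:R * b k); last first.
    by rewrite -(natr1 l); ring.
  by move=> /le_trans; apply; rewrite -(natr1 l.+1); lra.
pose E := [set (b k.+1 - 2 * c) / k.+1%:R | k in [set: nat]].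
have le2 k l : (b k.+1 - 2 * c) / k.+1%:R <= (b l.+1 + 2 * c) / l.+1%:R.
  rewrite ler_pdivrMr ?ltr0n// mulrAC ler_pdivlMr ?ltr0n//.
  have := mul k.+1 l.+1; have := mul l.+1 k.+1; rewrite mulnC.
  rewrite !ler_norml => /andP[_ h1] /andP[h2 _].
  have h3 : l.+2%:R * c + k.+2%:R * c <= 2 * c * l.+1%:R + 2 * c * k.+1%:R.
    rewrite -(natr1 k.+1) -(natr1 l.+1).
    have hk : c * 1 <= c * k.+1%:R by rewrite ler_wpM2l// ler1n.
    have hl : c * 1 <= c * l.+1%:R by rewrite ler_wpM2l// ler1n.
    by lra.
  by lra.
have E0 : has_sup E.
  split; first by exists ((b 1%N - 2 * c) / 1%:R); exists 0%N.
  by exists ((b 1%N + 2 * c) / 1%:R) => _ [k _ <-].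
(* The quotients start at index 1; index 0 only needs [|b 0| <= c]. *)
exists (sup E) => -[|k].
  by have := bc 0%N 0%N; rewrite addn0 subrr add0r normrN mul0r subr0 => h; lra.
have h1 : (b k.+1 - 2 * c) / k.+1%:R <= sup E.
  by apply: ub_le_sup; [case: E0|exists k].
have h2 : sup E <= (b k.+1 + 2 * c) / k.+1%:R.
  by apply: ge_sup; [case: E0|move=> _ [l _ <-]].
move: h1 h2; rewrite ler_pdivrMr ?ltr0n// ler_pdivlMr ?ltr0n// mulrC => h1 h2.
by rewrite ler_norml; apply/andP; split; lra.
Qed.

(** After multiplication by [k] the inequality holds up to [2 * c], an error that disappears as [k]
    grows. *)
Lemma growth_rate_le (a1 a2 : nat -> R) (L1 L2 x c : R) :
  (forall k, `|a1 k - k%:R * L1| <= c) -> (forall k, `|a2 k - k%:R * L2| <= c) ->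
  (forall k, a1 k <= a2 k + k%:R * x) -> L1 - L2 <= x.
Proof.
move=> h1 h2 h; rewrite -subr_le0; apply: (@natmul_bounded_le0 _ (2 * c)) => k.
have := h1 k; have := h2 k; have := h k; rewrite !ler_norml.
by move=> ? /andP[? ?] /andP[? ?]; lra.
Qed.

Lemma growth_rate_second_diff_le (a a1 a2 : nat -> R) (L L1 L2 x c : R) :
  (forall k, `|a k - k%:R * L| <= c) ->
  (forall k, `|a1 k - k%:R * L1| <= c) -> (forall k, `|a2 k - k%:R * L2| <= c) ->
  (forall k, a1 k + a2 k <= 2 * a k + k%:R * x) -> L1 + L2 - 2 * L <= x.
Proof.
move=> h0 h1 h2 h; rewrite -subr_le0; apply: (@natmul_bounded_le0 _ (4 * c)) => k.
have := h0 k; have := h1 k; have := h2 k; have := h k; rewrite !ler_norml.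
by move=> ? /andP[? ?] /andP[? ?] /andP[? ?]; lra.
Qed.

End quasi_additive.

(** * Integrability of functions dominated by an exponential of [S] *)

Section dominated.
Context {d} {T : measurableType d} {R : realType}.
Variables (P : {measure set T -> \bar R}) (D : set T) (S : T -> R) (eta : R).
Hypotheses (mD : measurable D) (PD : P D = 1%E).
Hypotheses (mS : measurable_fun D S) (S0 : forall w, D w -> 0 <= S w).
Hypothesis intS : P.-integrable D (EFin \o (fun w => expR (eta * S w))).

(** Bookkeeping for integrability: products add the exponents [k], and an integrand is integrable as
    soon as its total exponent is at most [eta]. *)
Definition dominated (k : R) (u : T -> R) : Prop :=
  measurable_fun D u /\ exists C, forall w, D w -> `|u w| <= C * expR (k * S w).

Local Notation Ex u := (\int[P]_(w in D) u w).

Lemma dominated_integrable u : dominated eta u -> P.-integrable D (EFin \o u).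
Proof.
move=> [mu [C uC]].
apply: (@le_integrable _ _ _ P D mD _ (EFin \o (fun w => `|C| * expR (eta * S w)))).
- exact/measurable_EFinP.
- move=> w Dw /=; rewrite lee_fin (le_trans (uC _ Dw))//.
  by rewrite ger0_norm ?mulr_ge0 ?expR_ge0// ler_wpM2r ?expR_ge0// ler_norm.
- have := integrableZl mD `|C| intS.
  by apply: eq_integrable => // w _ /=; rewrite EFinM.
Qed.

Lemma dominatedW k k' u : k <= k' -> dominated k u -> dominated k' u.
Proof.
move=> kk' [mu [C uC]]; split=> //; exists C => w Dw.
apply: le_trans (uC _ Dw) _.
have C0 : 0 <= C.
  by rewrite -(pmulr_lge0 _ (expR_gt0 (k * S w))) (le_trans _ (uC _ Dw)).
by rewrite ler_wpM2l// ler_expR ler_wpM2r ?S0.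
Qed.

Lemma dominatedD k u v : dominated k u -> dominated k v ->
  dominated k (fun w => u w + v w).
Proof.
move=> [mu [C uC]] [mv [C' vC]]; split; first exact: measurable_funD.
exists (C + C') => w Dw; rewrite mulrDl (le_trans (ler_normD _ _))// lerD ?uC ?vC//.
Qed.

Lemma dominatedM k l u v : dominated k u -> dominated l v ->
  dominated (k + l) (fun w => u w * v w).
Proof.
move=> [mu [C uC]] [mv [C' vC]]; split; first exact: measurable_funM.
exists (C * C') => w Dw; rewrite normrM mulrDl expRD mulrACA.
by rewrite ler_pM ?uC ?vC.
Qed.

Lemma dominated0M k u v : dominated 0 u -> dominated k v ->
  dominated k (fun w => u w * v w).
Proof. by move=> du dv; have := dominatedM du dv; rewrite add0r. Qed.

Lemma dominated_bounded (C : R) (u : T -> R) : measurable_fun D u ->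
  (forall w, D w -> `|u w| <= C) -> dominated 0 u.
Proof.
move=> mu uC; split=> //; exists C => w Dw.
by rewrite mul0r expR0 mulr1 uC.
Qed.

Lemma dominated_cst (c : R) : dominated 0 (fun=> c).
Proof. exact: (@dominated_bounded `|c|). Qed.

Lemma dominatedZ k (c : R) u : dominated k u -> dominated k (fun w => c * u w).
Proof. exact/dominated0M/dominated_cst. Qed.

Lemma dominatedB k u v : dominated k u -> dominated k v ->
  dominated k (fun w => u w - v w).
Proof.
move=> du dv; have := dominatedD du (dominatedZ (-1) dv).
by under [X in dominated _ X -> _]eq_fun do rewrite mulN1r.
Qed.

Lemma dominated_expR (k c : R) (u : T -> R) : measurable_fun D u ->
  (forall w, D w -> `|u w| <= S w) -> `|c| <= k ->
  dominated k (fun w => expR (c * u w)).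
Proof.
move=> mu uS ck; split.
  by apply: measurableT_comp => //; exact: measurable_funM.
exists 1 => w Dw; rewrite mul1r ger0_norm ?expR_ge0// ler_expR.
by rewrite (le_trans (ler_norm _))// normrM ler_pM ?uS.
Qed.

Lemma dominated_indic (E : set T) : measurable E -> dominated 0 (\1_E : T -> R).
Proof.
move=> mE; apply: (@dominated_bounded 1) => [|w _].
  exact: measurable_indic.
by rewrite indicE; case: (_ \in _); rewrite ?normr1 ?normr0.
Qed.

Lemma measurable_fun_inv_gt0 (u : T -> R) : measurable_fun D u ->
  (forall w, D w -> 0 < u w) -> measurable_fun D (fun w => (u w)^-1).
Proof.
move=> mu u0; apply: (@eq_measurable_fun _ _ _ _ _ (fun w => expR (- ln (u w)))).
  by move=> w; rewrite inE => Dw; rewrite expRN lnK// posrE u0.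
apply: measurableT_comp => //; apply: measurable_funN.
by apply: measurableT_comp => //; exact: measurable_ln.
Qed.

Lemma Ex_D u v : dominated eta u -> dominated eta v ->
  Ex (fun w => u w + v w) = Ex u + Ex v.
Proof. by move=> du dv; rewrite RintegralD//; exact: dominated_integrable. Qed.

Lemma Ex_B u v : dominated eta u -> dominated eta v ->
  Ex (fun w => u w - v w) = Ex u - Ex v.
Proof. by move=> du dv; rewrite RintegralB//; exact: dominated_integrable. Qed.

Lemma Ex_Z c u : dominated eta u -> Ex (fun w => c * u w) = c * Ex u.
Proof. by move=> du; rewrite RintegralZl//; exact: dominated_integrable. Qed.

Lemma Ex_le u v : dominated eta u -> dominated eta v ->
  (forall w, D w -> u w <= v w) -> Ex u <= Ex v.
Proof. by move=> du dv uv; rewrite le_Rintegral//; exact: dominated_integrable. Qed.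

Lemma Ex_cst (c : R) : Ex (fun=> c) = c.
Proof. by rewrite Rintegral_cst// PD mulr1. Qed.

End dominated.

(** * Doeblin estimates for the tilted block kernel *)

Section tilted_iteration.
Context {d} {T : measurableType d} {R : realType}.
Variables (P : {measure set T -> \bar R}) (D : set T) (S : T -> R) (eta : R).
Hypotheses (mD : measurable D) (PD : P D = 1%E).
Hypotheses (mS : measurable_fun D S) (S0 : forall w, D w -> 0 <= S w).
Hypothesis intS : P.-integrable D (EFin \o (fun w => expR (eta * S w))).
(* [X] is the state space, [B x w] the state reached from [x] in one step (a block
   of operators), [a x w] the increment of [phi] along that step and [f th k] the
   moment generating function after [k] steps. *)
Variables (X : Type) (x0 : X) (a : X -> T -> R) (B : X -> T -> X).
Variables (f : R -> nat -> X -> R) (E : set T) (b t : R).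
Hypotheses (ma : forall x, measurable_fun D (a x)).
Hypothesis aS : forall x w, D w -> `|a x w| <= S w.
Hypothesis mf : forall th k x, measurable_fun D (fun w => f th k (B x w)).
Local Notation Ex u := (\int[P]_(w in D) u w).
Hypothesis f0 : forall th x, f th 0 x = 1.
Hypothesis fS : forall th k x, `|th| <= t ->
  f th k.+1 x = Ex (fun w => expR (th * a x w) * f th k (B x w)).
Hypotheses (mE : measurable E) (ED : E `<=` D) (Sb : forall w, E w -> S w <= b).
Hypothesis fE : forall th k x y w, E w -> f th k (B x w) = f th k (B y w).
(** [4 * t] is the exponent of [drift_cst]: [t] for a density, [t] to absorb a factor [S], and
    [2 * t] for a tilt by [|h| <= 2 * t]. *)
Hypotheses (b0 : 0 <= b) (t0 : 0 < t) (t1 : t <= 1) (t4 : 4 * t <= eta).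

Let p := Ex (\1_E : T -> R).
Hypothesis p0 : 0 < p.
(** Smallness of [t]: off [E] the weights of any two starting points lie between [expR (- t * S)]
    and [expR (t * S)]; this gap, amplified by [2 * expR b], has to stay below the mass of [E]. *)
Hypothesis Jp : 2 * expR b *
  Ex (fun w => expR (t * S w) - expR (- t * S w)) <= p.

Local Notation beta := (expR b).
(** One factor [beta] is lost on [E] in the upper bound and one in the lower bound; the 2 leaves
    room for the error made off [E]. *)
Definition comparability_cst := 2 * beta ^+ 2.
Local Notation C0 := comparability_cst.

Local Lemma beta_ge1 : 1 <= beta. Proof. by rewrite -expR0 ler_expR. Qed.

Local Lemma indic01 w : (E w /\ (\1_E w : R) = 1) \/ (~ E w /\ (\1_E w : R) = 0).
Proof.
rewrite indicE; have [wE|wE] := boolP (w \in E); [left|right]; split=> //.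
  by rewrite inE in wE.
by move=> Ew; move: wE; rewrite mem_set.
Qed.

Local Lemma domW k u : dominated D S k u -> k <= 4 * t -> dominated D S eta u.
Proof. by move=> du k4; apply: dominatedW du => //; exact: le_trans t4. Qed.

Local Lemma dom_expS c k : `|c| <= k -> dominated D S k (fun w => expR (c * S w)).
Proof.
by move=> ck; apply: dominated_expR => // w Dw; rewrite ger0_norm ?S0.
Qed.

Local Lemma dom_expa c k x : `|c| <= k -> dominated D S k (fun w => expR (c * a x w)).
Proof. by move=> ck; apply: dominated_expR => // w Dw; exact: aS. Qed.

Local Lemma expa_le c x w : `|c| <= t -> D w ->
  expR (- t * S w) <= expR (c * a x w) <= expR (t * S w).
Proof.
move=> ct Dw; rewrite !ler_expR.
have : `|c * a x w| <= t * S w by rewrite normrM ler_pM// aS.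
by rewrite ler_norml mulNr.
Qed.

Local Lemma expa_le_beta c x w : `|c| <= t -> E w ->
  beta^-1 <= expR (c * a x w) <= beta.
Proof.
move=> ct Ew; rewrite -expRN !ler_expR.
have : `|c * a x w| <= 1 * b.
  rewrite normrM ler_pM// ?(le_trans ct)// (le_trans (aS _ (ED Ew)))//.
  exact: Sb.
by rewrite ler_norml mul1r.
Qed.

(** On [E] the next value does not depend on the start and contributes [G0], up to a factor [beta]
    either way; off [E] the induction hypothesis gives a contribution between [I * J'] and
    [C0 * I * J]. The bounds close up because [G0 >= p * I] pays for [C0 * I * (J - J')]. *)
Lemma iterate_comparable th k : `|th| <= t ->
  exists2 I, 0 < I & forall x, I <= f th k x <= C0 * I.
Proof.
move=> tht; have b1 := beta_ge1.
have C01 : 1 <= C0.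
  by rewrite /C0; have := ler_pM ler01 ler01 b1 b1; rewrite -expr2; lra.
elim: k => [|k [I I0 fI]].
  by exists 1 => // x; rewrite f0 mulr1 lexx.
pose phi w := f th k (B x0 w).
have dphi : dominated D S 0 phi.
  apply: (@dominated_bounded _ _ _ _ _ (C0 * I)) => [|w _]; first exact: mf.
  have /andP[h1 h2] := fI (B x0 w).
  by rewrite ger0_norm// (le_trans _ h1)// ltW.
have d1 := @dominated_indic _ _ R D S E mE.
have dg1 : dominated D S 0 (fun w => \1_E w * phi w).
  exact: dominated0M.
have dn : dominated D S 0 (fun w => 1 - \1_E w).
  exact/dominatedB/d1/dominated_cst.
have dJ : dominated D S t (fun w => (1 - \1_E w) * expR (t * S w)).
  by apply: dominated0M => //; apply: dom_expS; rewrite (ger0_norm (ltW t0)).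
have dJ' : dominated D S t (fun w => (1 - \1_E w) * expR (- t * S w)).
  by apply: dominated0M => //; apply: dom_expS; rewrite normrN (ger0_norm (ltW t0)).
have [t40 tt4] : 0 <= 4 * t /\ t <= 4 * t by have h0 := t0; lra.
pose G0 := Ex (fun w => \1_E w * phi w).
pose J := Ex (fun w => (1 - \1_E w) * expR (t * S w)).
pose J' := Ex (fun w => (1 - \1_E w) * expR (- t * S w)).
have pG : p * I <= G0.
  rewrite mulrC /p -(Ex_Z mD intS)//; last exact: domW d1 _.
  apply: (Ex_le mD intS).
  - exact/(domW _ t40)/dominatedZ.
  - exact: domW dg1 _.
  - move=> w Dw; have /andP[h1 _] := fI (B x0 w).
    by case: (indic01 w) => -[_ ->]; rewrite /phi; lra.
have n0 w : 0 <= 1 - \1_E w :> R by case: (indic01 w) => -[_ ->]; lra.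
have J'0 : 0 <= J'.
  by apply: Rintegral_ge0 => w _; rewrite mulr_ge0// expR_ge0.
have JJ : 2 * beta * (J - J') <= p.
  apply: le_trans Jp; rewrite ler_pM2l; last by lra.
  rewrite -(Ex_B mD intS); [|exact: domW dJ _|exact: domW dJ' _].
  have dt : dominated D S t (fun w => expR (t * S w)).
    by apply: dom_expS; rewrite (ger0_norm (ltW t0)).
  have dt' : dominated D S t (fun w => expR (- t * S w)).
    by apply: dom_expS; rewrite normrN (ger0_norm (ltW t0)).
  apply: (Ex_le mD intS).
  - by apply: (domW _ tt4); exact: dominatedB.
  - by apply: (domW _ tt4); exact: dominatedB.
  - move=> w Dw; rewrite -mulrBr.
    have h : 0 <= expR (t * S w) - expR (- t * S w).
      by rewrite subr_ge0 ler_expR ler_wpM2r ?S0//; have h0 := t0; lra.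
    by case: (indic01 w) => -[_ ->]; lra.
have dfk x : dominated D S t (fun w => expR (th * a x w) * f th k (B x w)).
  have := dominatedM (dom_expa x tht); rewrite -{2}(addr0 t); apply.
  apply: (@dominated_bounded _ _ _ _ _ (C0 * I)) => [|w _]; first exact: mf.
  have /andP[h1 h2] := fI (B x w).
  by rewrite ger0_norm// (le_trans _ h1)// ltW.
have up x : f th k.+1 x <= beta * G0 + (C0 * I) * J.
  rewrite fS// -(Ex_Z mD intS); last exact: domW dg1 _.
  rewrite -(Ex_Z mD intS); last exact: domW dJ _.
  rewrite -(Ex_D mD intS); [|exact/(domW _ t40)/dominatedZ|exact/(domW _ tt4)/dominatedZ].
  apply: (Ex_le mD intS).
  - exact: domW tt4.
  - by apply: (domW _ tt4); apply/dominatedD/dominatedZ => //; apply: dominatedW (ltW t0) _ => //; exact: dominatedZ.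
  - move=> w Dw.
    have /andP[f1 f2] := fI (B x w).
    have fp : 0 <= f th k (B x w) by apply: le_trans f1; exact: ltW.
    have [[Ew ->]|[_ ->]] := indic01 w.
      rewrite mul1r subrr mul0r mulr0 addr0 /phi (fE th k x0 x Ew) ler_wpM2r//.
      by have /andP[] := expa_le_beta x tht Ew.
    rewrite mul0r mulr0 add0r subr0 mul1r mulrC ler_pM ?expR_ge0//.
    by have /andP[] := expa_le x tht Dw.
have lo x : beta^-1 * G0 + I * J' <= f th k.+1 x.
  rewrite fS// -(Ex_Z mD intS); last exact: domW dg1 _.
  rewrite -(Ex_Z mD intS); last exact: domW dJ' _.
  rewrite -(Ex_D mD intS); [|exact/(domW _ t40)/dominatedZ|exact/(domW _ tt4)/dominatedZ].
  apply: (Ex_le mD intS).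
  - by apply: (domW _ tt4); apply/dominatedD/dominatedZ => //; apply: dominatedW (ltW t0) _ => //; exact: dominatedZ.
  - exact: domW tt4.
  - move=> w Dw.
    have /andP[f1 f2] := fI (B x w).
    have fp : 0 <= f th k (B x w) by apply: le_trans f1; exact: ltW.
    have [[Ew ->]|[_ ->]] := indic01 w.
      rewrite mul1r subrr mul0r mulr0 addr0 /phi (fE th k x0 x Ew) ler_wpM2r//.
      by have /andP[] := expa_le_beta x tht Ew.
    rewrite mul0r mulr0 add0r subr0 mul1r mulrC ler_pM ?expR_ge0 ?(ltW I0)//.
    by have /andP[] := expa_le x tht Dw.
have b0' : 0 < beta by lra.
exists (beta^-1 * G0 + I * J') => [|x].
  apply: ltr_pwDl; last by rewrite mulr_ge0// ltW.
  rewrite mulr_gt0 ?invr_gt0//; apply: lt_le_trans pG.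
  by rewrite mulr_gt0.
rewrite lo (le_trans (up x))//.
have -> : C0 * (beta^-1 * G0 + I * J') = 2 * beta * G0 + C0 * I * J'.
  by rewrite /C0; field; rewrite gt_eqF.
rewrite -lerBlDr -addrA -mulrBr.
(* [JJ] bounds the left side by [beta * (p * I)], which the factor 2 in [C0] has left available. *)
have : C0 * I * (J - J') <= beta * G0.
  have -> : C0 * I * (J - J') = beta * (I * (2 * beta * (J - J'))) by rewrite /C0; ring.
  rewrite ler_pM2l// (le_trans _ pG)// mulrC ler_pM2r//.
by lra.
Qed.

Local Lemma dom_S k : 0 < k -> dominated D S k S.
Proof.
move=> k0; split=> //; exists k^-1 => w Dw; rewrite ger0_norm ?S0//.
exact: le_expRM.
Qed.

Local Lemma dom_S_expS : dominated D S (4 * t)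
  (fun w => expR (t * S w) * (S w * expR (2 * t * S w))).
Proof.
have -> : 4 * t = t + (t + 2 * t) by ring.
apply: dominatedM; first by apply: dom_expS; rewrite (ger0_norm (ltW t0)).
apply: dominatedM; first exact: dom_S.
by apply: dom_expS; rewrite ger0_norm// mulr_ge0// ltW.
Qed.

(** Multiplied by [|h| * Cq], it bounds the mass moved when a density [q <= Cq * expR (t * S)] is
    tilted by [expR (h * a)], since [|exp(h a) - 1| <= |h| S exp(|h| S)]. *)
Definition drift_cst := Ex (fun w => expR (t * S w) * (S w * expR (2 * t * S w))).
Local Notation Z := drift_cst.

Local Lemma Z_ge0 : 0 <= Z.
Proof.
by apply: Rintegral_ge0 => w Dw; rewrite !mulr_ge0 ?expR_ge0 ?S0.
Qed.

(* A family of probability densities sharing a common part [cE] on the set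
   [E] where the starting point is forgotten. *)
Definition doeblin_weight (Cq cE : R) (q : X -> T -> R) : Prop :=
  [/\ forall x, measurable_fun D (q x),
      forall x w, D w -> 0 <= q x w <= Cq * expR (t * S w),
      forall x w, E w -> cE <= q x w,
      forall x, Ex (q x) = 1 &
      0 <= cE].

Section doeblin.
Variables (Cq cE : R) (q : X -> T -> R).
Hypothesis qw : doeblin_weight Cq cE q.

Local Lemma Cq_ge0 w : D w -> 0 <= Cq.
Proof.
case: qw => _ + _ _ _ Dw => /(_ x0 w Dw) /andP[q0 /(le_trans q0)].
by rewrite pmulr_lge0// expR_gt0.
Qed.

Local Lemma dom_q x : dominated D S t (q x).
Proof.
case: qw => mq qb _ _ _; split=> //; exists Cq => w Dw.
by have /andP[? ?] := qb x w Dw; rewrite ger0_norm.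
Qed.

Local Lemma drift_bound h x w : `|h| <= 2 * t -> D w ->
  q x w * `|expR (h * a x w) - 1| <=
  `|h| * Cq * (expR (t * S w) * (S w * expR (2 * t * S w))).
Proof.
move=> h2 Dw; case: qw => _ /(_ x w Dw) /andP[q0 qb] _ _ _.
have -> : `|h| * Cq * (expR (t * S w) * (S w * expR (2 * t * S w))) =
  (Cq * expR (t * S w)) * (`|h| * S w * expR (2 * t * S w)) by ring.
rewrite ler_pM//.
have hS : `|h * a x w| <= `|h| * S w by rewrite normrM ler_wpM2l// aS.
apply: le_trans (norm_expR_sub1_le hS) _.
rewrite ler_wpM2l ?mulr_ge0 ?S0// ler_expR.
by rewrite ler_wpM2r// S0.
Qed.

(** Removing the common part [cE] on [E] leaves mass [1 - cE * p], so averaging shrinks the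
    oscillation by that factor, while the tilt adds errors of size [2 * I * err]. The last
    hypothesis makes the gain cover the errors, so that [osc] reproduces itself. *)
Lemma doeblin_oscillation (u : X -> T -> R) (I osc h : R) :
  (forall x, measurable_fun D (u x)) ->
  (forall x w, D w -> I <= u x w <= (1 + osc) * I) ->
  (forall x y w, E w -> u x w = u y w) ->
  0 < I -> 0 <= osc <= 1 -> `|h| <= 2 * t ->
  6 * `|h| * Cq * Z <= osc * (cE * p) ->
  exists2 I', 0 < I' & forall x,
    I' <= Ex (fun w => q x w * (expR (h * a x w) * u x w)) <= (1 + osc) * I'.
Proof.
move=> mu uI uE I0 /andP[ osc0 osc1] h2 hosc.
have [mq qb qE q1 cE0] := qw.
have b1 := beta_ge1.
have [t40 tt4] : 0 <= 4 * t /\ t <= 4 * t by have h0 := t0; lra.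
have du x : dominated D S 0 (u x).
  apply: (@dominated_bounded _ _ _ _ _ ((1 + osc) * I)) => // w Dw.
  have /andP[h1 h3] := uI x w Dw.
  by rewrite ger0_norm// (le_trans _ h1)// ltW.
have d1 := @dominated_indic _ _ R D S E mE.
have dEu : dominated D S 0 (fun w => cE * (\1_E w * u x0 w)).
  exact/dominatedZ/dominated0M.
have dcE : dominated D S t (fun w => cE * \1_E w).
  by apply: dominatedW (ltW t0) _ => //; exact: dominatedZ.
have dqE x : dominated D S t (fun w => q x w - cE * \1_E w).
  by apply: dominatedB dcE; exact: dom_q.
have dqE' x c : dominated D S t (fun w => c * (q x w - cE * \1_E w)).
  exact: dominatedZ.
have dz c : dominated D S (4 * t)
    (fun w => c * (expR (t * S w) * (S w * expR (2 * t * S w)))).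
  exact/dominatedZ/dom_S_expS.
have dm x : dominated D S (3 * t) (fun w => q x w * (expR (h * a x w) * u x w)).
  have -> : 3 * t = t + (2 * t + 0) by ring.
  apply: dominatedM; first exact: dom_q.
  by apply: dominatedM => //; exact: dom_expa.
pose G := Ex (fun w => cE * (\1_E w * u x0 w)).
have ExqE x : Ex (fun w => q x w - cE * \1_E w) = 1 - cE * p.
  rewrite (Ex_B mD intS) ?q1 ?(Ex_Z mD intS)//; first exact: domW d1 _.
  - exact: domW (dom_q x) _.
  - exact: domW dcE _.
have alpha1 : cE * p <= 1.
  rewrite -subr_ge0 -(ExqE x0); apply: Rintegral_ge0 => w Dw.
  have := qb x0 w Dw; have := qE x0 w.
  case: (indic01 w) => -[Ew ->]; first by move=> /(_ Ew); lra.
  by move=> _ /andP[]; lra.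
have GI : cE * p * I <= G.
  rewrite /G (_ : cE * p * I = cE * (I * p)); last by ring.
  rewrite [X in _ <= X](Ex_Z mD intS); last exact/(domW _ t40)/dominated0M.
  rewrite ler_wpM2l// /p -(Ex_Z mD intS)//; last exact: domW d1 _.
  apply: (Ex_le mD intS).
  - exact/(domW _ t40)/dominatedZ.
  - exact/(domW _ t40)/dominated0M.
  - move=> w Dw; have /andP[? _] := uI x0 w Dw.
    by case: (indic01 w) => -[_ ->]; lra.
have qE0 x w : D w -> 0 <= q x w - cE * \1_E w.
  move=> Dw; have := qb x w Dw; have := qE x w.
  case: (indic01 w) => -[Ew ->]; first by move=> /(_ Ew); lra.
  by move=> _ /andP[]; lra.
pose err := `|h| * Cq * Z.
(* The 2 comes from [u <= (1 + osc) * I <= 2 * I], as [osc <= 1]. *)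
have drift x w : D w -> q x w * `|expR (h * a x w) - 1| * u x w <=
    2 * I * (`|h| * Cq) * (expR (t * S w) * (S w * expR (2 * t * S w))).
  move=> Dw; rewrite -(mulrA (2 * I)) [X in _ <= X]mulrC ler_pM//.
  - by have /andP[? ?] := qb x w Dw; rewrite mulr_ge0.
  - by have /andP[? ?] := uI x w Dw; lra.
  - exact: drift_bound.
  - have /andP[_ ub] := uI x w Dw; apply: le_trans ub _.
    by rewrite ler_pM2r//; lra.
have split_int x c s : Ex (fun w => cE * (\1_E w * u x0 w) +
     (c * (q x w - cE * \1_E w) +
      s * (expR (t * S w) * (S w * expR (2 * t * S w))))) =
     G + (c * (1 - cE * p) + s * Z).
  rewrite (Ex_D mD intS); [|exact: domW dEu _|]; last first.
    apply: (@domW (4 * t)) => //; apply: dominatedD => //.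
    exact: dominatedW tt4 _.
  rewrite (Ex_D mD intS); [|exact: domW (dqE' x c) _|exact: domW (dz s) _].
  rewrite (Ex_Z mD intS c); last exact: domW (dqE x) _.
  rewrite (Ex_Z mD intS s); last exact: domW dom_S_expS _.
  by rewrite ExqE.
have dsplit x c s : dominated D S (4 * t) (fun w => cE * (\1_E w * u x0 w) +
     (c * (q x w - cE * \1_E w) +
      s * (expR (t * S w) * (S w * expR (2 * t * S w))))).
  apply: dominatedD; first exact: dominatedW t40 _.
  by apply: dominatedD => //; exact: dominatedW tt4 _.
have t34 : 3 * t <= 4 * t by have h0 := t0; lra.
have up x : Ex (fun w => q x w * (expR (h * a x w) * u x w)) <=
    G + ((1 + osc) * I * (1 - cE * p) + 2 * I * err).
  rewrite (_ : 2 * I * err = 2 * I * (`|h| * Cq) * Z); last by rewrite /err; ring.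
  rewrite -(split_int x); apply: (Ex_le mD intS).
  - exact: domW (dm x) _.
  - exact: domW (dsplit _ _ _) _.
  - move=> w Dw; have dw := drift x w Dw.
    have /andP[u1 u2] := uI x w Dw.
    have /andP[qp _] := qb x w Dw.
    have h3 : q x w * (expR (h * a x w) - 1) * u x w <=
              q x w * `|expR (h * a x w) - 1| * u x w.
      by rewrite ler_wpM2r ?ler_wpM2l ?ler_norm//; lra.
    have h4 : q x w * u x w <= cE * (\1_E w * u x0 w) +
        (1 + osc) * I * (q x w - cE * \1_E w).
      have : (q x w - cE * \1_E w) * u x w <=
             (q x w - cE * \1_E w) * ((1 + osc) * I).
        by rewrite ler_wpM2l// qE0.
      have [[Ew ->]|[_ ->]] := indic01 w; last by lra.
      by rewrite (uE x0 x w Ew); lra.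
    by lra.
have lo x : G + (I * (1 - cE * p) - 2 * I * err) <=
    Ex (fun w => q x w * (expR (h * a x w) * u x w)).
  rewrite (_ : - (2 * I * err) = - (2 * I * (`|h| * Cq)) * Z); last by rewrite /err; ring.
  rewrite -(split_int x); apply: (Ex_le mD intS).
  - exact: domW (dsplit _ _ _) _.
  - exact: domW (dm x) _.
  - move=> w Dw; have dw := drift x w Dw.
    have /andP[u1 u2] := uI x w Dw.
    have /andP[qp _] := qb x w Dw.
    have h3 : - (q x w * (expR (h * a x w) - 1) * u x w) <=
              q x w * `|expR (h * a x w) - 1| * u x w.
      rewrite -mulNr -mulrN ler_wpM2r ?ler_wpM2l//; first by lra.
      by rewrite -normrN ler_norm.
    have h4 : cE * (\1_E w * u x0 w) + I * (q x w - cE * \1_E w) <=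
        q x w * u x w.
      have : (q x w - cE * \1_E w) * I <= (q x w - cE * \1_E w) * u x w.
        by rewrite ler_wpM2l// qE0.
      have [[Ew ->]|[_ ->]] := indic01 w; last by lra.
      by rewrite (uE x0 x w Ew); lra.
    by lra.
(* The goal amounts to [2 * I * err + (1 + osc) * (2 * I * err) <= osc * G]. With [osc <= 1] the
   left side is at most [6 * I * err], and [G >= cE * p * I]. *)
have err6 : 6 * err <= osc * (cE * p) by rewrite /err mulrA mulrA.
have oscp : osc * (cE * p) <= 1 by rewrite -[X in _ <= X]mulr1 ler_pM// mulr_ge0// ltW.
have errI : I * (6 * err) <= I * 1 by rewrite ler_pM2l//; lra.
(* Positive, since [G + I * (1 - cE * p) >= I] and [6 * err <= 1]. *)
exists (G + (I * (1 - cE * p) - 2 * I * err)); first by lra.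
move=> x; rewrite lo (le_trans (up x))//.
have osG : osc * (cE * p * I) <= osc * G by rewrite ler_wpM2l.
have oI : I * (6 * err) <= I * (osc * (cE * p)) by rewrite ler_pM2l.
have e0 : 0 <= err -> osc * (I * err) <= I * err.
  by move=> e0; rewrite ler_piMl// mulr_ge0// ltW.
have : 0 <= err.
  rewrite /err; have [w Dw] : exists w, D w.
    by apply/set0P/eqP => D0; move: PD; rewrite D0 measure0 => /eqP; rewrite eq_sym onee_eq0.
  by rewrite !mulr_ge0// ?Z_ge0// (Cq_ge0 Dw).
move=> /e0 e1.
by lra.
Qed.

(** As [q x] has mass 1, the untilted mean is at most [W]; the tilt adds at most [W] times the drift
    bound. *)
Lemma doeblin_drift (u : X -> T -> R) (W h : R) x :
  measurable_fun D (u x) -> (forall w, D w -> 0 <= u x w <= W) ->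
  `|h| <= 2 * t ->
  Ex (fun w => q x w * (expR (h * a x w) * u x w)) <= W * (1 + `|h| * Cq * Z).
Proof.
move=> mu uW h2; have [mq qb qE q1 cE0] := qw.
have [t40 tt4] : 0 <= 4 * t /\ t <= 4 * t by have h0 := t0; lra.
have t34 : 3 * t <= 4 * t by have h0 := t0; lra.
have du : dominated D S 0 (u x).
  apply: (@dominated_bounded _ _ _ _ _ W) => // w Dw.
  by have /andP[h1 h3] := uW w Dw; rewrite ger0_norm.
have dm : dominated D S (3 * t) (fun w => q x w * (expR (h * a x w) * u x w)).
  have -> : 3 * t = t + (2 * t + 0) by ring.
  apply: dominatedM; first exact: dom_q.
  by apply: dominatedM => //; exact: dom_expa.
have dz c : dominated D S (4 * t)
    (fun w => c * (expR (t * S w) * (S w * expR (2 * t * S w)))).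
  exact/dominatedZ/dom_S_expS.
have -> : W * (1 + `|h| * Cq * Z) = W * Ex (q x) + W * (`|h| * Cq) * Z.
  by rewrite q1; ring.
rewrite -(Ex_Z mD intS W); last exact: domW (dom_q x) _.
rewrite /drift_cst -(Ex_Z mD intS (W * _)); last exact: domW dom_S_expS _.
rewrite -(Ex_D mD intS); last 2 first.
- by apply: (domW _ tt4); exact/dominatedZ/dom_q.
- exact: domW (dz _) _.
apply: (Ex_le mD intS).
- exact: domW dm _.
- apply: (@domW (4 * t)) => //; apply: dominatedD => //.
  by apply: dominatedW tt4 _ => //; exact/dominatedZ/dom_q.
- move=> w Dw; have /andP[u1 u2] := uW w Dw.
  have /andP[qp _] := qb x w Dw.
  have h5 := drift_bound x h2 Dw.
  have h3 : q x w * (expR (h * a x w) - 1) * u x w <=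
            q x w * `|expR (h * a x w) - 1| * W.
    apply: (@le_trans _ _ (q x w * `|expR (h * a x w) - 1| * u x w)).
      by rewrite ler_wpM2r ?ler_wpM2l ?ler_norm.
    by rewrite ler_wpM2l// mulr_ge0.
  have h6 : q x w * `|expR (h * a x w) - 1| * W <= `|h| * Cq *
     (expR (t * S w) * (S w * expR (2 * t * S w))) * W.
    by rewrite ler_wpM2r// (le_trans u1).
  have h4 : q x w * u x w <= q x w * W by rewrite ler_wpM2l.
  have h7 : W * (`|h| * Cq) * (expR (t * S w) * (S w * expR (2 * t * S w))) = `|h| * Cq *
     (expR (t * S w) * (S w * expR (2 * t * S w))) * W by ring.
  by rewrite h7; lra.
Qed.

(** With Q the mean of density [q], the first factor bounds [Q[Y]] and the second [Q[Y + 1 / Y - 2]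
    / h^2] in [doeblin_inverse]. *)
Definition second_diff_cst (K : R) :=
  Cq * Ex (fun w => expR (t * S w) * expR (t * (S w + K))) *
  (Cq * Ex (fun w => expR (t * S w) *
               ((S w + K) ^+ 2 * expR (t * (S w + K))))).

(* [v] plays the role of [W / Y].  In [1 / Y = 2 - Y + (Y + 1 / Y - 2)] the last
   term is of second order, and [m * (2 - m) <= 1] for [m = Q[Y]]. *)
Lemma doeblin_inverse (Y v : T -> R) (h K W : R) x :
  measurable_fun D Y -> measurable_fun D v -> 0 <= K -> `|h| <= t ->
  (forall w, D w ->
    expR (- (`|h| * (S w + K))) <= Y w <= expR (`|h| * (S w + K))) ->
  (forall w, D w -> 0 <= v w /\ Y w * v w <= W) ->
  Ex (fun w => q x w * Y w) * Ex (fun w => q x w * v w) <=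
  W * (1 + second_diff_cst K * h ^+ 2).
Proof.
move=> mY mv K0 ht Yb vW; have [mq qb qE q1 cE0] := qw.
have tp := t0.
have t24 : 2 * t <= 4 * t by lra.
have t34 : 3 * t <= 4 * t by lra.
have tt4 : t <= 4 * t by lra.
have Y0 w : D w -> 0 < Y w.
  by move=> Dw; have /andP[+ _] := Yb w Dw; apply: lt_le_trans; rewrite expR_gt0.
have deK : dominated D S t (fun w => expR (t * (S w + K))).
  under [X in dominated _ _ _ X]eq_fun do rewrite mulrDr expRD mulrC.
  by apply: dominatedZ; apply: dom_expS; rewrite ger0_norm// ltW.
have eK w : D w -> expR (`|h| * (S w + K)) <= expR (t * (S w + K)).
  by move=> Dw; rewrite ler_expR ler_wpM2r// addr_ge0 ?S0.
have dY : dominated D S t Y.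
  case: deK => _ [C CP]; split=> //; exists C => w Dw.
  apply: le_trans (CP w Dw); have /andP[_ h1] := Yb w Dw.
  by rewrite gtr0_norm ?Y0// ger0_norm ?expR_ge0// (le_trans h1)// eK.
have Yib w : D w ->
    expR (- (`|h| * (S w + K))) <= (Y w)^-1 <= expR (`|h| * (S w + K)).
  move=> Dw; have /andP[h1 h2] := Yb w Dw.
  rewrite expRN lef_pV2 ?posrE ?expR_gt0 ?Y0// h2/=.
  by rewrite -[leRHS]invrK -expRN lef_pV2 ?posrE ?expR_gt0 ?Y0.
have dYi : dominated D S t (fun w => (Y w)^-1).
  case: deK => _ [C CP]; split=> //.
    exact: measurable_fun_inv_gt0.
  exists C => w Dw.
  apply: le_trans (CP w Dw); have /andP[_ h1] := Yib w Dw.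
  rewrite ger0_norm ?invr_ge0 ?(ltW (Y0 _ Dw))// ger0_norm ?expR_ge0//.
  by rewrite (le_trans h1)// eK.
have D0 : exists w, D w.
  by apply/set0P/eqP => D0; move: PD; rewrite D0 measure0 => /eqP; rewrite eq_sym onee_eq0.
have W0 : 0 <= W.
  by have [w Dw] := D0; have [v0] := vW w Dw; apply: le_trans; rewrite mulr_ge0// ltW// Y0.
have vY w : D w -> v w <= W * (Y w)^-1.
  by move=> Dw; rewrite ler_pdivlMr ?Y0// mulrC; have [] := vW w Dw.
have dv : dominated D S t v.
  have [_ [C CP]] := dominatedZ W dYi; split=> //; exists C => w Dw.
  apply: le_trans (CP w Dw); have [v0 _] := vW w Dw.
  by rewrite ger0_norm// (le_trans (vY w Dw))// ler_norm.
have Cq0 : 0 <= Cq by have [w Dw] := D0; exact: Cq_ge0 Dw.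
pose m := Ex (fun w => q x w * Y w).
pose V := Ex (fun w => q x w * (Y w + (Y w)^-1 - 2)).
pose Y1 := Ex (fun w => expR (t * S w) * expR (t * (S w + K))).
pose V1 := Ex (fun w => expR (t * S w) *
                 ((S w + K) ^+ 2 * expR (t * (S w + K)))).
have deS : dominated D S t (fun w => expR (t * S w)).
  by apply: dom_expS; rewrite ger0_norm// ltW.
have d2K : dominated D S t (fun w => (S w + K) ^+ 2).
  (* Each factor of the square gets half of the exponent [t]. *)
  have dh : dominated D S (t / 2) (fun w => S w + K).
    have th : 0 < t / 2 by lra.
    apply: dominatedD; first exact: dom_S.
    by apply: dominatedW (ltW th) _ => //; exact: dominated_cst.
  by have := dominatedM dh dh; rewrite -splitr; under eq_fun do rewrite -expr2.
have dY1 : dominated D S (2 * t) (fun w => expR (t * S w) * expR (t * (S w + K))).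
  by rewrite (_ : 2 * t = t + t); [exact: dominatedM|ring].
have dV1 : dominated D S (3 * t) (fun w => expR (t * S w) *
                 ((S w + K) ^+ 2 * expR (t * (S w + K)))).
  rewrite (_ : 3 * t = t + (t + t)); last by ring.
  by apply: dominatedM => //; exact: dominatedM.
have dqY : dominated D S (2 * t) (fun w => q x w * Y w).
  by rewrite (_ : 2 * t = t + t); [exact/dominatedM/dY/dom_q|ring].
have dqYi : dominated D S (2 * t) (fun w => q x w * (Y w)^-1).
  by rewrite (_ : 2 * t = t + t); [exact/dominatedM/dYi/dom_q|ring].
have dqV : dominated D S (2 * t) (fun w => q x w * (Y w + (Y w)^-1 - 2)).
  rewrite (_ : 2 * t = t + t); last by ring.
  apply: dominatedM; first exact: dom_q.
  apply: dominatedB; first exact: dominatedD.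
  by apply: dominatedW (ltW tp) _ => //; exact: dominated_cst.
have mVE : Ex (fun w => q x w * (Y w)^-1) = V - m + 2.
  have -> : V - m + 2 = (V + 2 * Ex (q x)) - m by rewrite q1; ring.
  rewrite -(Ex_Z mD intS); last exact: domW (dom_q x) _.
  rewrite -(Ex_D mD intS); last 2 first.
  - exact: domW dqV _.
  - by apply: (domW _ tt4); exact/dominatedZ/dom_q.
  rewrite -(Ex_B mD intS); last 2 first.
  - apply: (domW _ t24); apply: dominatedD => //.
    by apply: (@dominatedW _ _ _ _ _ S0 t); [lra|exact/dominatedZ/dom_q].
  - exact: domW dqY _.
  by apply: eq_Rintegral => w _; ring.
have m0 : 0 <= m.
  apply: Rintegral_ge0 => w Dw; have /andP[qp _] := qb x w Dw.
  by rewrite mulr_ge0// ltW// Y0.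
have mY1 : m <= Cq * Y1.
  rewrite -(Ex_Z mD intS); last exact: domW dY1 _.
  apply: (Ex_le mD intS).
  - exact: domW dqY _.
  - by apply: (domW _ t24); exact: dominatedZ.
  - move=> w Dw; have /andP[qp qu] := qb x w Dw.
    rewrite mulrA ler_pM// ?(ltW (Y0 _ Dw))//.
    by have /andP[_ h1] := Yb w Dw; rewrite (le_trans h1)// eK.
have VV1 : V <= Cq * V1 * h ^+ 2.
  rewrite mulrC mulrA -(Ex_Z mD intS); last exact: domW dV1 _.
  apply: (Ex_le mD intS).
  - exact: domW dqV _.
  - by apply: (domW _ t34); exact: dominatedZ.
  - move=> w Dw; have /andP[qp qu] := qb x w Dw.
    have SK0 : 0 <= S w + K by rewrite addr_ge0 ?S0.
    have -> : h ^+ 2 * Cq * (expR (t * S w) * ((S w + K) ^+ 2 * expR (t * (S w + K)))) =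
      (Cq * expR (t * S w)) * ((`|h| * (S w + K)) ^+ 2 * expR (t * (S w + K))).
      by rewrite exprMn real_normK ?num_real//; ring.
    (* [Y + 1 / Y - 2] is [exp(l) + exp(-l) - 2] with [l = ln Y], hence of second order in
       [|h| (S + K)]. *)
    have lnY : `|ln (Y w)| <= `|h| * (S w + K).
      have /andP[h1 h2] := Yb w Dw.
      by rewrite ler_norml -[X in X && _]ler_expR -[X in _ && X]ler_expR lnK ?posrE ?Y0// h1 h2.
    have := expRDN_sub2_le lnY; rewrite expRN lnK ?posrE ?Y0// => h3.
    have h4 : 0 <= Y w + (Y w)^-1 - 2.
      have -> : Y w + (Y w)^-1 - 2 = (Y w - 1) ^+ 2 / Y w.
        by field; rewrite gt_eqF// Y0.
      by rewrite divr_ge0 ?sqr_ge0// ltW// Y0.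
    rewrite ler_pM// (le_trans h3)// ler_wpM2l ?sqr_ge0// eK//.
have V10 : 0 <= Cq * V1 * h ^+ 2.
  rewrite mulr_ge0 ?sqr_ge0// mulr_ge0//; apply: Rintegral_ge0 => w Dw.
  by rewrite mulr_ge0 ?expR_ge0// mulr_ge0 ?expR_ge0// sqr_ge0.
have dqv : dominated D S (2 * t) (fun w => q x w * v w).
  by rewrite (_ : 2 * t = t + t); [exact/dominatedM/dv/dom_q|ring].
have vi : Ex (fun w => q x w * v w) <= W * Ex (fun w => q x w * (Y w)^-1).
  rewrite -(Ex_Z mD intS); last exact: domW dqYi _.
  apply: (Ex_le mD intS).
  - exact: domW dqv _.
  - by apply: (domW _ t24); exact: dominatedZ.
  - move=> w Dw; have /andP[qp qu] := qb x w Dw.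
    by rewrite mulrCA ler_wpM2l// vY.
rewrite -/m /second_diff_cst -/Y1 -/V1 -(mulrA (Cq * Y1)).
apply: (@le_trans _ _ (m * (W * (V - m + 2)))).
  by rewrite ler_wpM2l// -mVE.
rewrite mulrCA; apply: ler_wpM2l => //.
have h1 : m * V <= Cq * Y1 * (Cq * V1 * h ^+ 2).
  by apply: (@le_trans _ _ (m * (Cq * V1 * h ^+ 2))); [exact: ler_wpM2l|exact: ler_wpM2r].
have h2 : 0 <= (m - 1) ^+ 2 by rewrite sqr_ge0.
have -> : m * (V - m + 2) = m * V + 1 - (m - 1) ^+ 2 by ring.
by lra.
Qed.

End doeblin.

Local Notation L := (Ex (fun w => expR (t * S w))).

Local Lemma L_ge1 : 1 <= L.
Proof.
rewrite -(Ex_cst mD PD 1); apply: (Ex_le mD intS).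
- by apply: (@domW 0); [exact: dominated_cst|have h0 := t0; lra].
- by apply: (@domW t); [apply: dom_expS; rewrite (ger0_norm (ltW t0))|have h0 := t0; lra].
- by move=> w Dw; rewrite -expR0 ler_expR mulr_ge0 ?S0// ltW.
Qed.

Lemma iterate_gt0 th k x : `|th| <= t -> 0 < f th k x.
Proof.
move=> /(iterate_comparable k) [I I0 /(_ x) /andP[fI _]].
exact: lt_le_trans fI.
Qed.

(** With [I] from [iterate_comparable]: the numerator of the density is at most
    [expR (t * S) * (C0 * I)], the denominator at least [beta^-1 * I * p]. *)
Definition weight_ub := C0 * beta / p.
(** On [E] the numerator is at least [beta^-1 * I], while the denominator never exceeds
    [C0 * I * L]. *)
Definition weight_lb := (beta * (C0 * L))^-1.

Local Lemma C0_gt0 : 0 < C0.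
Proof. by rewrite /C0 mulr_gt0// exprn_gt0// expR_gt0. Qed.

Local Lemma weight_lb_gt0 : 0 < weight_lb.
Proof.
rewrite invr_gt0 !mulr_gt0 ?expR_gt0 ?C0_gt0//.
exact: lt_le_trans L_ge1.
Qed.

(** Doob's h-transform with the finite-time moments as harmonic functions: [fS] says that the
    quotient integrates to 1, and comparability makes its bounds free of [k]. *)
Lemma iterate_doeblin_weight th k : `|th| <= t -> doeblin_weight weight_ub weight_lb
  (fun x w => expR (th * a x w) * f th k (B x w) / f th k.+1 x).
Proof.
move=> tht; have [I I0 fI] := iterate_comparable k tht.
have C00 := C0_gt0; have L1 := L_ge1.
have tt4 : t <= 4 * t by have h0 := t0; lra.
have t40 : 0 <= 4 * t by have h0 := t0; lra.
have fb w x : 0 <= f th k (B x w).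
  by have /andP[h1 h2] := fI (B x w); rewrite (le_trans _ h1)// ltW.
have dfk x : dominated D S t (fun w => expR (th * a x w) * f th k (B x w)).
  have := dominatedM (dom_expa x tht); rewrite -{2}(addr0 t); apply.
  apply: (@dominated_bounded _ _ _ _ _ (C0 * I)) => [|w _]; first exact: mf.
  by have /andP[h1 h2] := fI (B x w); rewrite ger0_norm.
have up x : f th k.+1 x <= C0 * I * L.
  rewrite fS// -(Ex_Z mD intS).
    apply: (Ex_le mD intS).
    - exact: domW (dfk x) _.
    - apply: (domW _ tt4); apply: dominatedZ; apply: dom_expS.
      by rewrite (ger0_norm (ltW t0)).
    - move=> w Dw; rewrite mulrC ler_pM ?expR_ge0//.
        by have /andP[] := fI (B x w).
      by have /andP[] := expa_le x tht Dw.
  apply: (@domW t) => //; apply: dom_expS.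
  by rewrite (ger0_norm (ltW t0)).
have d1 := @dominated_indic _ _ R D S E mE.
have lo x : beta^-1 * I * p <= f th k.+1 x.
  rewrite fS// /p -(Ex_Z mD intS); last exact: domW d1 _.
  apply: (Ex_le mD intS).
  - exact/(domW _ t40)/dominatedZ.
  - exact: domW (dfk x) _.
  - move=> w Dw; have /andP[f1 f2] := fI (B x w).
    have [[Ew ->]|[_ ->]] := indic01 w.
      rewrite mulr1 ler_pM ?invr_ge0 ?expR_ge0 ?(ltW I0)//.
      by have /andP[] := expa_le_beta x tht Ew.
    by rewrite mulr0 mulr_ge0 ?expR_ge0.
have fp x := iterate_gt0 k.+1 x tht.
have b1 : 0 < beta by exact: expR_gt0.
split.
- move=> x; apply: measurable_funM => //.
  by case: (dfk x).
- move=> x w Dw; rewrite mulr_ge0 ?invr_ge0 ?(ltW (fp x)) ?mulr_ge0 ?expR_ge0//=.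
  rewrite ler_pdivrMr//.
  apply: (@le_trans _ _ (expR (t * S w) * (C0 * I))).
    rewrite ler_pM ?expR_ge0//.
      by have /andP[] := expa_le x tht Dw.
    by have /andP[] := fI (B x w).
  rewrite [leRHS](_ : _ = expR (t * S w) * (weight_ub * f th k.+1 x)); last by ring.
  rewrite ler_wpM2l ?expR_ge0// /weight_ub.
  apply: (@le_trans _ _ (C0 * beta / p * (beta^-1 * I * p))).
    rewrite (_ : C0 * beta / p * _ = C0 * I)//.
    by field; rewrite !gt_eqF.
  by rewrite ler_wpM2l// divr_ge0 ?(ltW p0)// mulr_ge0// ltW.
- move=> x w Ew; rewrite ler_pdivlMr//.
  apply: (@le_trans _ _ (weight_lb * (C0 * I * L))).
    by rewrite ler_wpM2l// ltW// weight_lb_gt0.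
  rewrite (_ : _ * _ = beta^-1 * I).
    rewrite ler_pM ?invr_ge0 ?expR_ge0 ?(ltW I0)//.
      by have /andP[] := expa_le_beta x tht Ew.
    by have /andP[] := fI (B x w).
  by rewrite /weight_lb; field; rewrite !gt_eqF//; exact: lt_le_trans L1.
- move=> x; under eq_Rintegral do rewrite mulrC.
  rewrite (Ex_Z mD intS); last exact: domW (dfk x) _.
  by rewrite -fS// mulVf// gt_eqF.
- exact/ltW/weight_lb_gt0.
Qed.

(** The ratio of two moments evolves under the Markov kernel of [iterate_doeblin_weight], tilted
    only by the increment [h]. *)
Local Lemma iterate_ratioE th h k x : `|th| <= t -> `|th + h| <= t ->
  f (th + h) k.+1 x / f th k.+1 x =
  Ex (fun w => expR (th * a x w) * f th k (B x w) / f th k.+1 x *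
               (expR (h * a x w) * (f (th + h) k (B x w) / f th k (B x w)))).
Proof.
move=> tht thh; have [I I0 fI] := iterate_comparable k thh.
have dfk : dominated D S t (fun w => expR ((th + h) * a x w) * f (th + h) k (B x w)).
  have := dominatedM (dom_expa x thh); rewrite -{2}(addr0 t); apply.
  apply: (@dominated_bounded _ _ _ _ _ (C0 * I)) => [|w _]; first exact: mf.
  have /andP[h1 h2] := fI (B x w).
  by rewrite ger0_norm// (le_trans _ h1)// ltW.
rewrite [in LHS]fS// mulrC -(Ex_Z mD intS); last first.
  by apply: (domW dfk); have h0 := t0; lra.
apply: eq_Rintegral => w _.
rewrite mulrDl expRD; field.
by rewrite !gt_eqF// iterate_gt0.
Qed.

(** Solves [6 * |h| * weight_ub * Z = osc * (weight_lb * p)] for [osc = osc_cst * |h|]. *)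
Definition osc_cst := 6 * weight_ub * Z / (weight_lb * p).

Local Lemma weight_ub_ge0 : 0 <= weight_ub.
Proof. by rewrite !mulr_ge0 ?expR_ge0 ?invr_ge0 ?(ltW C0_gt0) ?(ltW p0). Qed.

Local Lemma osc_cst_ge0 : 0 <= osc_cst.
Proof.
apply: divr_ge0; last exact: mulr_ge0 (ltW weight_lb_gt0) (ltW p0).
by apply: mulr_ge0 Z_ge0; apply: mulr_ge0 weight_ub_ge0.
Qed.

Local Lemma norm_diff_le (th h : R) : `|th| <= t -> `|th + h| <= t -> `|h| <= 2 * t.
Proof. by rewrite !ler_norml => /andP[? ?] /andP[? ?]; apply/andP; split; lra. Qed.

Local Lemma measurable_ratio th h k x : `|th| <= t ->
  measurable_fun D (fun w => f (th + h) k (B x w) / f th k (B x w)).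
Proof.
move=> tht; apply: measurable_funM => //; apply: measurable_fun_inv_gt0 => //.
by move=> w Dw; exact: iterate_gt0.
Qed.

(** At [k = 0] the ratio is 1; from then on an oscillation proportional to [|h|] reproduces itself,
    whence the uniformity in [k]. *)
Lemma iterate_ratio_osc th h k : `|th| <= t -> `|th + h| <= t ->
  osc_cst * `|h| <= 1 ->
  exists2 I, 0 < I & forall x,
    I <= f (th + h) k x / f th k x <= (1 + osc_cst * `|h|) * I.
Proof.
move=> tht thh oh.
have oh0 : 0 <= osc_cst * `|h| by rewrite mulr_ge0// osc_cst_ge0.
elim: k => [|k [I I0 IH]].
  by exists 1 => // x; rewrite !f0 divr1 lexx/=; lra.
suff [I' I'0 h'] : exists2 I', 0 < I' & forall x, I' <= Ex (fun w =>
    expR (th * a x w) * f th k (B x w) / f th k.+1 x *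
    (expR (h * a x w) * (f (th + h) k (B x w) / f th k (B x w)))) <=
    (1 + osc_cst * `|h|) * I'.
  by exists I' => // x; rewrite iterate_ratioE.
apply: (doeblin_oscillation (iterate_doeblin_weight k tht)
  (u := fun x w => f (th + h) k (B x w) / f th k (B x w))) => //.
- by move=> x; exact: measurable_ratio.
- by move=> x y w Ew; rewrite !(@fE _ _ x y).
- by rewrite oh0.
- exact: norm_diff_le thh.
- rewrite /osc_cst [leRHS](_ : _ = 6 * `|h| * weight_ub * Z)//.
  by field; rewrite !gt_eqF ?weight_lb_gt0.
Qed.

Lemma iterate_lipschitz th h k x : `|th| <= t -> `|th + h| <= t ->
  f (th + h) k x <= (1 + `|h| * weight_ub * Z) ^+ k * f th k x.
Proof.
move=> tht thh.
have c0 : 0 <= `|h| * weight_ub * Z.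
  by apply: mulr_ge0 Z_ge0; apply: mulr_ge0 weight_ub_ge0.
elim: k x => [x|k IH x]; first by rewrite !f0 expr0 mulr1.
rewrite -ler_pdivrMr ?iterate_gt0// iterate_ratioE// exprSr.
apply: (doeblin_drift (iterate_doeblin_weight k tht)
  (u := fun x w => f (th + h) k (B x w) / f th k (B x w))).
- exact: measurable_ratio.
- move=> w Dw; rewrite ler_pdivrMr ?iterate_gt0// IH andbT.
  by rewrite divr_ge0// ltW// iterate_gt0.
- exact: norm_diff_le thh.
Qed.

(** Dividing the ratio at [th + h] by its lower bound [I] puts [Y] between [exp(-|h| (S + osc_cst))]
    and [exp(|h| (S + osc_cst))]. With [v] the tilted ratio at [th - h], [Y * v] is the product of
    the two ratios over [I], which the induction hypothesis bounds. *)
Lemma iterate_second_diff th h k x : `|th| <= t -> `|th + h| <= t ->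
  `|th - h| <= t -> osc_cst * `|h| <= 1 ->
  f (th + h) k x * f (th - h) k x <=
  (1 + second_diff_cst weight_ub osc_cst * h ^+ 2) ^+ k * f th k x ^+ 2.
Proof.
move=> tht thh thmh oh.
have ht : `|h| <= t.
  move: thh thmh; rewrite !ler_norml => /andP[? ?] /andP[? ?].
  by apply/andP; split; lra.
elim: k x => [x|k IH x]; first by rewrite !f0 expr0 expr1n mulr1.
have fp := iterate_gt0 k.+1 x tht.
rewrite -ler_pdivrMr ?exprn_gt0// expr2 invfM mulrACA !iterate_ratioE// exprSr.
have [I I0 rI] := iterate_ratio_osc k tht thh oh.
pose q y w := expR (th * a y w) * f th k (B y w) / f th k.+1 y.
pose rp w := f (th + h) k (B x w) / f th k (B x w).
pose rm w := f (th - h) k (B x w) / f th k (B x w).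
have rp0 w : 0 < rp w by apply: divr_gt0; exact: iterate_gt0.
have rm0 w : 0 < rm w by apply: divr_gt0; exact: iterate_gt0.
have K0 := osc_cst_ge0.
have dY : dominated D S (2 * t) (fun w => q x w * (expR (h * a x w) * rp w / I)).
  rewrite (_ : 2 * t = t + (t + 0)); last by ring.
  apply: dominatedM; first exact: dom_q (iterate_doeblin_weight k tht) x.
  under eq_fun do rewrite -mulrA.
  apply: dominatedM; first exact: dom_expa.
  apply: (@dominated_bounded _ _ _ _ _ (1 + osc_cst * `|h|)) => [|w Dw].
    by apply: measurable_funM => //; exact: measurable_ratio.
  have /andP[_ h2] := rI (B x w).
  have r0 : 0 < rp w / I by exact: divr_gt0.
  by rewrite (gtr0_norm r0) ler_pdivrMr.
(* The factor [I] taken out here is compensated by the bound [I^-1 * W] on [Y * v]. *)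
have -> : Ex (fun w => q x w * (expR (h * a x w) * rp w)) =
          I * Ex (fun w => q x w * (expR (h * a x w) * rp w / I)).
  rewrite -(Ex_Z mD intS); last by apply: (domW dY); have h0 := t0; lra.
  by apply: eq_Rintegral => w _; field; rewrite gt_eqF.
set W := _ ^+ k; rewrite -mulrA -ler_pdivlMl// mulrA.
have := @doeblin_inverse _ _ _ (iterate_doeblin_weight k tht)
  (fun w => expR (h * a x w) * rp w / I)
  (fun w => expR (- h * a x w) * rm w) h osc_cst (I^-1 * W) x.
apply => //.
- apply: measurable_funM => //; apply: measurable_funM; last exact: measurable_ratio.
  by case: (dom_expa x ht).
- apply: measurable_funM; last exact: measurable_ratio.
  have ht' : `|- h| <= t by rewrite normrN.
  by case: (dom_expa x ht').
- move=> w Dw; have /andP[h1 h2] := rI (B x w).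
  have : `|h * a x w| <= `|h| * S w by rewrite normrM ler_wpM2l// aS.
  rewrite ler_norml => /andP[a1 a2].
  have hK : 0 <= `|h| * osc_cst by rewrite mulr_ge0.
  apply/andP; split.
    rewrite -[leLHS]mulr1 -mulrA ler_pM ?expR_ge0//; last by rewrite ler_pdivlMr// mul1r.
    by rewrite ler_expR; lra.
  rewrite mulrDr expRD -mulrA ler_pM ?expR_ge0//.
  - by rewrite divr_ge0// ltW.
  - by rewrite ler_expR.
  - rewrite ler_pdivrMr// (le_trans h2)// ler_wpM2r ?(ltW I0)//.
    by rewrite (mulrC osc_cst) expR_ge1Dx.
- move=> w Dw; split; first by rewrite mulr_ge0 ?expR_ge0 ?(ltW (rm0 w)).
  rewrite [leLHS](_ : _ = I^-1 * (rp w * rm w)); last first.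
    by rewrite mulNr expRN; field; rewrite !gt_eqF ?expR_gt0.
  rewrite ler_wpM2l ?invr_ge0 ?(ltW I0)//.
  rewrite /rp /rm mulrACA -invfM -expr2 ler_pdivrMr ?exprn_gt0 ?iterate_gt0//.
Qed.

(** Together with comparability, this bound and its reverse make [ln f] quasi-additive in the number
    of blocks. *)
Lemma iterate_add_le th k l x c : `|th| <= t ->
  (forall y, f th l y <= c) -> f th (k + l) x <= c * f th k x.
Proof.
move=> tht lc; elim: k x => [x|k IH x]; first by rewrite add0n f0 mulr1.
have dfk n : dominated D S t (fun w => expR (th * a x w) * f th n (B x w)).
  have [I I0 fI] := iterate_comparable n tht.
  have := dominatedM (dom_expa x tht); rewrite -{2}(addr0 t); apply.
  apply: (@dominated_bounded _ _ _ _ _ (C0 * I)) => [|w _]; first exact: mf.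
  have /andP[h1 h2] := fI (B x w).
  by rewrite ger0_norm// (le_trans _ h1)// ltW.
have tt4 : t <= 4 * t by have h0 := t0; lra.
rewrite addSn !fS// -(Ex_Z mD intS); last exact: domW (dfk k) _.
apply: (Ex_le mD intS).
- exact: domW (dfk _) _.
- by apply: (domW _ tt4); exact/dominatedZ/dfk.
- by move=> w Dw; rewrite mulrCA ler_wpM2l ?expR_ge0// mulrC IH.
Qed.

Lemma iterate_add_ge th k l x c : `|th| <= t ->
  (forall y, c <= f th l y) -> c * f th k x <= f th (k + l) x.
Proof.
move=> tht lc; elim: k x => [x|k IH x]; first by rewrite add0n f0 mulr1.
have dfk n : dominated D S t (fun w => expR (th * a x w) * f th n (B x w)).
  have [I I0 fI] := iterate_comparable n tht.
  have := dominatedM (dom_expa x tht); rewrite -{2}(addr0 t); apply.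
  apply: (@dominated_bounded _ _ _ _ _ (C0 * I)) => [|w _]; first exact: mf.
  have /andP[h1 h2] := fI (B x w).
  by rewrite ger0_norm// (le_trans _ h1)// ltW.
have tt4 : t <= 4 * t by have h0 := t0; lra.
rewrite addSn !fS// -(Ex_Z mD intS); last exact: domW (dfk k) _.
apply: (Ex_le mD intS).
- by apply: (domW _ tt4); exact/dominatedZ/dfk.
- exact: domW (dfk _) _.
- by move=> w Dw; rewrite mulrCA ler_wpM2l ?expR_ge0// mulrC IH.
Qed.

(** [2 * ln C0] comes from [quasi_additive] at [x0], one more [ln C0] from replacing [x0] by [x]. *)
Lemma iterate_growth_rate th : `|th| <= t -> exists L, forall k x,
  `|ln (f th k x) - k%:R * L| <= 3 * ln C0.
Proof.
move=> tht.
have C00 := C0_gt0.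
have fp k x := iterate_gt0 k x tht.
have cmp k x y : f th k x <= C0 * f th k y.
  have [I I0 fI] := iterate_comparable k tht.
  have /andP[_ h1] := fI x; have /andP[h2 _] := fI y.
  by rewrite (le_trans h1)// ler_wpM2l// ltW.
have lncmp k x y : ln (f th k x) <= ln C0 + ln (f th k y).
  by rewrite -lnM ?posrE// ler_ln ?posrE//; exact: mulr_gt0.
pose bb k := ln (f th k x0).
have [k l|L Lb] := @quasi_additive R bb (ln C0).
  rewrite ler_norml; apply/andP; split.
    have : C0^-1 * f th l x0 * f th k x0 <= f th (k + l) x0.
      by apply: iterate_add_ge => // y; rewrite ler_pdivrMl.
    have Cl : 0 < C0^-1 * f th l x0 by rewrite mulr_gt0// invr_gt0.
    have Clk := mulr_gt0 Cl (fp k x0).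
    rewrite -ler_ln ?posrE//.
    rewrite (_ : ln (_ * _ * _) = - ln C0 + ln (f th l x0) + ln (f th k x0)).
      by rewrite /bb; lra.
    by rewrite lnM ?posrE// lnM ?posrE ?invr_gt0// lnV ?posrE.
  have : f th (k + l) x0 <= C0 * f th l x0 * f th k x0.
    by apply: iterate_add_le => // y; exact: cmp.
  have Cl := mulr_gt0 C00 (fp l x0); have Clk := mulr_gt0 Cl (fp k x0).
  rewrite -ler_ln ?posrE//.
  rewrite (_ : ln (_ * _ * _) = ln C0 + ln (f th l x0) + ln (f th k x0)).
    by rewrite /bb; lra.
  by rewrite lnM ?posrE// lnM ?posrE.
exists L => k x; have := Lb k; rewrite /bb !ler_norml => /andP[h1 h2].
have := lncmp k x x0; have := lncmp k x0 x => h3 h4.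
by apply/andP; split; lra.
Qed.

Lemma growth_rate_smooth : exists (Lam : R -> R) (C K h0 : R),
  [/\ 0 <= K, 0 < h0,
      (forall th k x, `|th| <= t ->
         0 < f th k x /\ `|ln (f th k x) - k%:R * Lam th| <= C),
      (forall th h, `|th| <= t -> `|th + h| <= t ->
         Lam (th + h) - Lam th <= K * `|h|) &
      (forall th h, `|th| <= t -> `|th + h| <= t -> `|th - h| <= t ->
         `|h| <= h0 -> Lam (th + h) + Lam (th - h) - 2 * Lam th <= K * h ^+ 2)].
Proof.
have /choice[Lam LamP] : forall th, exists L, `|th| <= t -> forall k x,
    `|ln (f th k x) - k%:R * L| <= 3 * ln C0.
  move=> th; have [tht|] := boolP (`|th| <= t); last by exists 0.
  by have [L hL] := iterate_growth_rate tht; exists L.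
have c1 : 0 <= weight_ub * Z := mulr_ge0 weight_ub_ge0 Z_ge0.
pose c2 := second_diff_cst weight_ub osc_cst.
have c20 : 0 <= `|c2| by [].
have o0 := osc_cst_ge0.
(* The radius ensures [osc_cst * |h| <= 1]; the absolute value gives [0 <= K] before the sign of
   [c2] is established. *)
exists Lam, (3 * ln C0), (weight_ub * Z + `|c2|), (osc_cst + 1)^-1; split.
- exact: addr_ge0.
- by rewrite invr_gt0; lra.
- by move=> th k x tht; split; [exact: iterate_gt0|exact: LamP].
- move=> th h tht thh.
  have d0 : 0 <= `|h| * weight_ub * Z by rewrite -mulrA; exact: mulr_ge0.
  have d1 : 0 < 1 + `|h| * weight_ub * Z by rewrite ltr_pwDl.
  apply: (@le_trans _ _ (`|h| * weight_ub * Z)); last first.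
    by rewrite -mulrA mulrC ler_wpM2r// lerDl.
  apply: (growth_rate_le (LamP _ thh ^~ x0) (LamP _ tht ^~ x0)) => k /=.
  have fp := iterate_gt0 k x0 tht; have fhp := iterate_gt0 k x0 thh.
  have d1k : 0 < (1 + `|h| * weight_ub * Z) ^+ k by exact: exprn_gt0.
  have := iterate_lipschitz k x0 tht thh.
  rewrite -ler_ln ?posrE//; last exact: mulr_gt0.
  rewrite lnM ?posrE// lnXn// => /le_trans; apply.
  rewrite addrC lerD2l mulr_natl lerMn2r.
  by rewrite le_ln1Dx ?orbT// (lt_le_trans _ d0)// oppr_lt0.
- move=> th h tht thh thmh hh0.
  have oh : osc_cst * `|h| <= 1.
    move: hh0; rewrite -[leRHS]mul1r ler_pdivlMr; last by rewrite ltr_wpDl.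
    by apply: le_trans; rewrite mulrC ler_wpM2l// lerDl.
  have h20 : 0 <= h ^+ 2 by rewrite sqr_ge0.
  have d0 : 0 <= `|c2| * h ^+ 2 by exact: mulr_ge0.
  have d1 : 0 < 1 + `|c2| * h ^+ 2 by rewrite ltr_pwDl.
  apply: (@le_trans _ _ (`|c2| * h ^+ 2)); last first.
    by rewrite ler_wpM2r// lerDr.
  apply: (growth_rate_second_diff_le (LamP _ tht ^~ x0)
    (LamP _ thh ^~ x0) (LamP _ thmh ^~ x0)) => k /=.
  have fp := iterate_gt0 k x0 tht; have fhp := iterate_gt0 k x0 thh.
  have fhm := iterate_gt0 k x0 thmh.
  have d1k : 0 < (1 + `|c2| * h ^+ 2) ^+ k by exact: exprn_gt0.
  have c2p : 0 <= c2.
    have p1 : 0 <= Ex (fun w => expR (t * S w) * expR (t * (S w + osc_cst))).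
      by apply: Rintegral_ge0 => w Dw; rewrite mulr_ge0 ?expR_ge0.
    have p2 : 0 <= Ex (fun w => expR (t * S w) *
        ((S w + osc_cst) ^+ 2 * expR (t * (S w + osc_cst)))).
      apply: Rintegral_ge0 => w Dw.
      by rewrite mulr_ge0 ?expR_ge0// mulr_ge0 ?expR_ge0 ?sqr_ge0.
    exact: mulr_ge0 (mulr_ge0 weight_ub_ge0 p1) (mulr_ge0 weight_ub_ge0 p2).
  have := iterate_second_diff k x0 tht thh thmh oh.
  rewrite -/c2; rewrite (ger0_norm c2p) in d0 d1 d1k *.
  rewrite -ler_ln ?posrE//; [|exact: mulr_gt0|by apply: mulr_gt0 => //; exact: exprn_gt0].
  rewrite lnM ?posrE// lnM ?posrE ?exprn_gt0// !lnXn// => /le_trans; apply.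
  rewrite addrC [2 * _]mulr_natl lerD2l mulr_natl lerMn2r.
  by rewrite le_ln1Dx ?orbT// (lt_le_trans _ d0)// oppr_lt0.
Qed.

End tilted_iteration.

Lemma exists_growth_rate {d} {T : measurableType d} {R : realType}
  (P : {measure set T -> \bar R}) (D : set T) (S : T -> R) (eta : R)
  (X : Type) (x0 : X) (a : X -> T -> R) (B : X -> T -> X)
  (f : R -> nat -> X -> R) (E : set T) (b : R) :
  measurable D -> P D = 1%E -> measurable_fun D S ->
  (forall w, D w -> 0 <= S w) -> 0 < eta ->
  P.-integrable D (EFin \o (fun w => expR (eta * S w))) ->
  (forall x, measurable_fun D (a x)) ->
  (forall x w, D w -> `|a x w| <= S w) ->
  (forall th k x, measurable_fun D (fun w => f th k (B x w))) ->
  (forall th x, f th 0%N x = 1) ->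
  (forall th k x, `|th| <= eta -> f th k.+1 x =
     \int[P]_(w in D) (expR (th * a x w) * f th k (B x w))) ->
  measurable E -> E `<=` D -> (forall w, E w -> S w <= b) ->
  (forall th k x y w, E w -> f th k (B x w) = f th k (B y w)) ->
  (0 < P E)%E ->
  exists (t : R) (Lam : R -> R) (C K h0 : R),
  [/\ 0 < t <= eta, 0 <= K, 0 < h0,
      (forall th k x, `|th| <= t ->
         0 < f th k x /\ `|ln (f th k x) - k%:R * Lam th| <= C) &
      (forall th h, `|th| <= t -> `|th + h| <= t ->
         Lam (th + h) - Lam th <= K * `|h|) /\
      (forall th h, `|th| <= t -> `|th + h| <= t -> `|th - h| <= t ->
         `|h| <= h0 -> Lam (th + h) + Lam (th - h) - 2 * Lam th <= K * h ^+ 2)].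
Proof.
move=> mD PD mS S0 eta0 intS ma aS mf f0 fS mE ED Sb fE PE.
pose p := \int[P]_(w in D) (\1_E w : R).
have p0 : 0 < p.
  rewrite /p /Rintegral integral_indic// setIidl//.
  rewrite fine_gt0// PE/= (@le_lt_trans _ _ (P D))// ?PD ?ltry//.
  by rewrite -PD le_measure ?inE.
pose b' := Num.max b 0.
pose M := \int[P]_(w in D) expR (eta * S w).
have dM : dominated D S eta (fun w => expR (eta * S w)).
  split; first by apply: measurableT_comp => //; exact: measurable_funM.
  by exists 1 => w _; rewrite mul1r ger0_norm ?expR_ge0.
have M1 : 1 <= M.
  rewrite -(Ex_cst mD PD 1); apply: (Ex_le mD intS) => //.
    by apply: dominatedW (ltW eta0) _ => //; exact: dominated_cst.
  by move=> w Dw; rewrite -expR0 ler_expR mulr_ge0 ?S0// ltW.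
(* The three terms give [t <= 1], [4 * t <= eta] and, through [exp(t S) - exp(-t S) <= (4 t / eta)
   exp(eta S)], the smallness condition [Jp]. *)
pose t := Num.min 1 (Num.min (eta / 4) (p * eta / (8 * expR b' * M))).
have c0 : 0 < 8 * expR b' * M.
  by rewrite mulr_gt0 ?(lt_le_trans _ M1)// mulr_gt0 ?expR_gt0.
have t0 : 0 < t by rewrite !lt_min ltr01 !divr_gt0// mulr_gt0.
have t1 : t <= 1 by rewrite ge_min lexx.
have t4 : 4 * t <= eta.
  by rewrite mulrC -ler_pdivlMr// !ge_min lexx orbT.
have t8 : t * (8 * expR b' * M) <= p * eta.
  by rewrite -ler_pdivlMr// !ge_min lexx !orbT.
have Jp : 2 * expR b' *
    \int[P]_(w in D) (expR (t * S w) - expR (- t * S w)) <= p.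
  have dS c : `|c| <= eta -> dominated D S eta (fun w => expR (c * S w)).
    by move=> ce; apply: dominated_expR => // w Dw; rewrite ger0_norm ?S0.
  have : \int[P]_(w in D) (expR (t * S w) - expR (- t * S w)) <=
         4 * t / eta * M.
    rewrite -(Ex_Z mD intS)//; apply: (Ex_le mD intS).
    - by apply: dominatedB; apply: dS; rewrite ?normrN ger0_norm ?(ltW t0)//; lra.
    - exact: dominatedZ.
    - move=> w Dw; have Sw0 := S0 _ Dw.
      have h1 : expR (t * S w) - 1 <= t * S w * expR (t * S w) := expR_sub1_le _.
      have h2 : 1 - t * S w <= expR (- t * S w).
        by have := expR_ge1Dx (- t * S w); lra.
      have h3 : 1 <= expR (t * S w) by rewrite -expR0 ler_expR mulr_ge0// ltW.
      have tS0 : 0 <= t * S w by rewrite mulr_ge0// ltW.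
      have h4 : expR (t * S w) - expR (- t * S w) <= 2 * (t * (S w * expR (t * S w))).
        have : t * S w * 1 <= t * S w * expR (t * S w) by rewrite ler_wpM2l.
        by lra.
      apply: le_trans h4 _.
      have e2 : 0 < eta / 2 by lra.
      (* Half of [eta] absorbs the factor [S]; the other half dominates [t]. *)
      have h5 : S w * expR (t * S w) <= 2 / eta * expR (eta * S w).
        rewrite [eta * S w](_ : _ = eta / 2 * S w + eta / 2 * S w); last by field.
        rewrite expRD mulrA ler_pM ?expR_ge0//.
          by have := le_expRM (S w) e2; rewrite invf_div.
        by rewrite ler_expR ler_wpM2r//; lra.
      rewrite [leRHS](_ : _ = 2 * (t * (2 / eta * expR (eta * S w)))); last by ring.
      by rewrite ler_pM2l// ler_pM2l.
  move=> h; apply: (@le_trans _ _ (2 * expR b' * (4 * t / eta * M))).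
    by rewrite ler_wpM2l// mulr_ge0// expR_ge0.
  rewrite [leLHS](_ : _ = t * (8 * expR b' * M) / eta); last by ring.
  by rewrite ler_pdivrMr.
have te : t <= eta by lra.
have fS' th k x : `|th| <= t -> f th k.+1 x =
     \int[P]_(w in D) (expR (th * a x w) * f th k (B x w)).
  by move=> tht; apply: fS; exact: le_trans te.
have Sb' w : E w -> S w <= b' by move=> Ew; rewrite le_max Sb.
have b'0 : 0 <= b' by rewrite le_max lexx orbT.
have [Lam [C [K [h0 [K0 h00 hf hl hd]]]]] :=
  growth_rate_smooth mD PD mS S0 intS x0 ma aS mf f0 fS' mE ED Sb' fE b'0 t0 t1 t4 p0 Jp.
by exists t, Lam, C, K, h0; split=> //; rewrite t0.
Qed.

(** * Legendre transform of a rate with bounded second differences *)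

Definition legendre {R : realType} (Lam : R -> R) (t e : R) : R :=
  sup [set th * e - Lam th | th in [set th | `|th| <= t]].

Section legendre.
Context {R : realType}.
Variables (Lam : R -> R) (t K h0 : R).
Hypotheses (t0 : 0 < t) (K0 : 0 <= K) (h00 : 0 < h0).
Hypothesis lip : forall th h, `|th| <= t -> `|th + h| <= t ->
  Lam (th + h) - Lam th <= K * `|h|.
Hypothesis smooth : forall th h, `|th| <= t -> `|th + h| <= t -> `|th - h| <= t ->
  `|h| <= h0 -> Lam (th + h) + Lam (th - h) - 2 * Lam th <= K * h ^+ 2.
Hypothesis Lam0 : Lam 0 = 0.
Hypothesis Lam_gt0 : forall th, `|th| <= t -> th != 0 -> 0 < Lam th.
Local Notation c := (legendre Lam t).

(** For [|e|] below this radius, [th * e - Lam th] is negative at both ends of the interval but 0 at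
    [th = 0], so maximizers are interior. *)
Definition legendre_radius := Num.min (Lam t) (Lam (- t)) / t.
Local Notation delta := legendre_radius.

Lemma legendre_radius_gt0 : 0 < delta.
Proof.
rewrite divr_gt0// lt_min !Lam_gt0 ?normrN ?gtr0_norm//.
- by rewrite oppr_eq0 gt_eqF.
- by rewrite gt_eqF.
Qed.

Local Lemma Lam_ge0 th : `|th| <= t -> 0 <= Lam th.
Proof.
by move=> tht; have [->|/(Lam_gt0 tht)/ltW//] := eqVneq th 0; rewrite Lam0.
Qed.

(** The one-sided bound [lip], read in both directions, makes the objective continuous on a compact
    interval. *)
Lemma legendre_attained e : exists2 th, `|th| <= t &
  c e = th * e - Lam th /\ forall th', `|th'| <= t -> th' * e - Lam th' <= th * e - Lam th.
Proof.
have [||th] := @EVT_max R (fun th => th * e - Lam th) (- t) t.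
- by have h := t0; lra.
- apply/subspace_continuousP => x; rewrite /= in_itv/= -ler_norml => xt.
  apply/cvgrPdist_le => d d0; rewrite near_withinE.
  have Ke : 0 < K + `|e| + 1 by rewrite ltr_wpDl// addr_ge0.
  near=> y; rewrite /= in_itv/= -ler_norml => yt.
  have hxy : `|x - y| <= d / (K + `|e| + 1).
    near: y; apply: cvgr_dist_le; first exact: cvg_id.
    by rewrite divr_gt0.
  rewrite [X in `|X|](_ : _ = (x * e - Lam x) - (y * e - Lam y))//.
  rewrite [X in `|X|](_ : _ = (x - y) * e + (Lam y - Lam x)); last by ring.
  have l1 : `|Lam y - Lam x| <= K * `|x - y|.
    rewrite ler_norml; apply/andP; split.
      have := @lip y (x - y) yt; rewrite addrC subrK => /(_ xt); lra.
    by have := @lip x (y - x) xt; rewrite addrC subrK distrC => /(_ yt).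
  apply: le_trans (ler_normD _ _) _; rewrite normrM.
  rewrite ler_pdivlMr// in hxy.
  by have := normr_ge0 (x - y); lra.
rewrite in_itv/= -ler_norml => tht thmax; exists th => //.
have mx th' : `|th'| <= t -> th' * e - Lam th' <= th * e - Lam th.
  by move=> th't; apply: thmax; rewrite in_itv/= -ler_norml.
split=> //; apply/eqP; rewrite eq_le; apply/andP; split.
  apply: ge_sup; first by exists (th * e - Lam th); exists th.
  by move=> _ [th' th't <-]; exact: mx.
apply: ub_le_sup; last by exists th.
by exists (th * e - Lam th) => _ [th' th't <-]; exact: mx.
Unshelve. all: by end_near. Qed.

Lemma legendre_ub e th : `|th| <= t -> th * e - Lam th <= c e.
Proof. by move=> tht; have [th' _ [-> ->]] := legendre_attained e. Qed.

Lemma legendre_ge0 e : 0 <= c e.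
Proof.
have := @legendre_ub e 0; rewrite mul0r Lam0 subr0; apply.
by rewrite normr0 ltW.
Qed.

Lemma legendre_interior e th : `|e| < delta -> `|th| <= t ->
  c e = th * e - Lam th -> `|th| < t.
Proof.
move=> ed tht ce; rewrite lt_neqAle tht andbT; apply/eqP => tht'.
have := legendre_ge0 e; rewrite ce leNgt => /negP; apply.
rewrite subr_lt0 (le_lt_trans (ler_norm _))// normrM tht' mulrC -ltr_pdivlMr//.
apply: lt_le_trans ed _; rewrite ler_pM2r ?invr_gt0//.
have h := t0; have [th0|th0] := leP 0 th.
  by rewrite -tht' (ger0_norm th0) ge_min lexx.
by rewrite -tht' (ltr0_norm th0) opprK ge_min lexx orbT.
Qed.

Lemma legendre_tangent e th h : `|th| <= t -> c e = th * e - Lam th ->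
  `|th + h| <= t -> Lam th + h * e <= Lam (th + h).
Proof. by move=> tht ce thh; have := legendre_ub e thh; rewrite ce; lra. Qed.

(** Stands in for the uniqueness of a derivative of [Lam] at [th]: tangents of slopes [a] and [b],
    used at [th + h] and [th - h], give [h (a - b) <= K h^2], impossible for small [h] if
    [b < a]. *)
Lemma legendre_maximizer_inj e1 e2 th : `|th| < t ->
  c e1 = th * e1 - Lam th -> c e2 = th * e2 - Lam th -> e1 = e2.
Proof.
move=> tht.
suff le a b : c a = th * a - Lam th -> c b = th * b - Lam th -> a <= b.
  by move=> h1 h2; apply/eqP; rewrite eq_le !le.
move=> ha hb; rewrite leNgt; apply/negP => ba.
pose h := Num.min h0 (Num.min (t - `|th|) ((a - b) / (2 * (K + 1)))).
have K1 : 0 < 2 * (K + 1) by have := K0; lra.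
have h_gt0 : 0 < h by rewrite !lt_min h00 subr_gt0 tht divr_gt0// subr_gt0.
have hh0 : h <= h0 by rewrite ge_min lexx.
have ht : h <= t - `|th| by rewrite !ge_min lexx orbT.
have hK : h * (2 * (K + 1)) <= a - b by rewrite -ler_pdivlMr// !ge_min lexx !orbT.
have nh : `|h| = h by exact: gtr0_norm.
have thh : `|th + h| <= t by apply: le_trans (ler_normD _ _) _; lra.
have thmh : `|th - h| <= t by apply: le_trans (ler_normB _ _) _; lra.
have h1 := legendre_tangent (ltW tht) ha thh.
have h2 := legendre_tangent (ltW tht) hb thmh.
have h3 := smooth (ltW tht) thh thmh; rewrite nh in h3; have {}h3 := h3 hh0.
have h4 : h * (a - b) <= h * (K * h) by rewrite expr2 in h3; lra.
rewrite ler_pM2l// in h4.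
have h5 : 0 <= K * h by rewrite mulr_ge0// ltW.
by lra.
Qed.

Lemma legendre0 : c 0 = 0.
Proof.
apply/eqP; rewrite eq_le legendre_ge0 andbT.
have [th tht [-> _]] := legendre_attained 0.
by rewrite mulr0 sub0r oppr_le0 Lam_ge0.
Qed.

(** If [c e = 0], then [th = 0] is a maximizer both for [e] and for 0, and an interior maximizer
    determines its slope. *)
Lemma legendre_eq0 e : `|e| < delta -> c e = 0 <-> e = 0.
Proof.
move=> ed; split=> [ce|->]; last exact: legendre0.
by apply: (@legendre_maximizer_inj _ _ 0); rewrite ?normr0// ?legendre0 ?ce Lam0; ring.
Qed.

(** Without strict inequality, the maximizer at the intermediate point would be a maximizer for [x]
    and for [y], against [legendre_maximizer_inj]. *)
Lemma legendre_strictly_convex : strictly_convex_on [set e | `|e| < delta] c.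
Proof.
move=> x y s /= xd yd xy /andP[s0 s1].
have zd : `|s * x + (1 - s) * y| < delta.
  have s1' : 0 < 1 - s by lra.
  rewrite (le_lt_trans (ler_normD _ _))// !normrM (gtr0_norm s0) (gtr0_norm s1').
  have h1 : s * `|x| < s * delta by rewrite ltr_pM2l.
  have h2 : (1 - s) * `|y| < (1 - s) * delta by rewrite ltr_pM2l.
  by lra.
have [th tht [cz _]] := legendre_attained (s * x + (1 - s) * y).
have thlt := legendre_interior zd tht cz.
have hx := legendre_ub x tht; have hy := legendre_ub y tht.
have s1' : 0 < 1 - s by lra.
rewrite ltNge; apply/negP => hle.
have hx' : s * (th * x - Lam th) <= s * c x by rewrite ler_pM2l.
have hy' : (1 - s) * (th * y - Lam th) <= (1 - s) * c y by rewrite ler_pM2l.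
move: hle; rewrite cz => hle.
have ex : c x = th * x - Lam th.
  apply/eqP; rewrite eq_le hx andbT -(ler_pM2l s0); lra.
have ey : c y = th * y - Lam th.
  apply/eqP; rewrite eq_le hy andbT -(ler_pM2l s1'); lra.
by move/eqP: xy; apply; exact: legendre_maximizer_inj thlt ex ey.
Qed.

Lemma legendre_maximizer_ge0 e th : 0 < e -> `|th| <= t -> c e = th * e - Lam th -> 0 <= th.
Proof.
move=> e0 tht ce; rewrite leNgt; apply/negP => th0.
have := legendre_ge0 e; rewrite ce; have := Lam_ge0 tht.
have : th * e < 0 by rewrite nmulr_rlt0.
by lra.
Qed.

Lemma legendre_lipschitz e e' : 0 <= e' -> c (e + e') <= c e + t * e'.
Proof.
move=> e'0; have [th tht [-> _]] := legendre_attained (e + e').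
have := legendre_ub e tht.
have : th * e' <= t * e' by rewrite ler_wpM2r// (le_trans (ler_norm _)).
by lra.
Qed.

(* At an interior maximizer [th] for [e], the second difference bound makes
   [Lam] quadratically close to its tangent of slope [e]. *)
Lemma legendre_tangent_ub e th h : `|th| <= t -> c e = th * e - Lam th ->
  `|th + h| <= t -> `|th - h| <= t -> `|h| <= h0 ->
  Lam (th + h) <= Lam th + h * e + K * h ^+ 2.
Proof.
move=> tht ce thh thmh hh0.
have := legendre_tangent tht ce thmh; have := smooth tht thh thmh hh0.
by lra.
Qed.

End legendre.

(** Carries the upper tail to the lower one: passing to the opposite process reflects [Lam]. *)
Lemma legendreN {R : realType} (Lam : R -> R) (t e : R) :
  legendre (fun th => Lam (- th)) t e = legendre Lam t (- e).
Proof.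
rewrite /legendre; congr sup; apply/seteqP; split => _ [th tht <-].
  by exists (- th); rewrite /= ?normrN// mulrNN.
by exists (- th); rewrite /= ?normrN// opprK mulrN mulNr.
Qed.

(** * Exponential bounds and the large deviation limit *)

Section exponential_tilting.
Context {d} {T : measurableType d} {R : realType} (P : probability T R).
Variables (Z : T -> R) (F : R -> R).
Hypothesis mZ : measurable_fun setT Z.

Local Lemma mexpR th : measurable_fun setT (fun w => (expR (th * Z w))%:E).
Proof.
by apply/measurable_EFinP; apply: measurableT_comp => //; exact: measurable_funM.
Qed.

Lemma chernoff_bound (U : set T) (th a f : R) : measurable U -> 0 <= th ->
  (forall w, U w -> a <= Z w) ->
  (\int[P]_w (expR (th * Z w))%:E = f%:E)%E ->
  fine (P U) <= expR (- (th * a)) * f.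
Proof.
move=> mU th0 UZ Ff.
have PU : (P U = (fine (P U))%:E)%E by rewrite fineK// fin_num_measure.
rewrite expRN ler_pdivlMl ?expR_gt0// -lee_fin EFinM -PU -Ff.
rewrite -[X in (_ * P X)%E]setIT -integral_indic// -ge0_integralZl//; last first.
  by apply/measurable_EFinP; exact: measurable_indic.
apply: ge0_le_integral => //=.
- apply: measurable_funeM; apply/measurable_EFinP; exact: measurable_indic.
- exact: mexpR.
- move=> w _; rewrite -EFinM lee_fin indicE; have [wU|_] := boolP (w \in U).
    by rewrite mulr1 ler_expR ler_wpM2l// UZ//; rewrite inE in wU.
  by rewrite mulr0 expR_ge0.
Qed.

(** Pointwise, the three terms dominate [exp(th Z)] on [a <= Z <= b], on [Z > b] and on [Z < a]
    respectively. This yields a lower bound for [P U] without passing to the tilted measure. *)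
Lemma tilting_bound (U : set T) (th h a b f fp fm : R) : measurable U ->
  0 <= th -> 0 <= h -> (forall w, a <= Z w <= b -> U w) ->
  (\int[P]_w (expR (th * Z w))%:E = f%:E)%E ->
  (\int[P]_w (expR ((th + h) * Z w))%:E = fp%:E)%E ->
  (\int[P]_w (expR ((th - h) * Z w))%:E = fm%:E)%E ->
  f <= expR (th * b) * fine (P U) + (expR (- (h * b)) * fp + expR (h * a) * fm).
Proof.
move=> mU th0 h0 ZU Ff Ffp Ffm.
have PU : (P U = (fine (P U))%:E)%E by rewrite fineK// fin_num_measure.
rewrite -lee_fin 2!EFinD 3!EFinM -PU -Ff -Ffp -Ffm.
have mI : measurable_fun setT (fun w => (\1_U w : R)%:E).
  by apply/measurable_EFinP; exact: measurable_indic.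
rewrite -[X in (_ * P X)%E]setIT -integral_indic//.
have e0 x : (0 <= (expR x : R)%:E)%E by rewrite lee_fin expR_ge0.
rewrite -!ge0_integralZl//; try exact: mexpR.
have me c x : measurable_fun setT (fun w => (c%:E * (expR (x * Z w))%:E)%E).
  by apply: measurable_funeM; exact: mexpR.
have mi c : measurable_fun setT (fun w => (c%:E * (\1_U w : R)%:E)%E).
  exact: measurable_funeM.
have ei w c : (0 <= (expR c)%:E * (\1_U w : R)%:E)%E by rewrite mule_ge0// lee_fin.
have ee x y : (0 <= (expR x : R)%:E * (expR y)%:E)%E by rewrite mule_ge0.
rewrite -ge0_integralD//.
rewrite -ge0_integralD//; last 2 first.
- by move=> w _; rewrite adde_ge0.
- exact: emeasurable_funD.
apply: ge0_le_integral => //=.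
- exact: mexpR.
- by apply: emeasurable_funD => //; exact: emeasurable_funD.
move=> w _; rewrite -!EFinM -!EFinD lee_fin -!expRD.
have x0 (x : R) : 0 <= expR x by exact: expR_ge0.
have ie c : 0 <= expR c * \1_U w by rewrite mulr_ge0.
have [bZ|Zb] := ltP b (Z w).
  apply: (@le_trans _ _ (expR (- (h * b) + (th + h) * Z w))).
    rewrite ler_expR; have : h * b <= h * Z w by rewrite ler_wpM2l// ltW.
    by lra.
  by rewrite addrCA lerDl addr_ge0.
have [Za|aZ] := ltP (Z w) a.
  apply: (@le_trans _ _ (expR (h * a + (th - h) * Z w))).
    rewrite ler_expR; have : h * Z w <= h * a by rewrite ler_wpM2l// ltW.
    by lra.
  by rewrite addrA lerDr addr_ge0.
apply: (@le_trans _ _ (expR (th * b))); first by rewrite ler_expR ler_wpM2l.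
rewrite indicE mem_set ?mulr1; last by apply: ZU; rewrite aZ.
by rewrite lerDl addr_ge0.
Qed.

End exponential_tilting.

Lemma cvg_lne_rate {R : realType} (p : nat -> R) (l C : R) :
  (forall n, p n <= expR (n%:R * l + C)) ->
  (forall s, 0 < s -> exists C' (N : nat), forall n, (N <= n)%N ->
     expR (n%:R * (l - s) - C') <= p n) ->
  (fun n => (lne (p n)%:E * (n%:R^-1)%:E)%E) @ \oo --> l%:E.
Proof.
move=> ub lb; have [C1 [N1 lb1]] := lb 1 ltr01.
have p0 n : (N1 <= n)%N -> 0 < p n.
  by move=> /lb1; apply: lt_le_trans; rewrite expR_gt0.
(* Terms of small index may be infinite, where [p n] vanishes; beyond [N1] the logarithm is
   finite. *)
apply: cvg_EFin.
  near=> n; rewrite lne_EFin -?EFinM//; apply: p0.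
  by near: n; exact: nbhs_infty_ge.
apply/cvgrPdist_le => e e0.
have [|C2 [N2 lb2]] := lb (e / 2); first by rewrite divr_gt0.
near=> n.
have n1 : (N1 <= n)%N by near: n; exact: nbhs_infty_ge.
have n2 : (N2 <= n)%N by near: n; exact: nbhs_infty_ge.
have n3 : (Num.truncn (2 * (`|C| + `|C2|) / e) < n)%N.
  by near: n; exact: nbhs_infty_gt.
have n0 : 0 < n%:R :> R by rewrite ltr0n (leq_ltn_trans _ n3).
have nC : 2 * (`|C| + `|C2|) <= n%:R * e.
  by rewrite -ler_pdivrMr// ltW// (lt_le_trans (truncnS_gt _))// ler_nat.
rewrite (_ : (fine \o _) n = ln (p n) / n%:R); last first.
  by rewrite /comp lne_EFin ?p0// -EFinM.
have := ub n; have := lb2 n n2; rewrite -[p n]lnK ?posrE ?p0// !ler_expR lnK ?posrE ?p0//.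
set q := ln (p n) / n%:R.
have -> : ln (p n) = n%:R * q by rewrite /q; field; rewrite gt_eqF.
move=> h1 h2; have := ler_norm C; have := ler_norm C2 => a1 a2.
have c1 := normr_ge0 C; have c2 := normr_ge0 C2.
by rewrite ler_norml; apply/andP; split; rewrite -(ler_pM2l n0); lra.
Unshelve. all: by end_near. Qed.

Section gartner_ellis.
Context {d} {T : measurableType d} {R : realType} (P : probability T R).
Variables (Z : nat -> T -> R) (F : R -> nat -> R).
Variables (Lam : R -> R) (t C K h0 : R).
Hypotheses (t0 : 0 < t) (K0 : 0 <= K) (h00 : 0 < h0).
Hypothesis lip : forall th h, `|th| <= t -> `|th + h| <= t ->
  Lam (th + h) - Lam th <= K * `|h|.
Hypothesis smooth : forall th h, `|th| <= t -> `|th + h| <= t -> `|th - h| <= t ->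
  `|h| <= h0 -> Lam (th + h) + Lam (th - h) - 2 * Lam th <= K * h ^+ 2.
Hypothesis Lam0 : Lam 0 = 0.
Hypothesis Lam_gt0 : forall th, `|th| <= t -> th != 0 -> 0 < Lam th.
Hypothesis mZ : forall n, measurable_fun setT (Z n).
Hypothesis FE : forall th n, `|th| <= t ->
  (\int[P]_w (expR (th * Z n w))%:E = (F th n)%:E)%E.
Hypothesis F_gt0 : forall th n, `|th| <= t -> 0 < F th n.
Hypothesis FLam : forall th n, `|th| <= t -> `|ln (F th n) - n%:R * Lam th| <= C.
Local Notation c := (legendre Lam t).
Local Notation delta := (legendre_radius Lam t).

Local Lemma F_le th n : `|th| <= t -> F th n <= expR (n%:R * Lam th + C).
Proof.
move=> tht; rewrite -[leLHS]lnK ?posrE ?F_gt0// ler_expR.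
by have := FLam n tht; rewrite ler_norml => /andP[_]; lra.
Qed.

Local Lemma F_ge th n : `|th| <= t -> expR (n%:R * Lam th - C) <= F th n.
Proof.
move=> tht; rewrite -[leRHS]lnK ?posrE ?F_gt0// ler_expR.
by have := FLam n tht; rewrite ler_norml => /andP[+ _]; lra.
Qed.

Local Lemma C_ge0 : 0 <= C.
Proof. by apply: le_trans (FLam 0%N (_ : `|0| <= t)) => //; rewrite normr0 ltW. Qed.

(** Chernoff's bound at the maximizer for [e], which is nonnegative because [e > 0]; the slack [M]
    costs [t * M]. *)
Lemma large_deviation_ub e M (U : set T) n : 0 < e < delta -> 0 <= M ->
  measurable U -> (forall w, U w -> n%:R * e - M <= Z n w) ->
  fine (P U) <= expR (- (n%:R * c e) + (t * M + C)).
Proof.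
move=> /andP[e0 ed] M0 mU UZ.
have [th tht [ce _]] := legendre_attained t0 K0 lip e.
have th0 := legendre_maximizer_ge0 t0 K0 lip Lam0 Lam_gt0 e0 tht ce.
apply: le_trans (chernoff_bound (mZ n) mU th0 UZ (FE n tht)) _.
apply: le_trans (ler_wpM2l (expR_ge0 _) (F_le n tht)) _.
rewrite -expRD ler_expR ce.
have : th * M <= t * M by rewrite ler_wpM2r// (le_trans (ler_norm _)).
by lra.
Qed.

(** Tilting at the maximizer [th] for [e + s] concentrates [Z n / n] near [e + s]: by
    [legendre_tangent_ub], moving the tilt by [h] either way shows that the tilted mass outside a
    window of half-width [s / 2] is relatively of order [exp(- n r)]. *)
Lemma large_deviation_lb e M s : 0 < e -> 0 < s -> e + s < delta ->
  exists N : nat, forall n (U : set T), (N <= n)%N -> measurable U ->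
  (forall w, n%:R * e + M < Z n w -> U w) ->
  expR (- (n%:R * (c e + 2 * t * s)) - (C + 1)) <= fine (P U).
Proof.
move=> e0 s0 esd; have C0 := C_ge0.
have es0 : 0 < e + s by lra.
have nes : `|e + s| < delta by rewrite gtr0_norm.
have [th tht [ce _]] := legendre_attained t0 K0 lip (e + s).
have th0 := legendre_maximizer_ge0 t0 K0 lip Lam0 Lam_gt0 es0 tht ce.
have thlt := legendre_interior t0 K0 lip Lam0 nes tht ce.
(* [h] is at most of order [s], so that [K * h ^+ 2 <= h * s / 4]: half of the gain [h * s / 2] at
   the edge of the window survives. *)
pose h := Num.min h0 (Num.min (t - `|th|) (s / 2 / (2 * (K + 1)))).
have K1 : 0 < 2 * (K + 1) by have := K0; lra.
have h_gt0 : 0 < h by rewrite !lt_min h00 subr_gt0 thlt !divr_gt0.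
have hh0 : h <= h0 by rewrite ge_min lexx.
have ht : h <= t - `|th| by rewrite !ge_min lexx orbT.
have hK : h * (2 * (K + 1)) <= s / 2 by rewrite -ler_pdivlMr// !ge_min lexx !orbT.
have nh : `|h| = h by exact: gtr0_norm.
have nNh : `|- h| <= h0 by rewrite normrN nh.
have nhh : `|h| <= h0 by rewrite nh.
have thh : `|th + h| <= t by apply: le_trans (ler_normD _ _) _; lra.
have thmh : `|th - h| <= t by apply: le_trans (ler_normB _ _) _; lra.
have thmh' : `|th - - h| <= t by rewrite opprK.
have up := legendre_tangent_ub t0 K0 lip smooth tht ce thh thmh nhh.
have um := legendre_tangent_ub t0 K0 lip smooth tht ce thmh thmh' nNh.
rewrite sqrrN in um.
pose r := h * s / 4.
have r0 : 0 < r by rewrite divr_gt0// mulr_gt0.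
have Kh : K * h ^+ 2 <= r.
  rewrite /r expr2; have : h * (h * (2 * (K + 1))) <= h * (s / 2) by rewrite ler_pM2l.
  have : 0 <= h * h by rewrite mulr_ge0// ltW.
  by lra.
(* The first term puts the window above [n * e + M]; the second makes each side term at most a
   quarter of the main one. *)
exists (Num.truncn (2 * (`|M| + 1) / s) + Num.truncn ((2 * C + 3) / r)).+2 => n U Nn mU ZU.
have nM : 2 * (`|M| + 1) <= n%:R * s.
  rewrite -ler_pdivrMr// ltW// (lt_le_trans (truncnS_gt _))// ler_nat.
  by rewrite (leq_trans _ Nn)// ltnS leqW// leq_addr.
have nr : 2 * C + 3 <= n%:R * r.
  rewrite -ler_pdivrMr// ltW// (lt_le_trans (truncnS_gt _))// ler_nat.
  by rewrite (leq_trans _ Nn)// ltnS leqW// leq_addl.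
pose a := n%:R * (e + s - s / 2).
pose b := n%:R * (e + s + s / 2).
have ZU' w : a <= Z n w <= b -> U w.
  move=> /andP[aZ _]; apply: ZU; apply: lt_le_trans aZ.
  by have := ler_norm M; rewrite /a; lra.
have := tilting_bound (mZ n) mU th0 (ltW h_gt0) ZU' (FE n tht) (FE n thh) (FE n thmh).
have Fp := F_le n thh; have Fm := F_le n thmh; have Fc := F_ge n tht.
have e1 : expR (- (h * b)) * F (th + h) n <= expR (n%:R * Lam th + C - n%:R * r).
  apply: le_trans (ler_wpM2l (expR_ge0 _) Fp) _.
  rewrite -expRD ler_expR /b.
  have : n%:R * Lam (th + h) <= n%:R * (Lam th + h * (e + s) + r) by rewrite ler_wpM2l//; lra.
  by rewrite /r; lra.
have e2 : expR (h * a) * F (th - h) n <= expR (n%:R * Lam th + C - n%:R * r).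
  apply: le_trans (ler_wpM2l (expR_ge0 _) Fm) _.
  rewrite -expRD ler_expR /a.
  have : n%:R * Lam (th - h) <= n%:R * (Lam th - h * (e + s) + r) by rewrite ler_wpM2l//; lra.
  by rewrite /r; lra.
move=> fU.
(* [2 * C] compensates the constants [C] of the two bounds on [F], and [expR 3 >= 4]. *)
have e3 : expR (n%:R * Lam th + C - n%:R * r) <= expR (n%:R * Lam th - C) * 4^-1.
  apply: (@le_trans _ _ (expR (n%:R * Lam th - C) * expR (- 3))).
    by rewrite -expRD ler_expR; lra.
  rewrite ler_wpM2l ?expR_ge0// expRN lef_pV2 ?posrE ?expR_gt0//.
  by have := @expR_ge1Dx R 3; lra.
have e4 : expR (n%:R * Lam th - C) * expR (- 1) <= expR (n%:R * Lam th - C) * 2^-1.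
  rewrite ler_wpM2l ?expR_ge0// expRN lef_pV2 ?posrE ?expR_gt0//.
  by have := @expR_ge1Dx R 1; lra.
have e5 : expR (n%:R * Lam th - C) * expR (- 1) <= expR (th * b) * fine (P U).
  by lra.
rewrite -ler_pdivrMl ?expR_gt0// -expRN -!expRD in e5.
apply: le_trans e5; rewrite ler_expR.
have h1 := legendre_lipschitz t0 K0 lip e (ltW s0).
have tht' : th <= t by rewrite (le_trans (ler_norm _)).
(* The upper edge [b] costs [n * th * s / 2] more than the optimum, and [legendre_lipschitz] charges
   [t * s] for replacing [e + s] by [e]. *)
have h2 : n%:R * (c (e + s) + th * s / 2) <= n%:R * (c e + 2 * t * s).
  rewrite ler_wpM2l//.
  have : th * s <= t * s by rewrite ler_wpM2r// ltW.
  have : 0 <= t * s by rewrite mulr_ge0// ltW.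
  by lra.
by rewrite ce in h2; rewrite /b; lra.
Qed.

(** The sandwich with slack [M] makes one limit serve all bounded initial states: [M] only affects a
    bounded factor and the index from which the lower bound holds. *)
Lemma gartner_ellis_ub e M (U : nat -> set T) : 0 < e < delta -> 0 <= M ->
  (forall n, measurable (U n)) ->
  (forall n w, n%:R * e + M < Z n w -> U n w) ->
  (forall n w, U n w -> n%:R * e - M <= Z n w) ->
  (fun n => (lne (P (U n)) * (n%:R^-1)%:E)%E) @ \oo --> (- c e)%:E.
Proof.
move=> /andP[e0 ed] M0 mU ZU UZ.
have PU n : (P (U n) = (fine (P (U n)))%:E)%E by rewrite fineK// fin_num_measure.
rewrite (_ : (fun n => _) = fun n => (lne (fine (P (U n)))%:E * (n%:R^-1)%:E)%E).
  2: by apply/funext => n; rewrite -PU.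
apply: (@cvg_lne_rate _ _ _ (t * M + C)) => [n|s s0].
  by rewrite mulrN; apply: large_deviation_ub (UZ n) => //; rewrite e0.
pose s' := Num.min (s / (2 * t)) ((delta - e) / 2).
have s'0 : 0 < s' by rewrite lt_min !divr_gt0 ?subr_gt0// mulr_gt0.
have s's : s' * (2 * t) <= s.
  by rewrite -ler_pdivlMr ?mulr_gt0// ge_min lexx.
have [|N HN] := @large_deviation_lb e M s' e0 s'0.
  have : s' <= (delta - e) / 2 by rewrite !ge_min lexx orbT.
  by lra.
exists (C + 1), N => n Nn; apply: le_trans (HN n _ Nn (mU n) (ZU n)).
rewrite ler_expR lerD2r -mulrN ler_wpM2l//.
by lra.
Qed.

End gartner_ellis.

(** * Independence and product laws *)

Section independence.
Context {d d1 d2 : measure_display} {T : measurableType d}.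
Context {T1 : measurableType d1} {T2 : measurableType d2} {R : realType}.
Variable P : probability T R.

(** Both sides are finite measures of [E] that agree on a pi-system containing the whole space. *)
Lemma pi_system_independent (G : set (set T)) (V : set T) : setI_closed G ->
  G setT -> (forall E, G E -> measurable E) -> measurable V ->
  (forall E, G E -> P (E `&` V) = (P E * P V)%E) ->
  forall E, <<s G >> E -> P (E `&` V) = (P E * P V)%E.
Proof.
move=> GI GT mG mV indG E sE.
have r0 : 0 <= fine (P V) by rewrite fine_ge0.
have PV : P V = (fine (P V))%:E by rewrite fineK// fin_num_measure.
pose m1 : {measure set T -> \bar R} := mrestr P mV.
pose m2 : {measure set T -> \bar R} := mscale (NngNum r0) P.
have m2E D : m2 D = (P D * P V)%E by rewrite /m2/= /mscale/= muleC PV.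
rewrite -m2E -[LHS]/(m1 E).
apply: (g_sigma_algebra_measure_unique G mG (fun=> setT)) => //.
- by rewrite bigcup_const//; exists 0%N.
- by move=> D GD; rewrite m2E -indG.
- move=> _; rewrite /m1/= /mrestr setTI.
  by rewrite (le_lt_trans (probability_le1 P mV))// ltry.
Qed.

Lemma probability_integral_cst (c : \bar R) : (\int[P]_w c = c)%E.
Proof.
rewrite (_ : (fun=> c) = cst c)// integral_cst//.
by rewrite [X in (_ * X)%E](_ : _ = 1%E) ?mule1//; exact: probability_setT.
Qed.

(** The joint law is the product of the marginals, because it is so on rectangles; Tonelli does the
    rest. *)
Lemma independent_integral (X : T -> T1) (Y : T -> T2) (h : T1 * T2 -> \bar R) :
  measurable_fun setT X -> measurable_fun setT Y ->
  (forall A B, measurable A -> measurable B ->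
     P (X @^-1` A `&` Y @^-1` B) = (P (X @^-1` A) * P (Y @^-1` B))%E) ->
  measurable_fun setT h -> (forall z, 0 <= h z)%E ->
  (\int[P]_w h (X w, Y w) = \int[P]_w \int[P]_w' h (X w, Y w'))%E.
Proof.
move=> mX mY ind mh h0.
pose X' : {mfun T >-> T1} := HB.pack X (isMeasurableFun.Build _ _ _ _ X mX).
pose Y' : {mfun T >-> T2} := HB.pack Y (isMeasurableFun.Build _ _ _ _ Y mY).
have mXY : measurable_fun setT (fun w => (X w, Y w)) by exact: measurable_fun_pair.
pose XY' : {mfun T >-> (T1 * T2)%type} :=
  HB.pack (fun w => (X w, Y w)) (isMeasurableFun.Build _ _ _ _ _ mXY).
transitivity (\int[distribution P XY']_z h z)%E.
  by rewrite ge0_integral_pushforward.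
transitivity (\int[(distribution P X') \x (distribution P Y')]_z h z)%E.
  apply: eq_measure_integral => A mA _; apply/esym.
  exact: product_measure_unique.
rewrite fubini_tonelli1//.
have mF := measurable_fun_fubini_tonelli_F (m2 := distribution P Y') h mh h0.
rewrite ge0_integral_pushforward//; last first.
  by move=> x _; rewrite /fubini_F integral_ge0.
rewrite preimage_setT; apply: eq_integral => w _ /=.
rewrite /fubini_F ge0_integral_pushforward//.
by apply: measurableT_comp => //; exact: pair1_measurable.
Qed.

End independence.

(** Generates the sigma-algebra on row vectors for which measurability of a map is measurability of
    its coordinates, as in [random_vec]. *)
Definition coordinate_preimages (R : realType) (d : nat) : set (set 'rV[R]_d) :=
  [set E | exists (i : 'I_d) (B : set R),
     measurable B /\ E = (fun y : 'rV[R]_d => y ord0 i) @^-1` B].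

Local Notation rVm R d := (g_sigma_algebraType (@coordinate_preimages R d)).

(** * Measurability of topical maps *)

Section topical_measurability.
Context {R : realType} {d : nat}.
Implicit Types (x y : 'rV[R]_d) (A : 'rV[R]_d -> 'rV[R]_d) (phi : 'rV[R]_d -> R).

Lemma topical_op_coord A i : topical_op A -> topical_fun (fun x => A x ord0 i).
Proof.
move=> [iso hom]; split=> [x y xy|x a]; first exact: iso.
by rewrite hom /cvec !mxE.
Qed.

Lemma topical_op_comp A A' : topical_op A -> topical_op A' -> topical_op (A \o A').
Proof.
move=> [i1 h1] [i2 h2]; split=> [x y xy|x a] /=; first exact/i1/i2.
by rewrite h2 h1.
Qed.

Lemma topical_fun_comp phi A : topical_fun phi -> topical_op A -> topical_fun (phi \o A).
Proof.
move=> [i1 h1] [i2 h2]; split=> [x y xy|x a] /=; first exact/i1/i2.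
by rewrite h2 h1.
Qed.

Lemma topical_fun_le phi x y a : topical_fun phi -> vle x (y + cvec d a) ->
  phi x <= phi y + a.
Proof. by move=> [iso hom] xy; rewrite -hom; exact: iso. Qed.

(** Nonexpansiveness in the sup norm: each point lies below the other translated by [a]. *)
Lemma topical_fun_dist phi x y a : topical_fun phi ->
  (forall i, `|x ord0 i - y ord0 i| <= a) -> `|phi x - phi y| <= a.
Proof.
move=> tphi xy; have vxy (u v : 'rV[R]_d) : (forall i, `|u ord0 i - v ord0 i| <= a) ->
    vle u (v + cvec d a).
  by move=> uv i; have := uv i; rewrite /cvec !mxE ler_norml => /andP[]; lra.
have h1 := topical_fun_le tphi (vxy _ _ xy).
have /(topical_fun_le tphi) h2 : vle y (x + cvec d a).
  by apply: vxy => i; rewrite distrC.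
by rewrite ler_norml; apply/andP; split; lra.
Qed.

Definition ratv (q : 'rV[rat]_d) : 'rV[R]_d := map_mx ratr q.

Lemma rational_above y e : 0 < e ->
  exists q : 'rV[rat]_d, vle y (ratv q) /\ vle (ratv q) (y + cvec d e).
Proof.
move=> e0.
have /choice[q qP] : forall i, exists r : rat, y ord0 i < ratr r < y ord0 i + e.
  move=> i; have [|r] := @rat_in_itvoo R (y ord0 i) (y ord0 i + e).
    by rewrite ltrDl.
  by rewrite in_itv; exists r.
exists (\row_i q i); split=> i; have /andP[h1 h2] := qP i.
  by rewrite !mxE ltW.
by rewrite /cvec !mxE ltW.
Qed.

(** A rational point slightly above [y] raises [phi] by less than the gap [t - phi y]; strict
    sublevel sets are thus countable unions of lower orthants. *)
Lemma topical_fun_ltP phi y t : topical_fun phi ->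
  phi y < t <-> exists q : 'rV[rat]_d, vle y (ratv q) /\ phi (ratv q) < t.
Proof.
move=> tphi; split=> [yt|[q [yq qt]]]; last exact: le_lt_trans (tphi.1 _ _ yq) qt.
have e0 : 0 < (t - phi y) / 2 by rewrite divr_gt0// subr_gt0.
have [q [yq qy]] := rational_above y e0; exists q; split=> //.
by have := topical_fun_le tphi qy; lra.
Qed.

Lemma measurable_coord i : measurable_fun setT (fun y : rVm R d => y ord0 i).
Proof.
move=> _ B mB; rewrite setTI; apply: sub_sigma_algebra.
by exists i, B.
Qed.

Lemma measurable_rVP {dT} {T : measurableType dT} (X : T -> rVm R d) :
  (forall i, measurable_fun setT (fun w => X w ord0 i)) -> measurable_fun setT X.
Proof.
move=> mX; apply: (@measurability _ _ T (rVm R d) setT X (@coordinate_preimages R d)) => //.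
move=> _ [_ [i [B [mB ->]]] <-].
exact: mX.
Qed.

Lemma measurable_vle y : measurable ([set x : rVm R d | vle x y]).
Proof.
have -> : [set x : rVm R d | vle x y] =
    \bigcap_(i in [set: 'I_d]) ((fun x : rVm R d => x ord0 i) @^-1` `]-oo, y ord0 i]).
  apply/seteqP; split=> x /=.
    by move=> xy i _ /=; rewrite in_itv/=; exact: xy.
  by move=> xy i; have := xy i Logic.I; rewrite /= in_itv.
apply: fin_bigcap_measurable => // i _; rewrite -[X in measurable X]setTI.
by apply: measurable_coord => //; exact: measurable_itv.
Qed.

(** Joint measurability from measurability at fixed points: by [topical_fun_ltP] a sublevel set is a
    countable union of rectangles. *)
Lemma measurable_fun_topical {dT} {T : measurableType dT} (h : T -> 'rV[R]_d -> R) :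
  (forall w, topical_fun (h w)) -> (forall q, measurable_fun setT (h ^~ q)) ->
  measurable_fun setT (fun z : T * rVm R d => h z.1 z.2).
Proof.
move=> th mh; apply: (measurability (@RGenInftyO.G R)).
  exact: RGenInftyO.measurableE.
move=> _ [_ [t ->] <-]; rewrite setTI.
have -> : (fun z : T * rVm R d => h z.1 z.2) @^-1` `]-oo, t[ =
    \bigcup_(q in [set: 'rV[rat]_d])
      (((h ^~ (ratv q)) @^-1` `]-oo, t[) `*` [set y : rVm R d | vle y (ratv q)]).
  apply/seteqP; split=> [[w y]|[w y] [q _ []]] /=; rewrite !in_itv/=.
    by move=> /topical_fun_ltP-/(_ (th w))[q [yq qt]]; exists q => //=; rewrite in_itv.
  by move=> qt yq; apply/topical_fun_ltP => //; exists q.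
apply: countable_bigcupT_measurable => [|q]; first exact: countableP.
apply: measurableX; last exact: measurable_vle.
rewrite -[X in measurable X]setTI; apply: mh => //.
Qed.

Lemma measurable_topical_fun phi : topical_fun phi ->
  measurable_fun setT (phi : rVm R d -> R).
Proof.
move=> tphi.
have m2 := @measurable_fun_topical _ (rVm R d) (fun=> phi) (fun=> tphi)
  (fun=> measurable_cst _).
exact: measurableT_comp m2 (measurable_fun_pair (@measurable_id _ _ _) (@measurable_id _ _ _)).
Qed.

Lemma measurable_random_op {dT} {T : measurableType dT} (A : T -> 'rV[R]_d -> 'rV[R]_d) :
  (forall w, topical_op (A w)) -> random_op A ->
  measurable_fun setT (fun z : T * rVm R d => (A z.1 z.2 : rVm R d)).
Proof.
move=> tA mA; apply: measurable_rVP => i.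
apply: (@measurable_fun_topical _ _ (fun w x => A w x ord0 i)) => [w|q].
  exact: topical_op_coord.
exact: mA.
Qed.

End topical_measurability.

(** The generator of [sigma_op], named so that [T] can carry the sigma-algebra of a single operator
    as a measurable space. *)
Definition op_preimages {dT} {T : measurableType dT} {R : realType} {d : nat}
    (A : T -> 'rV[R]_d -> 'rV[R]_d) : set (set T) :=
  [set E | exists (x : 'rV[R]_d) (i : 'I_d) (B : set R),
     measurable B /\ E = (fun w => A w x ord0 i) @^-1` B].

(** The pi-system on which [iid_ops] states equality in distribution; it generates the sigma-algebra
    in which operators have laws. *)
Definition op_cylinders (R : realType) (d : nat) : set (set ('rV[R]_d -> 'rV[R]_d)) :=
  [set E | exists (k : nat) (x : 'I_k -> 'rV[R]_d) (i : 'I_k -> 'I_d)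
      (B : 'I_k -> set R), (forall j, measurable (B j)) /\
      E = [set a : 'rV[R]_d -> 'rV[R]_d | forall j, B j (a (x j) ord0 (i j))]].

Local Notation opm R d := (g_sigma_algebraType (@op_cylinders R d)).

Lemma op_cylinders_setI R d : setI_closed (@op_cylinders R d).
Proof.
move=> _ _ [k [x [i [B [mB ->]]]]] [l [y [j [C [mC ->]]]]].
pose glue V (u : 'I_k -> V) (v : 'I_l -> V) (m : 'I_(k + l)) :=
  match fintype.split m with inl a => u a | inr b => v b end.
exists (k + l)%N, (glue _ x y), (glue _ i j), (glue _ B C); split.
  by move=> m; rewrite /glue; case: fintype.split.
apply/seteqP; split=> [a [/= aB aC] m|a /= h].
  by rewrite /glue; case: fintype.split.
split=> m /=.
  have := h (lshift l m); rewrite /glue; case: split_ordP => m' /eqP.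
    by rewrite eq_lshift => /eqP->.
  by rewrite eq_lrshift.
have := h (rshift k m); rewrite /glue; case: split_ordP => m' /eqP.
  by rewrite eq_rlshift.
by rewrite eq_rshift => /eqP->.
Qed.

(** * Markov property of the orbits *)

Section markov_property.
Context {dT} {T : measurableType dT} {R : realType} {d : nat}.
Variables (P : probability T R) (A : nat -> T -> 'rV[R]_d -> 'rV[R]_d).
Hypothesis iidA : iid_ops P A.
Hypothesis topA : forall n w, topical_op (A n w).
Local Notation Tn n := (g_sigma_algebraType (op_preimages (A n))).
Local Notation orbit n x w := (traj A (fun=> x) n w).

Lemma orbit_topical n w : topical_op (fun x => orbit n x w).
Proof.
elim: n => [|n IH]; first by split.
exact: (topical_op_comp (topA n w) IH).
Qed.

Lemma traj_orbit (X0 : T -> 'rV[R]_d) n w : traj A X0 n w = orbit n (X0 w) w.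
Proof. by elim: n => //= n ->. Qed.

Lemma measurable_op n : measurable_fun setT (A n : T -> opm R d).
Proof.
apply: (@measurability _ _ T (opm R d) setT (A n) (@op_cylinders R d)) => //.
move=> _ [_ [k [x [i [B [mB ->]]]]] <-]; rewrite setTI.
have -> : A n @^-1` [set a : 'rV[R]_d -> 'rV[R]_d | forall j, B j (a (x j) ord0 (i j))] =
    \bigcap_(j in [set: 'I_k]) ((fun w => A n w (x j) ord0 (i j)) @^-1` (B j)).
  by apply/seteqP; split=> w /=; [move=> h j _; exact: h|move=> h j; exact: h].
apply: fin_bigcap_measurable => // j _; rewrite -[X in measurable X]setTI.
by have [+ _] := iidA; apply.
Qed.

Lemma same_law (H : opm R d -> \bar R) n : measurable_fun setT H ->
  (forall a, 0 <= H a)%E -> (\int[P]_w H (A n w) = \int[P]_w H (A 0 w))%E.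
Proof.
move=> mH H0.
pose X m : {mfun T >-> opm R d} :=
  HB.pack (A m : T -> opm R d) (isMeasurableFun.Build _ _ _ _ _ (measurable_op m)).
transitivity (\int[distribution P (X n)]_a H a)%E.
  by rewrite ge0_integral_pushforward.
transitivity (\int[distribution P (X 0%N)]_a H a)%E; last first.
  by rewrite ge0_integral_pushforward.
apply: eq_measure_integral => C mC _.
apply: (@measure_unique _ R (opm R d) (@op_cylinders R d) (fun=> setT) erefl
  (@op_cylinders_setI R d) _ _ (distribution P (X n)) (distribution P (X 0%N))) => //.
(* The whole space is the cylinder without constraints; its coordinate indices come from an empty
   family, since ['I_d] offers no default. *)
- move=> _; exists 0%N, (fun=> 0), (fun j : 'I_0 => False_rect _ (notF (ltn_ord j))), (fun=> setT).
  by split=> //; apply/seteqP; split.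
- by rewrite bigcup_const//; exists 0%N.
- by move=> _ [k [x [i [B [mB ->]]]]]; have [_ [_ +]] := iidA; apply.
- by move=> k; rewrite -ge0_fin_numE //; exact: fin_num_measure.
Qed.

Lemma measurable_eval y : measurable_fun setT (fun a : opm R d => a y : rVm R d).
Proof.
apply: measurable_rVP => i _ B mB; rewrite setTI; apply: sub_sigma_algebra.
exists 1%N, (fun=> y), (fun=> i), (fun=> B); split=> //.
by apply/seteqP; split=> a /=; [move=> h j|apply; exact: ord0].
Qed.

Lemma measurable_opE n : measurable_fun setT (fun z : T * rVm R d => A n z.1 z.2 : rVm R d).
Proof. by apply: measurable_random_op => //; have [+ _] := iidA; apply. Qed.

Lemma measurable_op_preimages n :
  measurable_fun setT (fun z : Tn n * rVm R d => A n z.1 z.2 : rVm R d).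
Proof.
apply: (@measurable_random_op _ _ _ (Tn n)) => // x i _ B mB.
by rewrite setTI; apply: sub_sigma_algebra; exists x, i, B.
Qed.

Lemma sigma_op_measurable n E : sigma_op (A n) E -> measurable E.
Proof.
apply: smallest_sub => [|_ [x [i [B [mB ->]]]]].
  exact: sigma_algebra_measurable.
by rewrite -[X in measurable X]setTI; have [+ _] := iidA; apply.
Qed.

Lemma measurable_id_op n : measurable_fun setT (fun w : T => w : Tn n).
Proof. by move=> _ B mB; rewrite setTI; exact: sigma_op_measurable mB. Qed.

Lemma measurable_orbit n :
  measurable_fun setT (fun z : T * rVm R d => orbit n z.2 z.1 : rVm R d).
Proof.
elim: n => [|n IH] /=; first exact: measurable_snd.
have m2 : measurable_fun setT (fun z : T * rVm R d => (z.1, orbit n z.2 z.1 : rVm R d)).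
  by apply: measurable_fun_pair => //; exact: measurable_fst.
exact: measurableT_comp (@measurable_opE n) m2.
Qed.

Lemma measurable_orbit1 n x : measurable_fun setT (fun w : T => orbit n x w : rVm R d).
Proof.
have m2 : measurable_fun setT (fun w : T => (w, x : rVm R d)) by exact: measurable_fun_pair.
exact: measurableT_comp (@measurable_orbit n) m2.
Qed.

(** [iid_ops] only speaks of events depending on one operator each, whereas an orbit mixes the first
    [n]. The induction detaches the last of them, whose event joins the family; hence the arbitrary
    family of later indices. *)
Lemma orbit_independent n x (B : set (rVm R d)) (s : seq nat) (E : nat -> set T) :
  measurable B -> uniq s -> (forall k, k \in s -> (n <= k)%N) ->
  (forall k, k \in s -> sigma_op (A k) (E k)) ->
  P ((fun w => orbit n x w) @^-1` B `&` \big[setI/setT]_(k <- s) E k) =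
  (P ((fun w => orbit n x w) @^-1` B) * P (\big[setI/setT]_(k <- s) E k))%E.
Proof.
elim: n B s E => [|n IH] B s E mB us sn sE.
  have [Bx|nBx] := pselect (B x).
    rewrite (_ : _ @^-1` B = setT); last by apply/seteqP; split.
    rewrite setTI (_ : P setT = 1%E) ?mul1e//; exact: probability_setT.
  rewrite (_ : _ @^-1` B = set0); last by apply/seteqP; split.
  by rewrite set0I measure0 mul0e.
pose X w : rVm R d := orbit n x w.
have mX : measurable_fun setT X := measurable_orbit1 n x.
have mV : measurable (\big[setI/setT]_(k <- s) E k).
  rewrite big_seq; apply: bigsetI_measurable => k ks.
  exact: sigma_op_measurable (sE k ks).
(* Intersections of an event on the state before step [n] with an event of [A n]: a pi-system
   generating the events of the orbit at [n.+1]. *)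
pose G := [set X @^-1` B' `&` U | B' in @measurable _ (rVm R d) & U in sigma_op (A n)].
have sT : sigma_op (A n) setT := @measurableT _ (Tn n).
have mXB (B' : set (rVm R d)) : measurable B' -> measurable (X @^-1` B').
  by move=> mB'; rewrite -[X in measurable X]setTI; exact: mX.
have ns : n \notin s by apply/negP => /sn; rewrite ltnn.
have [_ [indA _]] := iidA.
have indU U : sigma_op (A n) U ->
    P (U `&` \big[setI/setT]_(k <- s) E k) = (P U * P (\big[setI/setT]_(k <- s) E k))%E.
  move=> sU; pose E' k := if k == n then U else E k.
  have E'E : \big[setI/setT]_(k <- s) E k = \big[setI/setT]_(k <- s) E' k.
    rewrite big_seq [RHS]big_seq; apply: eq_bigr => k ks.
    by rewrite /E'; case: eqP => // kn; rewrite -kn ks in ns.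
  have E'n : E' n = U by rewrite /E' eqxx.
  have sE' k : k \in n :: s -> sigma_op (A k) (E' k).
    rewrite inE /E'; case: eqP => [->//|_ /= ks]; exact: sE.
  have h1 : P (\big[setI/setT]_(k <- n :: s) E' k) = (\prod_(k <- n :: s) P (E' k))%E.
    by apply: indA => //=; rewrite ns us.
  have h2 : P (\big[setI/setT]_(k <- s) E' k) = (\prod_(k <- s) P (E' k))%E.
    by apply: indA => // k ks; apply: sE'; rewrite inE ks orbT.
  by rewrite !big_cons E'n in h1; rewrite E'E h1 h2.
apply: (pi_system_independent (G := G)) => //.
- move=> _ _ [B1 mB1 [U1 sU1 <-]] [B2 mB2 [U2 sU2 <-]].
  rewrite setIACA -preimage_setI; exists (B1 `&` B2); first exact: measurableI.
  by exists (U1 `&` U2) => //; exact: (@measurableI _ (Tn n)).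
- by exists setT => //; exists setT => //; rewrite preimage_setT setTI.
- move=> _ [B1 mB1 [U1 sU1 <-]]; apply: measurableI; first exact: mXB.
  exact: sigma_op_measurable sU1.
- move=> _ [B1 mB1 [U sU <-]].
  pose E' k := if k == n then U else E k.
  have E'E : \big[setI/setT]_(k <- s) E k = \big[setI/setT]_(k <- s) E' k.
    rewrite big_seq [RHS]big_seq; apply: eq_bigr => k ks.
    by rewrite /E'; case: eqP => // kn; rewrite -kn ks in ns.
  have E'n : E' n = U by rewrite /E' eqxx.
  have h1 := IH B1 (n :: s) E' mB1.
  rewrite /= ns us big_cons E'n -E'E in h1.
  rewrite -setIA h1 ?indU//; last 2 first.
  + by move=> k; rewrite inE => /orP[/eqP->//|/sn/ltnW].
  + by move=> k; rewrite inE /E'; case: eqP => [->//|_ /= ks]; exact: sE.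
  have h2 := IH B1 [:: n] (fun=> U) mB1 isT.
  rewrite !big_cons !big_nil !setIT in h2.
  rewrite h2 ?muleA// => k; rewrite inE => /eqP->//.
- have mXG : measurable_fun setT (X : g_sigma_algebraType G -> rVm R d).
    move=> _ B' mB'; rewrite setTI; apply: sub_sigma_algebra.
    by exists B' => //; exists setT => //; rewrite setIT.
  have mIG : measurable_fun setT (fun w : g_sigma_algebraType G => w : Tn n).
    move=> _ U mU; rewrite setTI; apply: sub_sigma_algebra.
    by exists setT => //; exists U => //; rewrite preimage_setT setTI.
  have mp := measurable_fun_pair mIG mXG.
  have m3 := measurableT_comp (@measurable_op_preimages n) mp.
  by have := m3 measurableT B mB; rewrite setTI.
Qed.

(** The last operator is independent of the orbit so far and has the law of [A 0]. *)
Lemma markov_one_step (u : rVm R d -> \bar R) n x : measurable_fun setT u ->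
  (forall y, 0 <= u y)%E ->
  (\int[P]_w u (orbit n.+1 x w) = \int[P]_w \int[P]_w' u (A 0 w' (orbit n x w)))%E.
Proof.
move=> mu u0.
transitivity (\int[P]_w \int[P]_w' u (A n w' (orbit n x w)))%E; last first.
  apply: eq_integral => w _.
  apply: (@same_law (fun a => u (a (orbit n x w)))) => //.
  exact: measurableT_comp mu (measurable_eval _).
(* The second random element is the sample point itself, read in the sigma-algebra of [A n]. *)
apply: (@independent_integral _ _ _ T (rVm R d) (Tn n) R P
  (fun w => orbit n x w) (fun w => w) (fun z => u (A n z.2 z.1))) => //.
- exact: measurable_orbit1.
- exact: measurable_id_op.
- move=> B V mB mV; rewrite preimage_id.
  have kn k : k \in [:: n] -> k = n by rewrite inE => /eqP.
  have := @orbit_independent n x B [:: n] (fun=> V) mB isT.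
  by rewrite !big_cons !big_nil !setIT; apply=> k /kn->.
- have sw : measurable_fun setT (fun z : rVm R d * Tn n => (z.2, z.1)).
    exact: measurable_fun_pair measurable_snd measurable_fst.
  have m3 : measurable_fun setT (fun z : rVm R d * Tn n => A n z.2 z.1 : rVm R d).
    exact: measurableT_comp (@measurable_op_preimages n) sw.
  exact: measurableT_comp mu m3.
Qed.

Definition expected_orbit (u : rVm R d -> \bar R) n x : \bar R :=
  (\int[P]_w u (orbit n x w))%E.

Lemma expected_orbit_ge0 u n x : (forall y, 0 <= u y)%E -> (0 <= expected_orbit u n x)%E.
Proof. by move=> u0; apply: integral_ge0. Qed.

Lemma measurable_expected_orbit (u : rVm R d -> \bar R) n : measurable_fun setT u ->
  (forall y, 0 <= u y)%E ->
  measurable_fun setT (expected_orbit u n : rVm R d -> \bar R).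
Proof.
move=> mu u0.
pose h (z : rVm R d * T) := u (orbit n z.1 z.2).
apply: (measurable_fun_fubini_tonelli_F (m2 := P) h); last by move=> z; exact: u0.
have sw : measurable_fun setT (fun z : rVm R d * T => (z.2, z.1)).
  exact: measurable_fun_pair measurable_snd measurable_fst.
have m3 : measurable_fun setT (fun z : rVm R d * T => orbit n z.1 z.2 : rVm R d).
  exact: measurableT_comp (@measurable_orbit n) sw.
exact: measurableT_comp mu m3.
Qed.

(** Chapman-Kolmogorov. Since [markov_one_step] detaches the last operator, the induction is on [m],
    with [u] replaced by its one-step mean. *)
Lemma expected_orbitD (u : rVm R d -> \bar R) n m x : measurable_fun setT u ->
  (forall y, 0 <= u y)%E ->
  expected_orbit u (n + m) x = expected_orbit (expected_orbit u m) n x.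
Proof.
elim: m u => [|m IH] u mu u0.
  have E0 : expected_orbit u 0 = u.
    by apply/funext => y; exact: probability_integral_cst P (u y).
  by rewrite addn0 E0.
have step k y : expected_orbit u k.+1 y = expected_orbit (expected_orbit u 1) k y.
  exact: markov_one_step.
rewrite addnS step IH; last first.
- by move=> y; exact: expected_orbit_ge0.
- exact: measurable_expected_orbit.
by congr (expected_orbit _ n x); apply/funext => y; rewrite step.
Qed.

Lemma expected_orbit_le (u v : rVm R d -> \bar R) (c : R) n x :
  measurable_fun setT u -> measurable_fun setT v -> 0 <= c ->
  (forall y, 0 <= u y)%E -> (forall y, 0 <= v y)%E ->
  (forall y, u y <= c%:E * v y)%E ->
  (expected_orbit u n x <= c%:E * expected_orbit v n x)%E.
Proof.
move=> mu mv c0 u0 v0 uv; have mo := measurable_orbit1 n x.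
rewrite /expected_orbit -ge0_integralZl//; last exact: measurableT_comp mv mo.
apply: ge0_le_integral => //.
- exact: measurableT_comp mu mo.
- by apply: measurable_funeM; exact: measurableT_comp mv mo.
Qed.

Lemma expected_orbit_ge (u v : rVm R d -> \bar R) (c : R) n x :
  measurable_fun setT u -> measurable_fun setT v -> 0 <= c ->
  (forall y, 0 <= u y)%E -> (forall y, 0 <= v y)%E ->
  (forall y, c%:E * v y <= u y)%E ->
  (c%:E * expected_orbit v n x <= expected_orbit u n x)%E.
Proof.
move=> mu mv c0 u0 v0 uv; have mo := measurable_orbit1 n x.
rewrite /expected_orbit -ge0_integralZl//; last exact: measurableT_comp mv mo.
apply: ge0_le_integral => //.
- by move=> w _; rewrite mule_ge0// lee_fin.
- by apply: measurable_funeM; exact: measurableT_comp mv mo.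
- exact: measurableT_comp mu mo.
Qed.

End markov_property.

(** * The supremum of the displacement of [phi] *)

Section exponential_moment.
Context {R : realType} {d : nat}.
Variables (phi : 'rV[R]_d -> R) (theta : R).
Hypotheses (tphi : topical_fun phi) (theta0 : 0 < theta).
Implicit Types a : 'rV[R]_d -> 'rV[R]_d.

Definition displacement a x : R := `|phi (a x) - phi x|.

(** The default 0 is harmless in the supremum, because for [theta > 0] the values at rational points
    are at least 1. *)
Definition exp_displacement_rat a (k : nat) : \bar R :=
  if (unpickle k : option 'rV[rat]_d) is Some q
  then (expR (theta * displacement a (ratv q)))%:E else 0%E.

(* The supremum is restricted to rational points to make it measurable in
   [a]; for topical [a] nothing is lost, see [exp_displacementE]. *)
Definition exp_displacement a : \bar R := esups (exp_displacement_rat a) 0.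

Lemma exp_displacement_ratv a (q : 'rV[rat]_d) :
  ((expR (theta * displacement a (ratv q)))%:E <= exp_displacement a)%E.
Proof.
apply: ereal_sup_ubound; exists (pickle q) => //=.
by rewrite /exp_displacement_rat pickleK.
Qed.

Lemma exp_displacement_ge1 a : (1 <= exp_displacement a)%E.
Proof.
apply: le_trans (exp_displacement_ratv a 0).
by rewrite lee_fin -expR0 ler_expR mulr_ge0 ?normr_ge0 ?(ltW theta0).
Qed.

Lemma exp_displacement_ge0 a : (0 <= exp_displacement a)%E.
Proof. exact: le_trans lee01 (exp_displacement_ge1 a). Qed.

Lemma measurable_exp_displacement :
  measurable_fun setT (exp_displacement : opm R d -> \bar R).
Proof.
have mk k : measurable_fun setT (fun a : opm R d => exp_displacement_rat a k).
  rewrite /exp_displacement_rat; case: unpickle => [q|]; last exact: measurable_cst.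
  apply/measurable_EFinP; apply: measurableT_comp => //; apply: measurable_funM => //.
  apply: measurableT_comp => //; apply: measurable_funB => //.
  exact: measurableT_comp (measurable_topical_fun tphi) (measurable_eval _).
exact: (measurable_fun_esups mk).
Qed.

(** Extends the bound from rational points: moving [x] by at most [e / 2] changes [phi (a x)] and
    [phi x] by at most [e / 2] each. *)
Lemma displacement_le a x r : topical_op a -> exp_displacement a = r%:E ->
  displacement a x <= ln r / theta.
Proof.
move=> ta ar; apply/ler_addgt0Pr => e e0.
have e2 : 0 < e / 2 by rewrite divr_gt0.
have [q [xq qx]] := rational_above x e2.
have near_q i : `|x ord0 i - ratv (R := R) q ord0 i| <= e / 2.
  have := xq i; have := qx i; rewrite [leRHS]mxE [cvec d _ _ _]mxE => h1 h2.
  by rewrite ler_norml; apply/andP; split; lra.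
have h1 := topical_fun_dist tphi near_q.
have h2 := topical_fun_dist (topical_fun_comp tphi ta) near_q.
have r1 : 1 <= r by have := exp_displacement_ge1 a; rewrite ar lee_fin.
have h3 : displacement a (ratv q) <= ln r / theta.
  rewrite ler_pdivlMr// mulrC -ler_expR lnK ?posrE; last by lra.
  by rewrite -lee_fin -ar exp_displacement_ratv.
move: h1 h2 h3; rewrite /displacement /= !ler_norml => /andP[a1 a2] /andP[a3 a4] /andP[a5 a6].
by apply/andP; split; lra.
Qed.

Lemma exp_displacementE a : topical_op a ->
  expeR (theta%:E * ereal_sup (range (fun x => (`|phi (a x) - phi x|)%:E)))%E =
  exp_displacement a.
Proof.
move=> ta; apply/eqP; rewrite eq_le; apply/andP; split.
  case E : (exp_displacement a) => [r| |]; last 2 first.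
  - exact: leey.
  - by have := exp_displacement_ge0 a; rewrite E.
  have r1 : 1 <= r by have := exp_displacement_ge1 a; rewrite E lee_fin.
  have -> : r%:E = expeR (ln r)%:E by rewrite /= lnK// posrE; lra.
  rewrite lee_expeR -lee_pdivlMl// -EFinM mulrC.
  by apply: ge_ereal_sup => _ [x _ <-]; rewrite lee_fin; exact: displacement_le.
apply: ge_ereal_sup => _ [k _ <-]; rewrite /exp_displacement_rat.
case: unpickle => [q|]; last exact: expeR_ge0.
rewrite -[leLHS]/(expeR (theta * displacement a (ratv q))%:E) lee_expeR EFinM.
rewrite lee_pmul2l ?fin_numE//.
by apply: ereal_sup_ubound; exists (ratv q).
Qed.

End exponential_moment.

(** Passes from multiples of [N] to all times; [g] and [gr] stand for the moments after [r + k * N]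
    and [r] steps. A step multiplies moments by at most [L], so [gr <= L ^+ r]; and [gr] is not
    small, since [N - r] more steps lead to the moment at [N]. *)
Lemma interpolated_growth {R : realType} (g gr L la C : R) (k r N : nat) :
  (0 < N)%N -> (r <= N)%N -> 1 <= L -> 0 <= C ->
  g <= expR (k%:R * la + C) * gr -> expR (k%:R * la - C) * gr <= g ->
  gr <= L ^+ r -> expR (la - C) <= L ^+ (N - r) * gr ->
  0 < g /\ `|ln g - (r + k * N)%:R * (la / N%:R)| <= 2 * C + 2 * `|la| + N%:R * ln L.
Proof.
move=> N0 rN L1 C0 u1 l1 u2 l2.
have L0 : 0 < L by lra.
have N1 : 0 < N%:R :> R by rewrite ltr0n.
have LNp : 0 < L ^+ (N - r) by exact: exprn_gt0.
have gr0 : 0 < gr.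
  by rewrite -(pmulr_rgt0 _ LNp) (lt_le_trans _ l2)// expR_gt0.
have g0 : 0 < g by rewrite (lt_le_trans _ l1)// mulr_gt0 ?expR_gt0.
split=> //.
have U1 : ln g <= k%:R * la + C + ln gr.
  by rewrite -[X in X + ln _]expRK -lnM ?posrE ?expR_gt0// ler_ln ?posrE ?mulr_gt0 ?expR_gt0.
have V1 : k%:R * la - C + ln gr <= ln g.
  by rewrite -[X in X + ln _]expRK -lnM ?posrE ?expR_gt0// ler_ln ?posrE ?mulr_gt0 ?expR_gt0.
have lnL : 0 <= ln L by exact: ln_ge0.
have lnX m : (m <= N)%N -> ln (L ^+ m) <= N%:R * ln L.
  by move=> mN; rewrite lnXn// -[leLHS]mulr_natl ler_wpM2r// ler_nat.
have U2 : ln gr <= N%:R * ln L.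
  by apply: le_trans (lnX r rN); rewrite ler_ln ?posrE// exprn_gt0.
have V2 : la - C - N%:R * ln L <= ln gr.
  have := lnX (N - r)%N (leq_subr _ _).
  have : ln (expR (la - C)) <= ln (L ^+ (N - r) * gr).
    by rewrite ler_ln ?posrE ?mulr_gt0 ?expR_gt0.
  by rewrite expRK lnM ?posrE//; lra.
have -> : (r + k * N)%:R * (la / N%:R) = k%:R * la + r%:R / N%:R * la.
  by rewrite natrD natrM; field; rewrite gt_eqF.
have rk : `|r%:R / N%:R * la| <= `|la|.
  rewrite normrM ler_piMl// ger0_norm; last by rewrite divr_ge0.
  by rewrite ler_pdivrMr// mul1r ler_nat.
move: rk; rewrite ler_norml => /andP[w1 w2].
have aL := ler_norm (- la); rewrite normrN in aL.
have aL' := ler_norm la.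
by rewrite ler_norml; apply/andP; split; lra.
Qed.

(** * Growth rate of the exponential moments *)

Section growth_of_moments.
Context {dT} {T : measurableType dT} {R : realType} {d : nat}.
Variables (P : probability T R) (A : nat -> T -> 'rV[R]_d -> 'rV[R]_d).
Hypothesis iidA : iid_ops P A.
Hypothesis topA : forall n w, topical_op (A n w).
Variables (phi : 'rV[R]_d -> R) (theta : R).
Hypotheses (tphi : topical_fun phi) (theta0 : 0 < theta).
Hypothesis mom : (\int[P]_w expeR (theta%:E *
  ereal_sup (range (fun x => (`|phi (A 0 w x) - phi x|)%:E))) < +oo)%E.
Local Notation orbit n x w := (traj A (fun=> x) n w).
Local Notation H n w := (exp_displacement phi theta (A n w)).

Local Lemma measurable_H n : measurable_fun setT (fun w => H n w).
Proof.
exact: measurableT_comp (measurable_exp_displacement theta tphi) (measurable_op iidA n).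
Qed.

Lemma exp_moment : exists2 L : R, 1 <= L & forall n, (\int[P]_w H n w = L%:E)%E.
Proof.
have h0 : (\int[P]_w H 0%N w < +oo)%E.
  apply: le_lt_trans mom; rewrite le_eqVlt; apply/orP; left; apply/eqP.
  by apply: eq_integral => w _; rewrite exp_displacementE.
have h1 : (1 <= \int[P]_w H 0%N w)%E.
  rewrite -[leLHS](probability_integral_cst P).
  apply: ge0_le_integral => //; first exact: measurable_H.
  by move=> w _; exact: exp_displacement_ge1.
have fH : (\int[P]_w H 0%N w)%E \is a fin_num.
  by rewrite ge0_fin_numE// (le_trans _ h1).
exists (fine (\int[P]_w H 0%N w)%E); first by rewrite -lee_fin fineK.
move=> n; rewrite fineK; last exact: fH.
exact: (same_law iidA n (measurable_exp_displacement theta tphi)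
  (exp_displacement_ge0 phi theta0)).
Qed.

(** An almost sure event on which the displacement bounds hold at every sample point, as the
    abstract iteration requires; integrals are moved to it. *)
Definition finite_displacement := [set w | forall n, (H n w < +oo)%E].
Local Notation D := finite_displacement.

Lemma measurable_finite_displacement : measurable D.
Proof.
rewrite (_ : D = \bigcap_n [set w | (H n w < +oo)%E]); last first.
  by apply/seteqP; split=> w /= h n; [move=> _; exact: h|exact: h].
apply: bigcapT_measurable => n; rewrite -[X in measurable X]setTI.
apply: emeasurable_fun_infty_o => //; exact: measurable_H.
Qed.

Lemma ae_finite_displacement : P D = 1%E.
Proof.
have mD := measurable_finite_displacement.
have [L _ HL] := exp_moment.
have ae n : {ae P, forall w, (H n w < +oo)%E}.
  have iH : P.-integrable setT (fun w => H n w).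
    apply/integrableP; split; first exact: measurable_H.
    under eq_integral do rewrite gee0_abs ?exp_displacement_ge0//.
    by rewrite HL ltry.
  have := integrable_ae measurableT iH; apply: filterS => w /(_ I) h.
  by rewrite -ge0_fin_numE// exp_displacement_ge0.
have /(negligibleP _) : P.-negligible (~` D).
  by have := ae_foralln ae.
move=> /(_ (measurableC mD)) h.
have := probability_setC P mD; rewrite h => /eqP.
by rewrite eq_sym sube_eq ?add0e// => /eqP.
Qed.

Lemma integral_finite_displacement (h : T -> \bar R) : measurable_fun setT h ->
  (forall w, 0 <= h w)%E -> (\int[P]_w h w = \int[P]_(w in D) h w)%E.
Proof.
move=> mh h0; have mD := measurable_finite_displacement.
have PD0 : P (~` D) = 0%E.
  by rewrite (probability_setC P mD) ae_finite_displacement subee.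
by rewrite (ge0_negligible_integral (measurableC mD) _ _ _ PD0)// setTD setCK.
Qed.

(** Recovers a bound on the displacement from its exponential; on [D] nothing is lost by [fine]. *)
Definition max_displacement n w : R := ln (fine (H n w)) / theta.
Local Notation s n w := (max_displacement n w).

Lemma max_displacement_ge0 n w : 0 <= s n w.
Proof.
rewrite divr_ge0 ?(ltW theta0)//; have := exp_displacement_ge1 phi theta0 (A n w).
case: (H n w) => [r|_|//] /=; last by rewrite ln0.
by rewrite lee_fin; exact: ln_ge0.
Qed.

Lemma displacement_max n x w : D w -> `|phi (A n w x) - phi x| <= s n w.
Proof.
move=> Dw; apply: (displacement_le tphi theta0 x (topA n w)).
rewrite fineK// ge0_fin_numE; [exact: Dw|exact: exp_displacement_ge0].
Qed.

Lemma expR_max_displacement n w : D w -> expR (theta * s n w) = fine (H n w).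
Proof.
move=> Dw; rewrite mulrC divfK ?gt_eqF// lnK// posrE.
have := exp_displacement_ge1 phi theta0 (A n w).
have : H n w \is a fin_num.
  by rewrite ge0_fin_numE; [exact: Dw|exact: exp_displacement_ge0].
by move=> /fineK <-; rewrite lee_fin; exact: lt_le_trans.
Qed.

Lemma measurable_max_displacement n : measurable_fun setT (fun w => s n w).
Proof.
apply: measurable_funM => //; apply: measurableT_comp; first exact: measurable_ln.
by apply: measurableT_comp => //; exact: measurable_H.
Qed.

Lemma orbit_displacement N x w : D w ->
  `|phi (orbit N x w) - phi x| <= \sum_(k < N) s k w.
Proof.
move=> Dw; elim: N => [|N IH] /=; first by rewrite subrr normr0 big_ord0.
rewrite big_ord_recr /= addrC.
have -> : phi (A N w (orbit N x w)) - phi x =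
  (phi (A N w (orbit N x w)) - phi (orbit N x w)) + (phi (orbit N x w) - phi x) by ring.
by apply: le_trans (ler_normD _ _) _; rewrite lerD// displacement_max.
Qed.

Definition exp_phi (th : R) (y : rVm R d) : \bar R := (expR (th * phi y))%:E.

Lemma measurable_exp_phi th : measurable_fun setT (exp_phi th).
Proof.
apply/measurable_EFinP; apply: measurableT_comp => //; apply: measurable_funM => //.
exact: measurable_topical_fun.
Qed.

Lemma exp_phi_ge0 th y : (0 <= exp_phi th y)%E.
Proof. by rewrite lee_fin expR_ge0. Qed.

Local Notation G th n x := (expected_orbit P A (exp_phi th) n x).

Lemma measurable_G th n : measurable_fun setT (fun x : rVm R d => G th n x).
Proof.
exact: measurable_expected_orbit (measurable_exp_phi th) (exp_phi_ge0 th).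
Qed.

Lemma G_ge0 th n x : (0 <= G th n x)%E.
Proof. exact/expected_orbit_ge0/exp_phi_ge0. Qed.

(** Detaches the first operator, each step costing one factor [L]; where its displacement is
    infinite the pointwise bound is trivial. *)
Lemma G_le (L : R) th n x : 1 <= L -> (forall n, (\int[P]_w H n w = L%:E)%E) ->
  `|th| <= theta -> (G th n x <= (L ^+ n * expR (th * phi x))%:E)%E.
Proof.
move=> L1 HL tht; have L0 : 0 <= L by lra.
elim: n x => [|n IH] x.
  by rewrite /expected_orbit /= probability_integral_cst expr0 mul1r.
rewrite -add1n expected_orbitD//; [|exact: measurable_exp_phi|exact: exp_phi_ge0].
rewrite add1n exprSr -mulrA (mulrC L) mulrA EFinM -(HL 0%N) -ge0_integralZl//; last 3 first.
- exact: measurable_H.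
- by move=> w _; exact: exp_displacement_ge0.
- by rewrite lee_fin mulr_ge0 ?expR_ge0 ?exprn_ge0.
apply: ge0_le_integral => //.
- by move=> w _; exact: G_ge0.
- apply: measurableT_comp (measurable_orbit1 iidA topA 1 x).
  exact: measurable_G.
- by apply: measurable_funeM; exact: measurable_H.
- move=> w _ /=; apply: le_trans (IH _) _.
  case E : (H 0%N w) => [r| |]; last 2 first.
  + rewrite gt0_muley ?leey// lte_fin mulr_gt0 ?expR_gt0// exprn_gt0//; lra.
  + by have := exp_displacement_ge0 phi theta0 (A 0%N w); rewrite E.
  rewrite -EFinM lee_fin -mulrA ler_wpM2l ?exprn_ge0//.
  have r1 : 1 <= r.
    by have := exp_displacement_ge1 phi theta0 (A 0%N w); rewrite E lee_fin.
  rewrite -ler_pdivrMl ?expR_gt0// -expRN -expRD -[leRHS]lnK ?posrE ?ler_expR; last by lra.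
  have := displacement_le tphi theta0 x (topA 0 w) E; rewrite ler_pdivlMr// /displacement.
  have : th * (phi (A 0%N w x) - phi x) <= theta * `|phi (A 0%N w x) - phi x|.
    by rewrite (le_trans (ler_norm _))// normrM ler_wpM2r.
  by lra.
Qed.

Local Notation block_sum N w := (\sum_(k < N) s k w).

Lemma measurable_block_sum N : measurable_fun setT (fun w => block_sum N w).
Proof. by apply: measurable_sum => k; exact: measurable_max_displacement. Qed.

Lemma block_sum_ge0 N w : 0 <= block_sum N w.
Proof. by apply: sumr_ge0 => k _; exact: max_displacement_ge0. Qed.

(** A mean is at most a maximum: after division of [theta] by [N], the exponential is at most one of
    the [H k w], hence at most their sum, which has mean [N * L]. *)
Lemma integrable_block_sum N : (0 < N)%N ->
  P.-integrable D (EFin \o (fun w => expR (theta / N%:R * block_sum N w))).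
Proof.
move=> N0; have mD := measurable_finite_displacement.
have [L L1 HL] := exp_moment.
have mE : measurable_fun setT (fun w => (expR (theta / N%:R * block_sum N w))%:E).
  apply/measurable_EFinP; apply: measurableT_comp => //; apply: measurable_funM => //.
  exact: measurable_block_sum.
have mS : measurable_fun setT (fun w => \sum_(k < N) H k w)%E.
  by apply: emeasurable_sum => k; exact: measurable_H.
have S0 w : (0 <= \sum_(k < N) H k w)%E.
  by apply: sume_ge0 => k _; exact: exp_displacement_ge0.
apply/integrableP; split; first exact: measurable_funTS.
apply: (@le_lt_trans _ _ (\int[P]_(w in D) (\sum_(k < N) H k w))%E); last first.
  rewrite -integral_finite_displacement// ge0_integral_sum//; last 2 first.
  - by move=> k; exact: measurable_H.
  - by move=> k w _; exact: exp_displacement_ge0.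
  by under eq_bigr do rewrite HL; rewrite sumEFin ltry.
apply: ge0_le_integral => //.
- by apply: measurableT_comp => //; exact: measurable_funTS.
- exact: measurable_funTS.
move=> w Dw /=; rewrite ger0_norm ?expR_ge0//.
have [k hk] : exists k : 'I_N, theta / N%:R * block_sum N w <= theta * s k w.
  apply: contrapT => /forallNP h.
  have Nr : 0 < N%:R :> R by rewrite ltr0n.
  have : \sum_(k < N) theta * s k w < \sum_(k < N) theta / N%:R * block_sum N w.
    apply: ltr_sum; first by apply/hasP; exists (Ordinal N0) => //; exact: mem_index_enum.
    by move=> k _; rewrite ltNge; apply/negP; exact: h.
  rewrite -mulr_sumr sumr_const card_ord -[X in _ < X]mulr_natl.
  rewrite [X in _ < X](_ : _ = theta * block_sum N w) ?ltxx//.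
  by field; rewrite gt_eqF.
rewrite [leRHS](bigD1 k)//; apply: (@le_trans _ _ (H k w)); last first.
  by rewrite leeDl// sume_ge0// => i _; exact: exp_displacement_ge0.
have <- : (fine (H k w))%:E = H k w.
  by rewrite fineK// ge0_fin_numE; [exact: Dw|exact: exp_displacement_ge0].
by rewrite lee_fin -expR_max_displacement// ler_expR.
Qed.

Lemma G_fin_num th n x : `|th| <= theta -> G th n x \is a fin_num.
Proof.
move=> tht; have [L L1 HL] := exp_moment.
by rewrite ge0_fin_numE ?G_ge0// (le_lt_trans (G_le _ _ L1 HL tht))// ltry.
Qed.

Lemma G_translate th n x c : G th n (x + cvec d c) = ((expR (th * c))%:E * G th n x)%E.
Proof.
rewrite /expected_orbit -ge0_integralZl//; last 2 first.
- exact: measurableT_comp (measurable_exp_phi th) (measurable_orbit1 iidA topA n x).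
- by move=> w _; exact: exp_phi_ge0.
apply: eq_integral => w _; rewrite (orbit_topical topA n w).2 /exp_phi tphi.2.
by rewrite -EFinM -expRD; congr (expR _)%:E; ring.
Qed.

Definition normalized_G th n x : R := expR (- (th * phi x)) * fine (G th n x).

(** This is how memory loss acts: after a rank one block all states differ by diagonal vectors,
    which [normalized_G] does not see. *)
Lemma normalized_G_translate th n x c :
  normalized_G th n (x + cvec d c) = normalized_G th n x.
Proof.
rewrite /normalized_G G_translate tphi.2.
have -> : fine ((expR (th * c))%:E * G th n x)%E = expR (th * c) * fine (G th n x).
  have := G_ge0 th n x; case: (G th n x) => [r|_|//] //=.
  by rewrite gt0_muley ?lte_fin ?expR_gt0// mulr0.
by rewrite mulrA -expRD; congr (expR _ * _); ring.
Qed.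

Lemma measurable_normalized_G th n :
  measurable_fun setT (fun x : rVm R d => normalized_G th n x).
Proof.
apply: measurable_funM; last first.
  by apply: measurableT_comp => //; exact: measurable_G.
apply: measurableT_comp => //; apply: measurable_funN; apply: measurable_funM => //.
exact: measurable_topical_fun.
Qed.

(** The Markov property after a block of [N] operators; it supplies the recursion [fS] of the
    abstract iteration. *)
Lemma normalized_G_block th n N x : `|th| <= theta ->
  normalized_G th (N + n) x = \int[P]_(w in D)
    (expR (th * (phi (orbit N x w) - phi x)) * normalized_G th n (orbit N x w)).
Proof.
move=> tht; rewrite /normalized_G.
have -> : fine (G th (N + n) x) =
    fine (\int[P]_(w in D) (fine (G th n (orbit N x w)))%:E)%E.
  rewrite expected_orbitD//; [|exact: measurable_exp_phi|exact: exp_phi_ge0].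
  rewrite {1}/expected_orbit integral_finite_displacement//; last 2 first.
  - apply: measurableT_comp (measurable_orbit1 iidA topA N x); exact: measurable_G.
  - by move=> w; exact: G_ge0.
  by congr fine; apply: eq_integral => w _; rewrite fineK// G_fin_num.
have mD := measurable_finite_displacement.
have mG : measurable_fun D (fun w => (fine (G th n (orbit N x w)))%:E).
  apply/measurable_EFinP; apply: measurable_funTS.
  apply: measurableT_comp => //.
  apply: measurableT_comp (measurable_orbit1 iidA topA N x); exact: measurable_G.
have G0 w : (0 <= (fine (G th n (orbit N x w)))%:E)%E.
  by rewrite lee_fin fine_ge0// G_ge0.
rewrite /Rintegral; transitivity (fine ((expR (- (th * phi x)))%:E *
    \int[P]_(w in D) (fine (G th n (orbit N x w)))%:E))%E.
  have : (0 <= \int[P]_(w in D) (fine (G th n (orbit N x w)))%:E)%E.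
    by apply: integral_ge0.
  case: (\int[P]_(w in D) _)%E => [r _|_|] //=.
  by rewrite gt0_muley ?lte_fin ?expR_gt0// mulr0.
rewrite -ge0_integralZl//.
congr fine; apply: eq_integral => w _; rewrite -EFinM; congr EFin.
rewrite mulrA -expRD; congr (expR _ * _); ring.
Qed.

Local Lemma measurable_bounded_block N (b : nat) :
  measurable (D `&` [set w | (block_sum N w <= b%:R)%R]).
Proof.
apply: measurableI; first exact: measurable_finite_displacement.
rewrite -[X in measurable X]setTI.
rewrite (_ : [set w | _] = (fun w => block_sum N w) @^-1` `]-oo, b%:R]).
  by apply: measurable_block_sum => //; exact: measurable_itv.
by apply/seteqP; split=> w /=; rewrite in_itv.
Qed.

(** As [b] grows these events exhaust [E0] up to a null set, so they cannot all be null. *)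
Lemma memory_loss_block N (E0 : set T) : measurable E0 -> (0 < P E0)%E ->
  exists b : nat, (0 < P (E0 `&` (D `&` [set w | (block_sum N w <= b%:R)%R])))%E.
Proof.
move=> mE0 PE0; have mD := measurable_finite_displacement.
apply: contrapT => /forallNP h.
have mb := measurable_bounded_block N.
have n0 (b : nat) : P.-negligible (E0 `&` (D `&` [set w | (block_sum N w <= b%:R)%R])).
  apply/negligibleP; first exact: measurableI.
  apply/eqP; rewrite eq_le measure_ge0 andbT leNgt; apply/negP; exact: h.
have nD : P.-negligible (~` D).
  apply/negligibleP; first exact: measurableC.
  have PD0 : P (~` D) = 0%E.
    by rewrite (probability_setC P mD) ae_finite_displacement subee.
  exact: PD0.
have : P.-negligible E0.
  apply: negligibleS (negligibleU nD (negligible_bigcup n0)) => w Ew.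
  have [Dw|nDw] := pselect (D w); [right|by left].
  exists (Num.truncn (block_sum N w)).+1 => //; split=> //; split=> //=.
  by apply/ltW; exact: truncnS_gt.
by move=> /negligibleP-/(_ mE0) E00; rewrite E00 ltxx in PE0.
Qed.

Lemma block_growth_rate : memory_loss P A ->
  exists (N : nat) (t : R) (Lam : R -> R) (C K h0 : R),
  [/\ (0 < N)%N /\ 0 < t <= theta, 0 <= K, 0 < h0,
      (forall th k x, `|th| <= t -> 0 < normalized_G th (k * N) x /\
         `|ln (normalized_G th (k * N) x) - k%:R * Lam th| <= C) &
      (forall th h, `|th| <= t -> `|th + h| <= t ->
         Lam (th + h) - Lam th <= K * `|h|) /\
      (forall th h, `|th| <= t -> `|th + h| <= t -> `|th - h| <= t ->
         `|h| <= h0 -> Lam (th + h) + Lam (th - h) - 2 * Lam th <= K * h ^+ 2)].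
Proof.
move=> [N [N0 [E0 [mE0 [PE0 rk]]]]]; have mD := measurable_finite_displacement.
have [b Pb] := memory_loss_block N mE0 PE0.
have Nr : 1 <= N%:R :> R by rewrite ler1n.
have eta0 : 0 < theta / N%:R by rewrite divr_gt0// ltr0n.
have eta_le : theta / N%:R <= theta by rewrite ler_pdivrMr ?ltr0n// ler_peMr// ltW.
have mo x := measurable_orbit1 iidA topA N x.
have mphi : measurable_fun setT (phi : rVm R d -> R) by exact: measurable_topical_fun.
have [||||||||||||||||t [Lam [C [K [h0 [/andP[t0 te] K0 h00 hf hl]]]]]] :=
  @exists_growth_rate _ T R P D (fun w => block_sum N w) (theta / N%:R)
  'rV[R]_d 0 (fun x w => phi (orbit N x w) - phi x) (fun x w => orbit N x w)
  (fun th k x => normalized_G th (k * N) x)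
  (E0 `&` (D `&` [set w | (block_sum N w <= b%:R)%R])) b%:R.
- exact: mD.
- exact: ae_finite_displacement.
- exact/measurable_funTS/measurable_block_sum.
- by move=> w _; exact: block_sum_ge0.
- exact: eta0.
- exact: integrable_block_sum.
- move=> x; apply: measurable_funTS; apply: measurable_funB => //.
  exact: measurableT_comp mphi (mo x).
- by move=> x w; exact: orbit_displacement.
- move=> th k x; apply: measurable_funTS.
  exact: measurableT_comp (measurable_normalized_G th (k * N)) (mo x).
- move=> th x; rewrite mul0n /normalized_G /expected_orbit /=.
  by rewrite probability_integral_cst /= -expRD addNr expR0.
- move=> th k x tht; rewrite mulSn; apply: normalized_G_block.
  exact: le_trans eta_le.
- by apply: measurableI => //; exact: measurable_bounded_block.
- by move=> w [_ []].
- by move=> w [_ []].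
- move=> th k x y w [Ew _]; have [c ->] := rk w Ew x y.
  exact: normalized_G_translate.
- exact: Pb.
- exists N, t, Lam, C, K, h0; split=> //; split=> //; rewrite t0.
  exact: le_trans eta_le.
Qed.

Local Lemma G_normalized th n x : `|th| <= theta ->
  G th n x = ((normalized_G th n x)%:E * exp_phi th x)%E.
Proof.
move=> tht; rewrite /exp_phi -EFinM /normalized_G mulrAC -expRD addNr expR0 mul1r.
by rewrite fineK// G_fin_num.
Qed.

Lemma normalized_G_le th r m x c : `|th| <= theta -> 0 <= c ->
  (forall y, normalized_G th m y <= c) ->
  normalized_G th (r + m) x <= c * normalized_G th r x.
Proof.
move=> tht c0 hc; rewrite /normalized_G mulrCA ler_wpM2l ?expR_ge0//.
rewrite -lee_fin EFinM !fineK ?G_fin_num//.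
rewrite expected_orbitD//; [|exact: measurable_exp_phi|exact: exp_phi_ge0].
apply: expected_orbit_le => //.
- exact: measurable_G.
- exact: measurable_exp_phi.
- by move=> y; exact: G_ge0.
- exact: exp_phi_ge0.
- by move=> y; rewrite G_normalized// -!EFinM lee_fin ler_wpM2r// expR_ge0.
Qed.

Lemma normalized_G_ge th r m x c : `|th| <= theta -> 0 <= c ->
  (forall y, c <= normalized_G th m y) ->
  c * normalized_G th r x <= normalized_G th (r + m) x.
Proof.
move=> tht c0 hc; rewrite /normalized_G mulrCA ler_wpM2l ?expR_ge0//.
rewrite -lee_fin EFinM !fineK ?G_fin_num//.
rewrite expected_orbitD//; [|exact: measurable_exp_phi|exact: exp_phi_ge0].
apply: expected_orbit_ge => //.
- exact: measurable_G.
- exact: measurable_exp_phi.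
- by move=> y; exact: G_ge0.
- exact: exp_phi_ge0.
- by move=> y; rewrite G_normalized// -!EFinM lee_fin ler_wpM2r// expR_ge0.
Qed.

Lemma normalized_G_exp_le (L : R) th n x : 1 <= L ->
  (forall n, (\int[P]_w H n w = L%:E)%E) -> `|th| <= theta ->
  normalized_G th n x <= L ^+ n.
Proof.
move=> L1 HL tht; rewrite /normalized_G expRN ler_pdivrMl ?expR_gt0// mulrC.
by rewrite -lee_fin fineK ?G_fin_num// G_le.
Qed.

Lemma moment_growth_rate x : memory_loss P A ->
  exists (t : R) (Lam : R -> R) (C K h0 : R),
  [/\ 0 < t <= theta, 0 <= K, 0 < h0,
      (forall th n, `|th| <= t -> 0 < normalized_G th n x /\
         `|ln (normalized_G th n x) - n%:R * Lam th| <= C) &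
      (forall th h, `|th| <= t -> `|th + h| <= t ->
         Lam (th + h) - Lam th <= K * `|h|) /\
      (forall th h, `|th| <= t -> `|th + h| <= t -> `|th - h| <= t ->
         `|h| <= h0 -> Lam (th + h) + Lam (th - h) - 2 * Lam th <= K * h ^+ 2)].
Proof.
move=> /block_growth_rate[N [t [Lam [C [K [h0 [[N0 /andP[t0 te]] K0 h00 hf [lip smooth]]]]]]]].
have [L L1 HL] := exp_moment.
have N1 : 0 < N%:R :> R by rewrite ltr0n.
(* One block is [N] operators, hence the division of the rate. [|Lam 0| + K * t] bounds [|Lam th|]
   and makes the error uniform in [th]. *)
exists t, (fun th => Lam th / N%:R), (2 * C + 2 * (`|Lam 0| + K * t) + N%:R * ln L),
  (K / N%:R), h0; split.
- by rewrite t0.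
- by rewrite divr_ge0// ltW.
- exact: h00.
- move=> th n tht; have thte := le_trans tht te.
  have Lamb : `|Lam th| <= `|Lam 0| + K * t.
    have tt0 : `|0 : R| <= t by rewrite normr0 ltW.
    have l1 := @lip 0 th tt0; rewrite add0r in l1; have {}l1 := l1 tht.
    have l2 := @lip th (- th) tht; rewrite subrr normrN in l2; have {}l2 := l2 tt0.
    have Kt : K * `|th| <= K * t by rewrite ler_wpM2l.
    have := ler_norm (Lam 0); have := ler_norm (- Lam 0); rewrite normrN => n1 n2.
    by rewrite ler_norml; apply/andP; split; lra.
  have C0 : 0 <= C by have [_] := hf th 0%N x tht; apply: le_trans.
  have [k [r [rN ->]]] : exists k r, (r <= N)%N /\ n = (r + k * N)%N.
    exists (n %/ N)%N, (n %% N)%N; split; first by rewrite ltnW// ltn_mod.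
    by rewrite addnC -divn_eq.
  have hb j y : expR (j%:R * Lam th - C) <= normalized_G th (j * N) y <=
      expR (j%:R * Lam th + C).
    have [p0] := hf th j y tht; rewrite ler_norml => /andP[q1 q2].
    by rewrite -[normalized_G _ _ _]lnK ?posrE// !ler_expR; apply/andP; split; lra.
  have u1 := normalized_G_le r x thte (expR_ge0 _) (fun y => (andP (hb k y)).2).
  have l1 := normalized_G_ge r x thte (expR_ge0 _) (fun y => (andP (hb k y)).1).
  have u2 := normalized_G_exp_le r x L1 HL thte.
  have LN0 : 0 <= L ^+ (N - r).
    by apply: exprn_ge0; exact: le_trans ler01 L1.
  have l2 := normalized_G_le r x thte LN0
    (fun y => normalized_G_exp_le (N - r) y L1 HL thte).
  have /andP[l3 _] := hb 1%N x; rewrite mul1n mul1r in l3.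
  rewrite (subnKC rN) in l2.
  have [g0 gb] := interpolated_growth N0 rN L1 C0 u1 l1 u2 (le_trans l3 l2).
  split=> //; apply: le_trans gb _.
  by rewrite lerD2r lerD2l ler_pM2l.
split=> [th h tht thh|th h tht thh thmh hh].
  by rewrite -mulrBl mulrAC ler_pM2r ?invr_gt0//; exact: lip.
have hs := smooth th h tht thh thmh hh.
rewrite (_ : _ - _ = (Lam (th + h) + Lam (th - h) - 2 * Lam th) / N%:R); last by ring.
by rewrite [leRHS]mulrAC ler_pM2r ?invr_gt0.
Qed.

End growth_of_moments.

(** * Lower bounds on probabilities from the central limit theorem *)

Lemma normal_prob_itv_gt0 {R : realType} (s a b : R) : s != 0 -> a < b ->
  (0 < normal_prob 0 s `[a, b])%E.
Proof.
move=> s0 ab; rewrite /normal_prob.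
have pdf0 x : 0 < normal_pdf 0 s x.
  by rewrite normal_pdfE// mulr_gt0 ?normal_peak_gt0 ?expR_gt0.
have [c _ cmin] := @EVT_min R (normal_pdf 0 s) a b (ltW ab)
  (continuous_subspaceT (continuous_normal_pdf s0)).
apply: (@lt_le_trans _ _ (\int[lebesgue_measure]_(x in `[a, b]) (cst (normal_pdf 0 s c)%:E x))%E).
  rewrite integral_cst//= lebesgue_measure_itv/= lte_fin ab -EFinB -EFinM lte_fin.
  by rewrite mulr_gt0// subr_gt0.
apply: ge0_le_integral => //.
- by move=> x _; rewrite lee_fin ltW.
- by apply/measurable_EFinP/measurable_funTS; exact: measurable_normal_pdf.
Qed.

Section matrix_norm.
Context {R : realType} {d : nat}.
Implicit Type x : 'rV[R]_d.

Lemma coord_le_norm x i : `|x ord0 i| <= `|x|.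
Proof.
rewrite [leRHS]mx_normrE.
exact: (le_bigmax _ (fun ij : 'I_1 * 'I_d => `|x ij.1 ij.2|) (ord0, i)).
Qed.

Lemma norm_cvec_le (c : R) : `|cvec d c| <= `|c|.
Proof.
rewrite [leLHS]mx_normrE; apply: bigmax_le => // ij _.
by rewrite /cvec mxE.
Qed.

Lemma measurable_norm_rV {dT} {T : measurableType dT} (X : T -> 'rV[R]_d) :
  (forall i, measurable_fun setT (fun w => X w ord0 i)) ->
  measurable_fun setT (fun w => `|X w|).
Proof.
move=> mX; rewrite (_ : (fun w => _) =
    fun w => \big[Order.max/0]_ij `|X w ij.1 ij.2|).
  2: by apply/funext => w; exact: mx_normrE.
elim: (index_enum _) => [|[i j] l IH].
  rewrite (_ : (fun w => _) = cst 0)//.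
  by apply/funext => w; rewrite big_nil.
rewrite (_ : (fun w => _) = fun w => Order.max `|X w i j|
    (\big[Order.max/0]_(ij <- l) `|X w ij.1 ij.2|)).
  2: by apply/funext => w; rewrite big_cons.
apply: measurable_maxr => //; apply: measurableT_comp => //.
by rewrite (ord1 i); exact: mX.
Qed.

End matrix_norm.

Section central_limit_lower_bound.
Context {dT} {T : measurableType dT} {R : realType} {d : nat}.
Variables (P : probability T R) (Y : nat -> T -> 'rV[R]_d) (sigma : R).
Hypothesis mY : forall n i, measurable_fun setT (fun w => Y n w ord0 i).
Hypothesis sigma0 : sigma != 0.
Hypothesis clt : forall f : 'rV[R]_d -> R, continuous f ->
  (exists M : R, forall x, `|f x| <= M) ->
  (fun n : nat => (\int[P]_w (f (Y n w))%:E)%E) @ \oo -->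
  (\int[normal_prob 0 sigma]_g (f (cvec d g))%:E)%E.

(** Weak convergence is given for continuous test functions, so the tent [f] replaces the indicator
    of a ball: it is at least 1 within distance 1 of the centre and vanishes beyond distance 2. *)
Lemma clt_lower_bound (e : R) (U : nat -> set T) : (forall n, measurable (U n)) ->
  (forall n w, (forall i, `|Y n w ord0 i - e| <= 2) -> U n w) ->
  exists2 r : R, 0 < r & \forall n \near \oo, r <= fine (P (U n)).
Proof.
move=> mU YU.
pose f (x : 'rV[R]_d) : R := Num.max 0 (2 - `|x - cvec d e|).
have f0 x : 0 <= f x by rewrite le_max lexx.
have f2 x : f x <= 2 by rewrite ge_max; apply/andP; split; [lra|have := normr_ge0 (x - cvec d e); lra].
have cf : continuous f.
  have c1 : continuous (fun x : 'rV[R]_d => 2 - `|x - cvec d e|).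
    have c0 : continuous (fun x : 'rV[R]_d => x - cvec d e).
      by move=> x; apply: (@continuousB _ _ _ id (fun=> cvec d e)); [exact: cvg_id|exact: cst_continuous].
    have c2 : continuous (fun r : R => 2 - r).
      by move=> r; apply: cvgB; [exact: cvg_cst|exact: cvg_id].
    move=> x; have cn := @continuous_comp _ _ _ (fun x : 'rV[R]_d => x - cvec d e)
      (fun y : 'rV[R]_d => `|y|) x (c0 x) (@norm_continuous _ _ _).
    exact: (@continuous_comp _ _ _ _ (fun r : R => 2 - r) x cn (c2 _)).
  by move=> x; apply: (@continuous_max _ _ (fun=> 0) _ x); [exact: cst_continuous|exact: c1].
have mf d' (T' : measurableType d') (X : T' -> 'rV[R]_d) :
    (forall i, measurable_fun setT (fun w => X w ord0 i)) ->
    measurable_fun setT (fun w => (f (X w))%:E).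
  move=> mX; apply/measurable_EFinP; apply: measurable_maxr => //.
  apply: measurable_funB => //; apply: measurable_norm_rV => i.
  rewrite (_ : (fun w => _) = (fun w => X w ord0 i - e)).
    exact: measurable_funB.
  by apply/funext => w; rewrite /cvec !mxE.
have fb : exists M, forall x, `|f x| <= M by exists 2 => x; rewrite ger0_norm.
have := clt cf fb.
set I := (\int[normal_prob 0 sigma]_g _)%E => fI.
have mfc : measurable_fun setT (fun g : R => (f (cvec d g))%:E).
  apply: mf => i; rewrite (_ : (fun g => _) = id)//.
  by apply/funext => g; rewrite /cvec mxE.
have I0 : (0 < I)%E.
  apply: (@lt_le_trans _ _ (normal_prob 0 sigma `[e - 1, e + 1])).
    by apply: normal_prob_itv_gt0 => //; lra.
  rewrite -[X in normal_prob _ _ X]setIT -integral_indic//.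
  apply: ge0_le_integral => //.
  - by apply/measurable_EFinP; exact: measurable_indic.
  - move=> g _; rewrite lee_fin indicE; have [|_] := boolP (g \in _) => //.
    rewrite inE/= in_itv/= => /andP[g1 g2]; rewrite le_max; apply/orP; right.
    have : `|cvec d g - cvec d e| <= 1.
      rewrite (_ : _ - _ = cvec d (g - e)); last by apply/matrixP => i j; rewrite /cvec !mxE.
      by apply: le_trans (norm_cvec_le _) _; rewrite ler_norml; apply/andP; split; lra.
    by rewrite /=; lra.
have I2 : (I <= 2%:E)%E.
  rewrite -[leRHS](probability_integral_cst (normal_prob 0 sigma)).
  by apply: ge0_le_integral => // g _; rewrite lee_fin.
have Ifin : I \is a fin_num by rewrite ge0_fin_numE ?ltW// (le_lt_trans I2)// ltry.
have fineI : 0 < fine I by rewrite fine_gt0// I0/= (le_lt_trans I2)// ltry.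
(* Eventually the mean of [f] is at least half its limit, and it is at most [2 * P (U n)]. *)
exists (fine I / 4); first by rewrite divr_gt0.
move: fI; rewrite -(fineK Ifin) => /fine_cvg /cvgr_ge /(_ (fine I / 2)) h.
have {}h := h (_ : fine I / 2 < fine I).
have : \forall n \near \oo, fine I / 2 <= fine (\int[P]_w (f (Y n w))%:E)%E.
  by apply: h; lra.
apply: filterS => n hn.
have : fine (\int[P]_w (f (Y n w))%:E)%E <= 2 * fine (P (U n)).
  have PU : (P (U n) = (fine (P (U n)))%:E)%E by rewrite fineK// fin_num_measure.
  have le : (\int[P]_w (f (Y n w))%:E <= (2 * fine (P (U n)))%:E)%E.
    rewrite EFinM -PU -[X in (_ * P X)%E]setIT -integral_indic// -ge0_integralZl//; last first.
      by apply/measurable_EFinP; exact: measurable_indic.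
    apply: ge0_le_integral => //.
    - by move=> w _; rewrite lee_fin.
    - exact: mf.
    - by apply: measurable_funeM; apply/measurable_EFinP; exact: measurable_indic.
    - move=> w _; rewrite -EFinM lee_fin indicE; have [_|nU] := boolP (w \in U n).
        by rewrite mulr1.
      rewrite mulr0 ge_max lexx/= subr_le0 leNgt; apply/negP => lt2.
      move/negP: nU; apply; rewrite inE; apply: YU => i.
      have := coord_le_norm (Y n w - cvec d e) i; rewrite /cvec !mxE.
      by move=> /le_trans; apply; exact: ltW.
  have ge : (0 <= \int[P]_w (f (Y n w))%:E)%E by apply: integral_ge0 => w _; rewrite lee_fin.
  have fi : (\int[P]_w (f (Y n w))%:E)%E \is a fin_num.
    by rewrite ge0_fin_numE// (le_lt_trans le)// ltry.
  by rewrite -lee_fin fineK.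
by lra.
Qed.

End central_limit_lower_bound.

(** * The centred process and the positivity of its rate *)

Section large_deviations.
Context {dT} {T : measurableType dT} {R : realType} {d : nat}.
Variables (P : probability T R) (A : nat -> T -> 'rV[R]_d -> 'rV[R]_d).
Hypothesis iidA : iid_ops P A.
Hypothesis topA : forall n w, topical_op (A n w).
Variables (phi : 'rV[R]_d -> R) (gamma : R).
Hypothesis tphi : topical_fun phi.
Local Notation Z n w := (phi (traj A (fun=> 0) n w) - n%:R * gamma).

Lemma measurable_centered n : measurable_fun setT (fun w => Z n w).
Proof.
apply: measurable_funB => //.
exact: measurableT_comp (measurable_topical_fun tphi) (measurable_orbit1 iidA topA n 0).
Qed.

(** Centring adds a linear term to the rate: it costs [|gamma|] in the Lipschitz constant and
    cancels in second differences. [F 0 n = 1] for all [n] forces [Lam 0 = 0]. *)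
Lemma centered_growth_rate (theta : R) : 0 < theta ->
  (\int[P]_w expeR (theta%:E *
    ereal_sup (range (fun x => (`|phi (A 0 w x) - phi x|)%:E))) < +oo)%E ->
  memory_loss P A ->
  exists (t : R) (Lam : R -> R) (F : R -> nat -> R) (C K h0 : R),
  [/\ 0 < t, 0 <= K, 0 < h0, Lam 0 = 0 &
   [/\ (forall th h, `|th| <= t -> `|th + h| <= t -> Lam (th + h) - Lam th <= K * `|h|),
      (forall th h, `|th| <= t -> `|th + h| <= t -> `|th - h| <= t ->
         `|h| <= h0 -> Lam (th + h) + Lam (th - h) - 2 * Lam th <= K * h ^+ 2),
      (forall (th : R) n, `|th| <= t -> (\int[P]_w (expR (th * Z n w))%:E = (F th n)%:E)%E),
      (forall (th : R) n, `|th| <= t -> 0 < F th n) &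
      (forall (th : R) n, `|th| <= t -> `|ln (F th n) - n%:R * Lam th| <= C)]].
Proof.
move=> theta0 mom ml.
have [t [Lam [C [K [h0 [/andP[t0 te] K0 h00 hg [lip smooth]]]]]]] :=
  moment_growth_rate iidA topA tphi theta0 mom 0 ml.
pose F (th : R) n := expR (th * phi 0 - th * (n%:R * gamma)) * normalized_G P A phi th n 0.
have F0 th n : `|th| <= t -> 0 < F th n.
  by move=> tht; have [g0 _] := hg th n tht; rewrite mulr_gt0// expR_gt0.
have FE th n : `|th| <= t -> (\int[P]_w (expR (th * Z n w))%:E = (F th n)%:E)%E.
  move=> tht; have thte := le_trans tht te.
  rewrite /F /normalized_G mulrA -expRD.
  rewrite (_ : _ + _ = - (th * (n%:R * gamma))); last by ring.
  rewrite EFinM fineK; last by apply: (G_fin_num iidA topA tphi theta0 mom).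
  rewrite /expected_orbit -ge0_integralZl//; last 2 first.
  - exact: measurableT_comp (measurable_exp_phi tphi th) (measurable_orbit1 iidA topA n 0).
  - by move=> w _; exact: exp_phi_ge0.
  apply: eq_integral => w _; rewrite /exp_phi -EFinM -expRD; congr (expR _)%:E; ring.
have FL th n : `|th| <= t ->
    `|ln (F th n) - n%:R * (Lam th - th * gamma)| <= C + t * `|phi 0|.
  move=> tht; have [g0 gb] := hg th n tht.
  rewrite lnM ?posrE ?expR_gt0// expRK.
  rewrite (_ : _ - _ = (ln (normalized_G P A phi th n 0) - n%:R * Lam th) + th * phi 0); last by ring.
  by apply: le_trans (ler_normD _ _) _; rewrite lerD// normrM ler_wpM2r.
exists t, (fun th => Lam th - th * gamma), F, (C + t * `|phi 0|), (K + `|gamma|), h0.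
split=> //.
- by rewrite addr_ge0.
- have t00 : `|0 : R| <= t by rewrite normr0 ltW.
  have F1 n : F 0 n = 1.
    apply: EFin_inj; rewrite -FE//.
    under eq_integral do rewrite mul0r expR0.
    exact: probability_integral_cst.
  have h n := FL 0 n t00; rewrite mul0r subr0 in h.
  rewrite mul0r subr0; apply/eqP; rewrite eq_le; apply/andP; split.
    apply: (@natmul_bounded_le0 _ _ (C + t * `|phi 0|)) => n.
    by have := h n; rewrite F1 ln1 sub0r normrN => /(le_trans (ler_norm _)).
  rewrite -oppr_le0; apply: (@natmul_bounded_le0 _ _ (C + t * `|phi 0|)) => n.
  by have := h n; rewrite F1 ln1 sub0r mulrN => /(le_trans (ler_norm _)).
split=> // [th h tht thh|th h tht thh thmh hh].
  have a := lip th h tht thh.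
  have b : - (gamma * h) <= `|gamma| * `|h| by rewrite -normrM -normrN ler_norm.
  rewrite [leRHS]mulrDl; apply: le_trans (lerD a b); rewrite le_eqVlt; apply/orP; left.
  by apply/eqP; ring.
rewrite (_ : _ - _ = Lam (th + h) + Lam (th - h) - 2 * Lam th); last by ring.
apply: le_trans (smooth th h tht thh thmh hh) _.
by rewrite ler_wpM2r ?sqr_ge0// lerDl.
Qed.

(* If the growth rate vanished or were negative at some [th != 0], then
   E[exp(th Z_n)] would stay bounded, and Chernoff's bound would contradict the
   central limit theorem. *)
Lemma centered_growth_rate_gt0 (sigma C th la : R) (F : nat -> R) :
  sigma != 0 ->
  (forall f : 'rV[R]_d -> R, continuous f -> (exists M : R, forall x, `|f x| <= M) ->
     (fun n : nat => (\int[P]_w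
        (f ((Num.sqrt n%:R)^-1 *: (traj A (fun _ => 0) n w - cvec d (n%:R * gamma))))%:E)%E)
     @ \oo --> (\int[normal_prob 0 sigma]_g (f (cvec d g))%:E)%E) ->
  th != 0 -> (forall n, (\int[P]_w (expR (th * Z n w))%:E = (F n)%:E)%E) ->
  (forall n, 0 < F n) -> (forall n, `|ln (F n) - n%:R * la| <= C) -> 0 < la.
Proof.
move=> sigma0 clt th0 FE F0 FL; rewrite ltNge; apply/negP => la0.
(* With the sign of [th] factored out, both cases concern the upper tail of [s * Z] under the tilt
   [|th|]. *)
pose s := Num.sg th.
have thE : `|th| * s = th by rewrite mulrC -numEsg.
have s1 : s = 1 \/ s = -1.
  by move: th0; rewrite neq_lt /s => /orP[/ltr0_sg ->|/gtr0_sg ->]; [right|left].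
pose U n := [set w | Num.sqrt n%:R + s * phi 0 <= s * Z n w].
have mZ n : measurable_fun setT (fun w => s * Z n w).
  by apply: measurable_funM => //; exact: measurable_centered.
have mU n : measurable (U n).
  rewrite (_ : U n = (fun w => s * Z n w) @^-1` `[Num.sqrt n%:R + s * phi 0, +oo[).
    by rewrite -[X in measurable X]setTI; apply: mZ => //; exact: measurable_itv.
  by apply/seteqP; split=> w /=; rewrite in_itv/= andbT.
(* Numbers within 2 of [3 * s] are at least 1 once multiplied by [s]. So all coordinates deviate by
   at least [sqrt n] in direction [s], and topicality passes this on to [phi]. *)
have [||r r0 hr] := @clt_lower_bound _ _ _ _ P _ sigma _ sigma0 clt (3 * s) U mU.
- move=> n i; rewrite (_ : (fun w => _) = fun w => (Num.sqrt n%:R)^-1 *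
      (traj A (fun=> 0) n w ord0 i - n%:R * gamma)); last first.
    by apply/funext => w; rewrite /cvec !mxE.
  apply: measurable_funM => //; apply: measurable_funB => //.
  exact: measurableT_comp (@measurable_coord _ _ i) (measurable_orbit1 iidA topA n 0).
- move=> n w hY; rewrite /U /=.
  pose y := traj A (fun=> 0) n w - cvec d (n%:R * gamma).
  have -> : Z n w = phi y.
    rewrite /y (_ : - cvec d _ = cvec d (- (n%:R * gamma))) ?tphi.2//.
    by apply/matrixP => i j; rewrite /cvec !mxE.
  (* At [n = 0] the scaling factor is 0 by convention, and [U 0] is the whole space. *)
  case: n => [|n] in hY y *.
    rewrite /y sqrtr0 add0r /= mul0r /cvec (_ : const_mx 0 = 0) ?subr0//.
  have n0 : 0 < Num.sqrt (n.+1%:R : R) by rewrite sqrtr_gt0 ltr0n.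
  have hy i : s * Num.sqrt n.+1%:R <= y ord0 i /\ s = 1 \/
              y ord0 i <= s * Num.sqrt n.+1%:R /\ s = -1.
    have := hY i; rewrite -/y mxE; move: (y) => z; clear y.
    rewrite (_ : z ord0 i = Num.sqrt n.+1%:R * ((Num.sqrt n.+1%:R)^-1 * z ord0 i)); last first.
      by rewrite mulrA mulfV ?mul1r// gt_eqF.
    rewrite mulKf ?gt_eqF//; move: (_^-1 * _) => u; rewrite ler_norml => /andP[h1 h2].
    case: s1 => s1; rewrite s1 in h1 h2 *; [left|right]; split => //.
      by rewrite mulrC ler_pM2l//; lra.
    by rewrite mulrC ler_pM2r//; lra.
  case: s1 => s1; rewrite s1 ?mul1r ?mulN1r.
    rewrite addrC -tphi.2 tphi.1// => i; have [[h _]|[_ h]] := hy i; last by lra.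
    by rewrite add0r /cvec mxE; move: h; rewrite s1 mul1r.
  suff : phi y <= phi (0 + cvec d (- Num.sqrt n.+1%:R)) by rewrite tphi.2; lra.
  apply: tphi.1 => i.
  have [[_ h]|[h _]] := hy i; first by lra.
  by rewrite add0r /cvec [leRHS]mxE; move: h; rewrite s1 mulN1r.
have ub n : fine (P (U n)) <= expR (- (`|th| * (Num.sqrt n%:R + s * phi 0)) + C).
  rewrite expRD; have := @chernoff_bound _ _ _ P _ (mZ n) (U n) `|th| (Num.sqrt n%:R + s * phi 0) (F n) (mU n).
  move=> h; apply: le_trans (h _ _ _) _ => //.
    by under eq_integral do rewrite mulrA thE.
  rewrite ler_wpM2l ?expR_ge0// -[leLHS]lnK ?posrE// ler_expR.
  have := FL n; rewrite ler_norml => /andP[_].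
  have : n%:R * la <= 0 by rewrite mulr_ge0_le0.
  by lra.
have [N _ hN] := hr.
(* Once [m > b], the Chernoff bound [exp(C - |th| (m + s phi(0)))] is below [r]. The time is taken
   to be [m ^ 2], so that its square root is [m]. *)
pose b := (C - `|th| * (s * phi 0) - ln r) / `|th|.
pose m := (N + Num.truncn b).+1.
have hm : (N <= m ^ 2)%N.
  by rewrite -mulnn (leq_trans _ (leq_pmulr m (ltn0Sn _)))// leqW// leq_addr.
have := le_trans (hN _ hm) (ub _); rewrite -[leLHS]lnK ?posrE// ler_expR natrX sqrtr_sqr (ger0_norm (ler0n R m)).
have bm : b < m%:R.
  by rewrite (lt_le_trans (truncnS_gt _))// ler_nat ltnS leq_addl.
have thp : 0 < `|th| by rewrite normr_gt0.
move: bm; rewrite (ltr_pdivrMr _ _ thp); move: thp.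
by move: (m%:R : R) (ln r) `|th| (s * phi 0) => x y z v z0 b1 b2; lra.
Qed.

End large_deviations.

(** * Bounded initial states and conclusion *)

Section initial_state.
Context {dT} {T : measurableType dT} {R : realType} {d : nat}.
Variables (P : probability T R) (A : nat -> T -> 'rV[R]_d -> 'rV[R]_d).
Hypothesis iidA : iid_ops P A.
Hypothesis topA : forall n w, topical_op (A n w).
Variable phi : 'rV[R]_d -> R.
Hypothesis tphi : topical_fun phi.
Variable X0 : T -> 'rV[R]_d.

Lemma measurable_topical_traj n : random_vec X0 ->
  measurable_fun setT (fun w => phi (traj A X0 n w)).
Proof.
move=> rX; rewrite (_ : (fun w => _) =
    (fun w => phi (traj A (fun=> X0 w) n w))); last first.
  by apply/funext => w; rewrite traj_orbit.
have mX : measurable_fun setT (X0 : T -> rVm R d) by exact: measurable_rVP.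
apply: measurableT_comp (measurable_topical_fun tphi) _.
apply: (measurableT_comp (measurable_orbit iidA topA n)
  (_ : measurable_fun setT (fun w => (w, X0 w : rVm R d)))).
exact: measurable_fun_pair.
Qed.

(** [phi] composed with a product of operators is nonexpansive, so moving the start to 0 costs at
    most its size, uniformly in time. *)
Lemma topical_traj_dist M n w : (forall i, `|X0 w ord0 i| <= M) ->
  `|phi (traj A X0 n w) - phi (traj A (fun=> 0) n w)| <= Num.max M 0.
Proof.
move=> hM; rewrite (traj_orbit A X0).
apply: (topical_fun_dist (topical_fun_comp tphi (orbit_topical topA n w))) => i.
by rewrite mxE subr0 le_max hM.
Qed.

End initial_state.

Unset Implicit Arguments.
Set Strict Implicit.
Set Printing Implicit Defensive.

Theorem theorem2p6 (dT : measure_display) (T : measurableType dT) (R : realType)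
  (d : nat) (P : probability T R) (A : nat -> T -> 'rV[R]_d -> 'rV[R]_d)
  (phi : 'rV[R]_d -> R) (gamma sigma2 : R) :
  iid_ops P A ->
  (forall n w, topical_op (A n w)) ->
  memory_loss P A ->
  topical_fun phi ->
  (* exponential moment of sup_x |phi(A(1)x) - phi(x)| *)
  (exists theta : R, 0 < theta /\
     (\int[P]_w expeR (theta%:E *
        ereal_sup (range (fun x => (`|phi (A 0 w x) - phi x|)%:E))) < +oo)%E) ->
  (* gamma is the Lyapunov exponent: x(n,0)/n --> gamma 1 a.s. *)
  {ae P, forall w, forall i : 'I_d,
     (fun n : nat => traj A (fun _ => 0) n w ord0 i / n%:R) @ \oo --> gamma} ->
  (* sigma2 is the CLT variance: (x(n,0) - n gamma 1)/sqrt n converges weakly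
     to G 1 with G ~ N(0, sigma2) *)
  (forall f : 'rV[R]_d -> R, continuous f -> (exists M : R, forall x, `|f x| <= M) ->
     (fun n : nat => (\int[P]_w
        (f ((Num.sqrt n%:R)^-1 *: (traj A (fun _ => 0) n w - cvec d (n%:R * gamma))))%:E)%E)
     @ \oo --> (\int[normal_prob 0 (Num.sqrt sigma2)]_g (f (cvec d g))%:E)%E) ->
  0 < sigma2 ->
  exists (c : R -> R) (delta : R), 0 < delta /\
    (forall e, `|e| < delta -> 0 <= c e) /\
    (forall e, `|e| < delta -> c e = 0 <-> e = 0) /\
    strictly_convex_on [set e | `|e| < delta] c /\
    exists eps0 : R, 0 < eps0 /\ eps0 <= delta /\
      forall X0 : T -> 'rV[R]_d,
        random_vec X0 ->
        (exists M : R, forall w i, `|X0 w ord0 i| <= M) ->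
        indep_of_ops P X0 A ->
        forall eps : R, 0 < eps < eps0 ->
          ((fun n : nat => (lne (P [set w | (phi (traj A X0 n w) - n%:R * gamma > n%:R * eps)%R])
                            * (n%:R^-1)%:E)%E)
             @ \oo --> (- c eps)%:E) /\
          ((fun n : nat => (lne (P [set w | (phi (traj A X0 n w) - n%:R * gamma < - (n%:R * eps))%R])
                            * (n%:R^-1)%:E)%E)
             @ \oo --> (- c (- eps))%:E).
Proof.
move=> iidA topA ml tphi [theta [theta0 mom]] _ clt sigma2_gt0.
have [t [Lam [F [C [K [h0 [t0 K0 h00 Lam0 [lip smooth FE F0 FL]]]]]]]] :=
  centered_growth_rate iidA topA gamma tphi theta0 mom ml.
have Lam_gt0 th : `|th| <= t -> th != 0 -> 0 < Lam th.
  move=> tht th0; apply: (centered_growth_rate_gt0 iidA topA tphi _ clt th0).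
  - by rewrite gt_eqF// sqrtr_gt0.
  - by move=> n; exact: FE.
  - by move=> n; exact: F0.
  - by move=> n; exact: FL.
have r0 := legendre_radius_gt0 t0 Lam_gt0.
exists (legendre Lam t), (legendre_radius Lam t); split=> //; split.
  by move=> e _; exact: legendre_ge0 t0 K0 lip Lam0 e.
split; first by move=> e er; exact: legendre_eq0 t0 K0 h00 lip smooth Lam0 Lam_gt0 e er.
split; first exact: legendre_strictly_convex t0 K0 h00 lip smooth Lam0.
exists (legendre_radius Lam t); split=> //; split=> //.
move=> X0 rX [M hM] _ eps eps_r.
have mZ := measurable_centered iidA topA gamma tphi.
have mX n : measurable_fun setT (fun w => phi (traj A X0 n w) - n%:R * gamma).
  by apply: measurable_funB => //; exact: (measurable_topical_traj iidA topA tphi).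
have dX n w : `|phi (traj A X0 n w) - phi (traj A (fun=> 0) n w)| <= Num.max M 0.
  by apply: topical_traj_dist.
have M0 : 0 <= Num.max M 0 by rewrite le_max lexx orbT.
split.
  (* The slack is the distance between the values of [phi] along the orbits started at [X0] and at
     0. *)
  apply: (gartner_ellis_ub t0 K0 h00 lip smooth Lam0 Lam_gt0 mZ FE F0 FL eps_r M0).
  - move=> n; rewrite (_ : [set w | _] = (fun w => phi (traj A X0 n w) - n%:R * gamma) @^-1` `]n%:R * eps, +oo[).
      by rewrite -[X in measurable X]setTI; apply: mX => //; exact: measurable_itv.
    by apply/seteqP; split=> w /=; rewrite in_itv/= andbT.
  - by move=> n w /=; have := dX n w; rewrite ler_norml => /andP[]; lra.
  - by move=> n w /=; have := dX n w; rewrite ler_norml => /andP[]; lra.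
rewrite -legendreN.
(* The lower tail is the upper tail of the opposite process, whose rate is
   [fun th => Lam (- th)]. *)
apply: (@gartner_ellis_ub _ _ _ P (fun n w => - (phi (traj A (fun=> 0) n w) - n%:R * gamma))
  (fun th => F (- th)) _ t C K h0 t0 K0 h00 _ _ _ _ _ _ _ _ eps (Num.max M 0) _ _ M0).
- move=> th h tht thh; rewrite opprD (le_trans (lip _ _ _ _)) ?normrN//.
  by rewrite -opprD normrN.
- move=> th h tht thh thmh hh; rewrite opprD opprB -(sqrrN h).
  have := smooth (- th) (- h); rewrite !normrN opprK -opprD normrN (addrC (- th)) distrC.
  by move/(_ tht thh thmh hh); rewrite (addrC h).
- by rewrite oppr0.
- by move=> th tht th0; rewrite Lam_gt0 ?normrN ?oppr_eq0.
- by move=> n; apply: measurable_funN; exact: mZ.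
- move=> th n tht; rewrite -FE ?normrN//; apply: eq_integral => w _.
  by rewrite mulrN mulNr.
- by move=> th n tht; rewrite F0 ?normrN.
- by move=> th n tht; rewrite FL ?normrN.
(* The radius is symmetric in the two ends of the interval, so reflection preserves it. *)
- by rewrite /legendre_radius opprK minC; exact: eps_r.
- move=> n; rewrite (_ : [set w | _] = (fun w => phi (traj A X0 n w) - n%:R * gamma) @^-1` `]-oo, - (n%:R * eps)[).
    by rewrite -[X in measurable X]setTI; apply: mX => //; exact: measurable_itv.
  by apply/seteqP; split=> w /=; rewrite in_itv.
- by move=> n w /=; have := dX n w; rewrite ler_norml => /andP[]; lra.
- by move=> n w /=; have := dX n w; rewrite ler_norml => /andP[]; lra.
Qed.
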